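(* Let $(\mathcal{A},E,\mathcal{B})$ be an operator-valued, tracial probability space where $\mathcal{B}$ is finite dimensional. For $\lambda\in\mathbb{R}^{+}$ define $$d_n(\lambda)=i\lambda\begin{bmatrix}1&0\\0&-1\end{bmatrix}\otimes 1_n\in\Omega_n(\mathcal{B}).$$ Let $\{X_i\}_{i\in I}\subset\tilde{\mathcal{A}}^{sa}$ be a family of random variables whose scalar distributions $\{\tau\circ e_{X_i}\}_{i\in I}$ form a tight family. Then there exist a sequence $\lambda_n\in\mathbb{R}^{+}$, decreasing over $n$, and a positive function $p_n:(0,\lambda_n)\to\mathbb{R}^{+}$, decreasing as $\lambda\downarrow 0$, such that $p_n(\lambda)=O(\lambda)$ and the set $B_{p_n(\lambda)}(d_n(\lambda))$ is in the domain of $\mathcal{R}_{X_i}$ for all $n\in\mathbb{N}$, all $0<\lambda<\lambda_n$ and all $i\in I$.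
   Context: An operator-valued, tracial probability space $(\mathcal{A},E,\mathcal{B})$ consists of a von Neumann algebra $\mathcal{A}$ with a trace $\tau$ (a faithful normal tracial state), a unital von Neumann subalgebra $\mathcal{B}\subset\mathcal{A}$, and a $\tau$-preserving conditional expectation $E:\mathcal{A}\to\mathcal{B}$ (unital, $\mathcal{B}$-bimodular, completely positive). $E_m=E\otimes1_m$ is $E$ applied entrywise to $M_m(\mathcal{A})$. $\tilde{\mathcal{A}}$ is the $*$-algebra of closed densely defined operators affiliated with $\mathcal{A}$, $\tilde{\mathcal{A}}^{sa}$ is its set of self-adjoint elements, and $e_X$ is the spectral measure of $X\in\tilde{\mathcal{A}}^{sa}$, so that $\tau\circ e_X$ is a probability measure on $\mathbb{R}$. For $X\in\tilde{\mathcal{A}}^{sa}$ the Cauchy transform is $G_X=\{G_X^{(m)}\}_{m\ge1}$, $G_X^{(m)}(b)=E_m[(b-X\otimes1_m)^{-1}]$, defined for all $b\in M_m(\mathcal{B})$ in the resolvent set (i.e. such that $b-X\otimes 1_m$ has an inverse in $M_m(\mathcal{A})$). The $\mathcal{R}$-transform is $\mathcal{R}_X^{(m)}(b)=(G_X^{(m)})^{\langle-1\rangle}(b)-b^{-1}$, where $\langle-1\rangle$ denotes the compositional inverse; its domain is where this inverse is defined. Since $d_n(\lambda)\in M_{2n}(\mathcal{B})$, the relevant level is $m=2n$. $\mathcal{B}^{+}$ (resp. $\mathcal{B}^-$) is the set of $b\in\mathcal{B}$ with $\Im(b)=(b-b^* )/2i>\epsilon1$ (resp. $<-\epsilon1$)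 for some $\epsilon>0$. $\Omega_n(\mathcal{B})\subset M_{2n}(\mathcal{B})$ is the union of all open norm balls $B_r(b)$, where $b=\mathrm{diag}(b_1,\dots,b_{2n})$ with $b_1,b_3,\dots,b_{2n-1}\in\mathcal{B}^+$, $b_2,b_4,\dots,b_{2n}\in\mathcal{B}^-$, and $r>0$ is the largest constant with $r\le|\Im(b_i)|$ for all $i$. In $d_n(\lambda)$ the diagonal entries $i\lambda,-i\lambda$ alternate. $B_p(d)$ denotes the open norm ball of radius $p$ about $d$ in $M_{2n}(\mathcal{B})$. *)

(* Defs.v *)
From HB Require Import structures.
From mathcomp Require Import all_boot all_order all_algebra.
From mathcomp Require Import complex.
From mathcomp Require Import all_classical all_reals all_analysis.

Set Implicit Arguments.
Unset Strict Implicit.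
Unset Printing Implicit Defensive.

Import Order.TTheory GRing.Theory Num.Theory.
Import numFieldNormedType.Exports.

Local Open Scope classical_set_scope.
Local Open Scope ring_scope.
Local Open Scope complex_scope.

(* As everywhere in MathComp, the inner product is linear in its first
   argument and conjugate-linear in the second one. *)
HB.mixin Record CompleteNormedModule_isHilbert (R : realType) H
    of CompleteNormedModule R[i] H := {
  hdot : {dot H for (@Num.conj R[i])};
  hnormE : forall x : H, `|x| ^+ 2 = hdot x x
}.

#[short(type="hilbertType")]
HB.structure Definition Hilbert (R : realType) :=
  {H of CompleteNormedModule_isHilbert R H & CompleteNormedModule R[i] H}.

Notation "'<|' x ',' y '|>'" := (hdot x y)
  (at level 0, x at level 99, y at level 99, format "'<|' x ,  y '|>'") : ring_scope.

Section BoundedOperators.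
Variables (R : realType) (H : hilbertType R).

Record bop := Bop {
  bop_fun :> H -> H;
  bop_linear : linear bop_fun;
  bop_continuous : continuous bop_fun
}.

HB.instance Definition _ := gen_eqMixin bop.
HB.instance Definition _ := gen_choiceMixin bop.

Lemma bop_ext (a b : bop) : (forall x, a x = b x) -> a = b.
Proof.
case: a b => [a la ca] [b lb cb] /= ab.
have {ab}eab : a = b by apply: funext.
by subst b; congr Bop; apply: Prop_irrelevance.
Qed.

Let zero_lin : linear (fun _ : H => 0 : H).
Proof. by move=> k x y; rewrite scaler0 addr0. Qed.
Let zero_cont : continuous (fun _ : H => 0 : H).
Proof. by move=> x; exact: cvg_cst. Qed.
Definition bop0 := Bop zero_lin zero_cont.

Let one_lin : linear (fun x : H => x).
Proof. by []. Qed.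
Let one_cont : continuous (fun x : H => x).
Proof. by move=> x; exact: cvg_id. Qed.
Definition bop1 := Bop one_lin one_cont.

Section Operations.
Variables (k : R[i]) (a b : bop).

Let opp_lin : linear (fun x => - a x).
Proof. by move=> l x y; rewrite bop_linear opprD scalerN. Qed.
Let opp_cont : continuous (fun x => - a x).
Proof. by move=> x; apply: cvgN; exact: bop_continuous. Qed.
Definition bop_opp := Bop opp_lin opp_cont.

Let add_lin : linear (fun x => a x + b x).
Proof. by move=> l x y; rewrite !bop_linear scalerDr addrACA. Qed.
Let add_cont : continuous (fun x => a x + b x).
Proof. by move=> x; apply: cvgD; exact: bop_continuous. Qed.
Definition bop_add := Bop add_lin add_cont.

Let mul_lin : linear (fun x => a (b x)).
Proof. by move=> l x y; rewrite !bop_linear. Qed.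
Let mul_cont : continuous (fun x => a (b x)).
Proof.
by move=> x; apply: continuous_comp; exact: bop_continuous.
Qed.
Definition bop_mul := Bop mul_lin mul_cont.

Let scale_lin : linear (fun x => k *: a x).
Proof. by move=> l x y; rewrite bop_linear scalerDr !scalerA mulrC. Qed.
Let scale_cont : continuous (fun x => k *: a x).
Proof. by move=> x; apply: cvgZr; exact: bop_continuous. Qed.
Definition bop_scale := Bop scale_lin scale_cont.

End Operations.

Let bop_addA : associative bop_add.
Proof. by move=> a b c; apply: bop_ext => x /=; rewrite addrA. Qed.
Let bop_addC : commutative bop_add.
Proof. by move=> a b; apply: bop_ext => x /=; rewrite addrC. Qed.
Let bop_add0 : left_id bop0 bop_add.
Proof. by move=> a; apply: bop_ext => x /=; rewrite add0r. Qed.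
Let bop_addN : left_inverse bop0 bop_opp bop_add.
Proof. by move=> a; apply: bop_ext => x /=; rewrite addNr. Qed.

HB.instance Definition _ :=
  GRing.isZmodule.Build bop bop_addA bop_addC bop_add0 bop_addN.

Let bop_mulA : associative bop_mul.
Proof. by move=> a b c; exact: bop_ext. Qed.
Let bop_mul1l : left_id bop1 bop_mul.
Proof. by move=> a; exact: bop_ext. Qed.
Let bop_mul1r : right_id bop1 bop_mul.
Proof. by move=> a; exact: bop_ext. Qed.
Let bop_mulDl : left_distributive bop_mul bop_add.
Proof. by move=> a b c; exact: bop_ext. Qed.
Let bop_mulDr : right_distributive bop_mul bop_add.
Proof.
move=> a b c; apply: bop_ext => x /=.
by rewrite -[b x]scale1r bop_linear !scale1r.
Qed.

HB.instance Definition _ := GRing.Zmodule_isPzRing.Build bop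
  bop_mulA bop_mul1l bop_mul1r bop_mulDl bop_mulDr.

Let bop_scaleA k l a : bop_scale k (bop_scale l a) = bop_scale (k * l) a.
Proof. by apply: bop_ext => x /=; rewrite scalerA. Qed.
Let bop_scale1 : left_id 1 bop_scale.
Proof. by move=> a; apply: bop_ext => x /=; rewrite scale1r. Qed.
Let bop_scaleDr : right_distributive bop_scale +%R.
Proof. by move=> k a b; apply: bop_ext => x /=; rewrite scalerDr. Qed.
Let bop_scaleDl a : {morph bop_scale^~ a : k l / k + l}.
Proof. by move=> k l; apply: bop_ext => x /=; rewrite scalerDl. Qed.

HB.instance Definition _ := GRing.Zmodule_isLmodule.Build R[i] bop
  bop_scaleA bop_scale1 bop_scaleDr bop_scaleDl.

End BoundedOperators.

Section Operators.
Variables (R : realType) (H : hilbertType R).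
Local Notation bop := (bop H).

Definition op_scalar (c : R[i]) : bop := c *: (1 : bop).

Definition is_adjoint (a b : bop) := forall x y, <| a x, y |> = <| x, b y |>.

(* The adjoint always exists, by the Riesz representation theorem, and is
   unique; [0] is only a placeholder. *)
Definition adj (a : bop) : bop := xget 0 [set b | is_adjoint a b].

(* On R[i], [0 <= z] means that z is real and nonnegative. *)
Definition op_ge0 (a : bop) := forall x, 0 <= <| a x, x |>.
Definition op_le (a b : bop) := op_ge0 (b - a).
Definition self_adjoint (a : bop) := is_adjoint a a.
Definition unitary (u : bop) := adj u * u = 1 /\ u * adj u = 1.
Definition op_Im (a : bop) : bop := (2 * 'i)^-1 *: (a - adj a).

(* |a| is the unique positive square root of a^* a. *)
Definition op_abs (a : bop) : bop :=
  xget 0 [set c | op_ge0 c /\ c * c = adj a * a].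

Definition commutant (S : set bop) : set bop :=
  [set a | forall b, S b -> a * b = b * a].

Definition von_Neumann_algebra (A : set bop) :=
  (forall a, A a -> exists2 b, A b & is_adjoint a b) /\
  commutant (commutant A) = A.

Definition linear_on (A : set bop) (V : lmodType R[i]) (f : bop -> V) :=
  forall k a b, A a -> A b -> f (k *: a + b) = k *: f a + f b.

Definition op_directed (S : set bop) :=
  S !=set0 /\
  forall a b, S a -> S b -> exists c, [/\ S c, op_le a c & op_le b c].

(* s is the least upper bound of S in the self-adjoint part of A. *)
Definition op_lub (A S : set bop) (s : bop) :=
  [/\ A s, self_adjoint s, forall a, S a -> op_le a s &
      forall t, A t -> self_adjoint t -> (forall a, S a -> op_le a t) ->
        op_le s t].

Definition normal_on (A : set bop) (tau : bop -> R[i]) :=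
  forall (S : set bop) (s : bop),
    S `<=` A -> (forall a, S a -> self_adjoint a) ->
    op_directed S -> op_lub A S s ->
    (forall a, S a -> tau a <= tau s) /\
    (forall t : R[i], (forall a, S a -> tau a <= t) -> tau s <= t).

(* The value of [tau] outside of A is irrelevant. *)
Record faithful_normal_tracial_state (A : set bop) (tau : bop -> R[i])
    : Prop := {
  tau_linear : linear_on A (tau : bop -> R[i]^o);
  tau_unital : tau 1 = 1;
  tau_positive : forall a, A a -> 0 <= tau (adj a * a);
  tau_faithful : forall a, A a -> tau (adj a * a) = 0 -> a = 0;
  tau_normal : normal_on A tau;
  tau_tracial : forall a b, A a -> A b -> tau (a * b) = tau (b * a)
}.

Definition finite_dimensional (B : set bop) :=
  exists (d : nat) (e : 'I_d -> bop), (forall j, B (e j)) /\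
    forall b, B b -> exists c : 'I_d -> R[i], b = \sum_(j < d) c j *: e j.

Section Matrices.
Variable m : nat.
Local Notation mat := 'M[bop]_m.

Definition mx_in (A : set bop) : set mat := [set b | forall i j, A (b i j)].

Definition mx_act (c : mat) (v : 'I_m -> H) : 'I_m -> H :=
  fun i => \sum_(j < m) c i j (v j).

Definition mx_adj (c : mat) : mat := \matrix_(i, j) adj (c j i).

Definition mx_ge0 (c : mat) :=
  forall v : 'I_m -> H, 0 <= \sum_(i < m) <| mx_act c v i, v i |>.

Definition vnorm (v : 'I_m -> H) : R :=
  Num.sqrt (\sum_(i < m) complex.Re `|v i| ^+ 2).

(* The operator norm of c acting on the m-fold direct sum of H, i.e. the
   C^*-norm of M_m(B(H)). *)
Definition op_norm (c : mat) : R :=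
  inf [set r : R | 0 <= r /\ forall v, vnorm (mx_act c v) <= r * vnorm v].

Definition op_ball (B : set bop) (b : mat) (r : R) : set mat :=
  [set c | mx_in B c /\ op_norm (c - b) < r].

(* Openness and connectedness are relative to M_m(B). *)
Definition mx_open (B : set bop) (U : set mat) :=
  U `<=` mx_in B /\
  forall b, U b -> exists2 r : R, 0 < r & op_ball B b r `<=` U.

Definition mx_open_connected (B : set bop) (D : set mat) :=
  mx_open B D /\
  forall V W, mx_open B V -> mx_open B W -> V `|` W = D -> V `&` W = set0 ->
    V = set0 \/ W = set0.

End Matrices.

Definition completely_positive_on (A : set bop) (E : bop -> bop) :=
  forall (m : nat) (a : 'M[bop]_m), mx_in A a ->
    mx_ge0 (map_mx E (mx_adj a *m a)).

(* Every von Neumann algebra contains the identity of H, so that B is a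
   unital subalgebra of A. *)
Record tracial_opval_space (A : set bop) (tau : bop -> R[i])
    (E : bop -> bop) (B : set bop) : Prop := {
  vn_A : von_Neumann_algebra A;
  trace_A : faithful_normal_tracial_state A tau;
  vn_B : von_Neumann_algebra B;
  sub_BA : B `<=` A;
  E_range : forall a, A a -> B (E a);
  E_linear : linear_on A E;
  E_unital : E 1 = 1;
  E_bimodular : forall b a b', B b -> A a -> B b' ->
    E (b * a * b') = b * E a * b';
  E_cp : completely_positive_on A E;
  E_trace : forall a, A a -> tau (E a) = tau a
}.

(* An operator with domain [udom]; [uact] is irrelevant outside of it. *)
Record unbounded := Unbounded { udom : set H; uact : H -> H }.

Definition ulinear (X : unbounded) :=
  forall (k : R[i]) x y, udom X x -> udom X y ->
    udom X (k *: x + y) /\ uact X (k *: x + y) = k *: uact X x + uact X y.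

Definition closed_densely_defined (X : unbounded) :=
  [/\ ulinear X, dense (udom X) &
      closed [set p : H * H | udom X p.1 /\ uact X p.1 = p.2]].

(* Applied to both u and u^*, the condition says u X u^* = X, domains
   included. *)
Definition affiliated (A : set bop) (X : unbounded) :=
  closed_densely_defined X /\
  forall u, commutant A u -> unitary u ->
    forall x, udom X x -> udom X (u x) /\ uact X (u x) = u (uact X x).

(* The graph of X is the graph of its adjoint. *)
Definition uself_adjoint (X : unbounded) :=
  forall y z, (udom X y /\ uact X y = z) <->
    (forall x, udom X x -> <| uact X x, y |> = <| x, z |>).

(* e is a projection-valued measure and X = \int t de(t). *)
Definition spectral_measure (X : unbounded)
    (e : set (measurableTypeR R) -> bop) :=
  [/\ forall S, measurable S -> self_adjoint (e S),
      forall S T, measurable S -> measurable T -> e (S `&` T) = e S * e T,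
      e setT = 1 &
      forall x, exists mu : {finite_measure set (measurableTypeR R) -> \bar R},
        [/\ forall S, measurable S -> mu S = (complex.Re <| e S x, x |>)%:E,
            udom X x <-> (\int[mu]_t (t ^+ 2)%:E < +oo)%E &
            udom X x -> <| uact X x, x |> = (\int[mu]_t t)%:C]].

Definition tight (I : Type) (mu : I -> set R -> R) :=
  forall eps : R, 0 < eps ->
    exists2 K : set R, compact K & forall i, mu i (~` K) < eps.

Section Transforms.
Variables (A : set bop) (E : bop -> bop) (B : set bop) (X : unbounded).

(* c is an inverse in M_m(A) of the operator b - X (x) 1_m, whose domain is
   the m-fold direct sum of the domain of X. *)
Definition is_resolvent m (b c : 'M[bop]_m) :=
  [/\ mx_in A c,
      forall v : 'I_m -> H, forall i, udom X (mx_act c v i) /\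
        mx_act b (mx_act c v) i - uact X (mx_act c v i) = v i &
      forall v : 'I_m -> H, (forall i, udom X (v i)) ->
        forall i, mx_act c (fun j => mx_act b v j - uact X (v j)) i = v i].

Definition resolvent_set m : set 'M[bop]_m :=
  [set b | mx_in B b /\ exists c, is_resolvent b c].

Definition cauchy_transform m (b : 'M[bop]_m) : 'M[bop]_m :=
  map_mx E (xget 0 [set c | is_resolvent b c]).

End Transforms.

(* The tensor product i lam diag(1, -1) (x) 1_n, ordered so that the diagonal
   entries i lam and - i lam alternate. *)
Definition d_ n (lam : R) : 'M[bop]_(2 * n) :=
  diag_mx (\row_k op_scalar ((-1) ^+ k * ('i * lam%:C))).

Definition half_plane_pos (B : set bop) : set bop :=
  [set b | B b /\ exists2 eps : R, 0 < eps & op_le (op_scalar eps%:C) (op_Im b)].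

Definition half_plane_neg (B : set bop) : set bop :=
  [set b | B b /\ exists2 eps : R, 0 < eps & op_le (op_Im b) (op_scalar (- eps%:C))].

(* The index k starts from 0, whence the parities. *)
Definition Omega n (B : set bop) : set 'M[bop]_(2 * n) :=
  [set w | exists (b : 'rV[bop]_(2 * n)) (r : R),
    [/\ forall k : 'I_(2 * n),
          if odd k then half_plane_neg B (b 0 k) else half_plane_pos B (b 0 k),
        0 < r /\ (forall k, op_le (op_scalar r%:C) (op_abs (op_Im (b 0 k)))),
        forall s : R, (forall k, op_le (op_scalar s%:C) (op_abs (op_Im (b 0 k)))) ->
          s <= r &
        op_ball B (diag_mx b) r w]].

(* Rt, with domain D, is the level 2n of the R-transform of X: on D it equals
   g(w) - w^-1, where g is a compositional inverse of the Cauchy transform G.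
   As G need not be injective on the whole resolvent set, g is the inverse of
   the restriction of G to an open set U on which G is injective.  Of the
   possible branches, it is the one corresponding to G(b) ~ b^-1 at infinity:
   w g(w) -> 1 as w = d_n(lam) -> 0.  This determines g, since D is open and
   connected; when B is finite dimensional, g is automatically analytic. *)
Definition is_R_transform (A : set bop) (E : bop -> bop) (B : set bop)
    (X : unbounded) n (D : set 'M[bop]_(2 * n))
    (Rt : 'M[bop]_(2 * n) -> 'M[bop]_(2 * n)) :=
  exists (U : set 'M[bop]_(2 * n)) (g : 'M[bop]_(2 * n) -> 'M[bop]_(2 * n)),
    let G := cauchy_transform A E X (m := 2 * n) in
    [/\ [/\ mx_open B U, U `<=` resolvent_set A B X (m := 2 * n) &
            forall b b', U b -> U b' -> G b = G b' -> b = b'],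
        mx_open_connected B D,
        forall w, D w -> U (g w) /\ G (g w) = w,
        (\forall lam \near (0 : R)^'+, D (d_ n lam)) /\
        op_norm (d_ n lam *m g (d_ n lam) - 1%:M) @[lam --> (0 : R)^'+] --> 0 &
        forall w, D w -> exists v,
          [/\ mx_in B v, w *m v = 1%:M, v *m w = 1%:M & Rt w = g w - v]].

End Operators.

(* Main.v *)
(* Put b near d_n(l)^-1 with l small, let c = (b - X)^-1, and write
   c - b^-1 = (c b - 1) b^-1, where c b - 1 = c X on the domain of X.  Let P be
   the spectral projection of X on a compact set and Q = 1 - P.  Then
   (c b - 1) P = c X P has norm O(l), whereas c b - 1 is bounded and tau(Q) is
   small uniformly in the family, by tightness.  As B is finite dimensional and
   tau is a trace, E(y Q z) is bounded in norm by a constant times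
   sqrt(tau(Q)) |y| |z|.  Hence F(b) = G_X(b) - b^-1 has norm at most eps l, and
   |F(b) - F(b')| <= eps |b - b'| l l' in the same way.  The second bound makes
   G_X injective on the union over l of balls around d_n(l)^-1, and makes
   b |-> w^-1 (1 + F(b) b) a contraction whose fixed point solves G_X(b) = w
   when |w - d_n(l)| < l / 8.

   The spectral projections of an affiliated operator lie in A: if a unitary u
   commutes with X, then e(J) u e(I) intertwines the restrictions of X to the
   ranges of e(I) and e(J), hence vanishes for separated I and J.  So u commutes
   with e, and the double commutant applies. *)

Require Import Defs.
From HB Require Import structures.
From mathcomp Require Import all_boot all_order all_algebra.
From mathcomp Require Import complex.
From mathcomp Require Import all_classical all_reals all_analysis.
From mathcomp Require Import measurable_realfun.
From mathcomp Require Import ring lra.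

Set Implicit Arguments.
Unset Strict Implicit.
Unset Printing Implicit Defensive.

Import Order.TTheory GRing.Theory Num.Theory.
Import numFieldNormedType.Exports.

Local Open Scope classical_set_scope.
Local Open Scope ring_scope.
Local Open Scope complex_scope.

(** The inverse branch must live on one connected domain reaching down to 0, whereas each estimate
    concerns one or two scales [l]. The mixed factor [l l'] in the Lipschitz bound links the scales:
    points near [d_n(l)^-1] have norm of order 1/l, so in b - b' = b (b'^-1 - b^-1) b' all powers of
    [l] and [l'] cancel. On the side of w, the balls have radius proportional to [l] and [d_n] is
    linear in [l], so that their union is convex.

    Since Q has norm 0 or 1, only the trace sees that it is small. Expand E(y Q z) in a basis of B
    orthonormal for tau(f^* x): its coefficients are tau(Q z f^* y), and Cauchy-Schwarz yields the
    factor sqrt(tau(Q)).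

    With [eta] the constant of the defect estimates, the inversion asks for 18 eta < 1
    (injectivity), 16 eta <= 1/2 (contraction) and 1/7 + 24 eta/7 <= 1/4 (stability of the ball);
    1/100 serves for all three. Smaller values enter only in the normalisation at 0.

    The spectral measure is given through the scalar measures of S |-> <e(S)x, x> alone, so the
    additivity of e and its commutation with X have to be extracted from quadratic forms. *)

Lemma subBB (V : zmodType) (x y z : V) : x - y - (x - z) = - (y - z).
Proof. by rewrite [RHS]opprB opprD opprK addrACA subrr add0r addrC. Qed.

(** * The modulus of a complex number and discriminants *)

Section Modulus.
Variable R : realType.
Implicit Types k l : R[i].

(** Norms over [R[i]] take values in [R[i]]; the real-valued [cn], and later [hn] for vectors, move
    all estimates to the ordered field [R]. *)
Definition cn k : R := complex.Re `|k|.

Lemma cnE k : (cn k)%:C = `|k|.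
Proof. by rewrite /cn RRe_real ?normr_real. Qed.

Lemma cn_ge0 k : 0 <= cn k.
Proof. by rewrite -ler0c cnE. Qed.

Lemma cnM k l : cn (k * l) = cn k * cn l.
Proof. by apply: complexI; rewrite rmorphM/= !cnE normrM. Qed.

Lemma cnD k l : cn (k + l) <= cn k + cn l.
Proof. by rewrite -lecR rmorphD/= !cnE ler_normD. Qed.

Lemma cnN k : cn (- k) = cn k.
Proof. by rewrite /cn normrN. Qed.

Lemma cn0 : cn 0 = 0 :> R.
Proof. by rewrite /cn normr0. Qed.

Lemma cn1 : cn 1 = 1 :> R.
Proof. by rewrite /cn normr1. Qed.

Lemma cn_eq0 k : cn k = 0 -> k = 0.
Proof. by move=> k0; apply/normr0_eq0; rewrite -cnE k0. Qed.

Lemma cn_sqr k : cn k ^+ 2 = complex.Re k ^+ 2 + complex.Im k ^+ 2.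
Proof. by apply: complexI; rewrite rmorphXn/= cnE -add_Re2_Im2. Qed.

Lemma cnR (x : R) : cn x%:C = `|x|.
Proof. by apply: complexI; rewrite cnE normc_def/= expr0n/= addr0 sqrtr_sqr. Qed.

Lemma cni : cn 'i = 1 :> R.
Proof.
apply/eqP; rewrite -(@eqrXn2 _ 2) ?cn_ge0// cn_sqr/= expr0n/= add0r.
by rewrite expr1n.
Qed.

Lemma Re_le_cn k : complex.Re k <= cn k.
Proof.
apply: (le_trans (ler_norm _)); rewrite -(@ler_pXn2r _ 2) ?nnegrE ?cn_ge0//.
by rewrite cn_sqr real_normK ?num_real// lerDl sqr_ge0.
Qed.

Lemma ReD k l : complex.Re (k + l) = complex.Re k + complex.Re l.
Proof. by case: k; case: l. Qed.

Lemma ReN k : complex.Re (- k) = - complex.Re k.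
Proof. by case: k. Qed.

Lemma ReB k l : complex.Re (k - l) = complex.Re k - complex.Re l.
Proof. by rewrite ReD ReN. Qed.

Lemma Re_conjc k : complex.Re k^*%C = complex.Re k.
Proof. by case: k. Qed.

Lemma conjcM k : k^*%C * k = (cn k ^+ 2)%:C.
Proof. by rewrite rmorphXn/= cnE sqr_normc mulrC. Qed.

Lemma Re_conjMl (t : R) k : complex.Re ((t%:C * k)^*%C * k) = t * cn k ^+ 2.
Proof. by rewrite cn_sqr; case: k => a b /=; ring. Qed.

(* The discriminant argument behind the Cauchy-Schwarz inequality, for forms
   that need not be definite. *)
Lemma sesqui_discr (a d : R) (b : R[i]) : 0 <= d ->
  (forall k, 0 <= a - 2 * complex.Re (k^*%C * b) + cn k ^+ 2 * d) ->
  cn b ^+ 2 <= a * d.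
Proof.
move=> d0 H; have [dz|dnz] := eqVneq d 0.
  rewrite dz mulr0; have [->|bn0] := eqVneq b 0; first by rewrite cn0 expr0n.
  have cb : 0 < cn b ^+ 2.
    rewrite exprn_gt0// lt_neqAle cn_ge0 andbT eq_sym.
    by apply: contra_neq bn0 => /cn_eq0.
  (* For [d = 0] the choice k = t b leaves a - 2 (|a| + 1), which is negative. *)
  have [t ht] : exists t, t * cn b ^+ 2 = `|a| + 1.
    by exists ((`|a| + 1) / cn b ^+ 2); rewrite divfK ?gt_eqF.
  have := H (t%:C * b).
  rewrite dz mulr0 addr0 Re_conjMl ht.
  by have := ler_norm a; have := normr_ge0 a; lra.
have dp : 0 < d by rewrite lt_neqAle eq_sym dnz.
(* k = b/d minimises the quadratic expression. *)
have := H (d^-1%:C * b); move: (d^-1) (mulVf dnz) => d' d'd; rewrite Re_conjMl.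
rewrite cnM cnR exprMn real_normK ?num_real// => h.
have : 0 <= a * d - (2 * (d' * d) - (d' * d) ^+ 2) * cn b ^+ 2.
  apply: le_trans (mulr_ge0 h d0) _; rewrite le_eqVlt; apply/orP; left.
  by apply/eqP; ring.
by rewrite d'd; lra.
Qed.

End Modulus.

(** * Adjoints *)

Section HilbertNorm.
Variables (R : realType) (H : hilbertType R).
Implicit Types (x y z : H) (k : R[i]).

Definition hn x : R := complex.Re `|x|.

Lemma hnE x : (hn x)%:C = `|x|.
Proof. by rewrite /hn RRe_real ?normr_real. Qed.

Lemma hn_ge0 x : 0 <= hn x.
Proof. by rewrite -ler0c hnE. Qed.

Lemma hnD x y : hn (x + y) <= hn x + hn y.
Proof. by rewrite -lecR rmorphD/= !hnE ler_normD. Qed.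

Lemma hnN x : hn (- x) = hn x.
Proof. by rewrite /hn normrN. Qed.

Lemma hnBC x y : hn (x - y) = hn (y - x).
Proof. by rewrite -hnN opprB. Qed.

Lemma hn0 : hn 0 = 0.
Proof. by rewrite /hn normr0. Qed.

Lemma hn_eq0 x : hn x = 0 -> x = 0.
Proof. by move=> x0; apply/normr0_eq0; rewrite -hnE x0. Qed.

Lemma hnZ k x : hn (k *: x) = cn k * hn x.
Proof. by apply: complexI; rewrite rmorphM/= hnE normrZ hnE cnE. Qed.

Lemma hn_tri z x y : hn (x - y) <= hn (x - z) + hn (z - y).
Proof. by rewrite -[x - y](_ : (x - z) + (z - y) = _) ?hnD// addrA subrK. Qed.

Lemma hn_dot x : (hn x ^+ 2)%:C = <| x, x |>.
Proof. by rewrite rmorphXn/= hnE hnormE. Qed.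

Lemma dotDl x y z : <| x + y, z |> = <| x, z |> + <| y, z |>.
Proof. exact: linearDl. Qed.
Lemma dotDr x y z : <| z, x + y |> = <| z, x |> + <| z, y |>.
Proof. exact: linearDr. Qed.
Lemma dotZl k x z : <| k *: x, z |> = k * <| x, z |>.
Proof. exact: linearZl_LR. Qed.
Lemma dotZr k x z : <| z, k *: x |> = k^*%C * <| z, x |>.
Proof. exact: linearZr_LR. Qed.
Lemma dotNl x z : <| - x, z |> = - <| x, z |>.
Proof. by rewrite -scaleN1r dotZl mulN1r. Qed.
Lemma dotNr x z : <| z, - x |> = - <| z, x |>.
Proof. by rewrite -scaleN1r dotZr rmorphN1 mulN1r. Qed.
Lemma dotBl x y z : <| x - y, z |> = <| x, z |> - <| y, z |>.
Proof. by rewrite dotDl dotNl. Qed.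
Lemma dotBr x y z : <| z, x - y |> = <| z, x |> - <| z, y |>.
Proof. by rewrite dotDr dotNr. Qed.
Lemma dot0l z : <| 0, z |> = 0.
Proof. by rewrite -(scale0r 0) dotZl mul0r. Qed.
Lemma dot0r z : <| z, 0 |> = 0.
Proof. by rewrite -(scale0r 0) dotZr rmorph0 mul0r. Qed.
Lemma dotC x y : <| x, y |> = <| y, x |>^*%C.
Proof. by rewrite hermC expr0 mul1r. Qed.

Lemma hn2E x : hn x ^+ 2 = complex.Re <| x, x |>.
Proof. by rewrite -hn_dot. Qed.

Lemma hn2D x y : hn (x + y) ^+ 2 = hn x ^+ 2 + hn y ^+ 2 + 2 * complex.Re <| x, y |>.
Proof.
rewrite !hn2E dotDl !dotDr !ReD [<| y, x |>]dotC Re_conjc; ring.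
Qed.

Lemma hn2B x y : hn (x - y) ^+ 2 = hn x ^+ 2 + hn y ^+ 2 - 2 * complex.Re <| x, y |>.
Proof. by rewrite hn2D hnN dotNr ReN mulrN. Qed.

Lemma hn_dot_eq0 x : <| x, x |> = 0 -> x = 0.
Proof.
by move=> x0; apply: hn_eq0; apply/eqP; rewrite -sqrf_eq0 hn2E x0.
Qed.

Lemma dot_nondeg x : (forall y, <| x, y |> = 0) -> x = 0.
Proof. by move=> h; apply: hn_dot_eq0. Qed.

Lemma dot_ext x x' : (forall y, <| x, y |> = <| x', y |>) -> x = x'.
Proof.
by move=> h; apply/eqP; rewrite -subr_eq0; apply/eqP/dot_nondeg => y;
  rewrite dotBl h subrr.
Qed.

Lemma dot_extr x x' : (forall y, <| y, x |> = <| y, x' |>) -> x = x'.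
Proof. by move=> h; apply: dot_ext => y; rewrite dotC h -dotC. Qed.

Lemma cn_dot x y : cn <| x, y |> <= hn x * hn y.
Proof.
rewrite -(@ler_pXn2r _ 2) ?nnegrE ?cn_ge0 ?mulr_ge0 ?hn_ge0// exprMn.
apply: sesqui_discr; first exact: sqr_ge0.
move=> k; have := sqr_ge0 (hn (x - k *: y)).
by rewrite hn2B dotZr hnZ exprMn addrAC.
Qed.

Lemma Re_dot x y : complex.Re <| x, y |> <= hn x * hn y.
Proof. exact: le_trans (Re_le_cn _) (cn_dot _ _). Qed.

Lemma parallelogram x y :
  hn (x + y) ^+ 2 + hn (x - y) ^+ 2 = 2 * (hn x ^+ 2 + hn y ^+ 2).
Proof. rewrite hn2D hn2B; ring. Qed.

Definition hlim (u : nat -> H) x :=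
  forall eps : R, 0 < eps -> exists N, forall n, (N <= n)%N -> hn (u n - x) < eps.

Lemma hcomplete (u : nat -> H) :
  (forall eps : R, 0 < eps -> exists N, forall m n, (N <= m)%N -> (N <= n)%N ->
     hn (u m - u n) < eps) -> exists x, hlim u x.
Proof.
move=> cu; have : cvg (u @ \oo).
  apply/cauchy_cvgP/cauchy_ballP => e e0.
  have er : (complex.Re e)%:C = e by rewrite RRe_real// gtr0_real.
  have e0' : 0 < complex.Re e by rewrite -ltcR er.
  have [N hN] := cu _ e0'.
  rewrite near_simpl; exists ([set n | (N <= n)%N], [set n | (N <= n)%N]) => /=.
    by split; exists N.
  by move=> [m n] [/= Nm Nn]; rewrite -ball_normE/= -hnE -er ltcR; exact: hN.
move=> /cvg_ex[x ux]; exists x => eps eps0.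
move/cvgrPdist_lt : ux => /(_ eps%:C); rewrite ltcR => /(_ eps0)[N _ hN].
by exists N => n Nn; have := hN _ Nn; rewrite /= -hnE ltcR hnBC.
Qed.

Lemma hlim_bnd (u : nat -> H) x (r : R) :
  hlim u x -> (forall e : R, 0 < e -> exists N, forall n, (N <= n)%N -> hn (u n) <= r + e) -> hn x <= r.
Proof.
move=> ux h; apply/ler_addgt0Pr => e e0.
have e20 : 0 < e / 2 by rewrite divr_gt0.
have [N1 h1] := ux _ e20; have [N2 h2] := h _ e20.
have {}h1 := h1 (maxn N1 N2) (leq_maxl _ _).
have {}h2 := h2 (maxn N1 N2) (leq_maxr _ _).
have := hnD (u (maxn N1 N2)) (x - u (maxn N1 N2)).
by rewrite addrC subrK hnBC; lra.
Qed.

Lemma hlim_unique (u : nat -> H) x y : hlim u x -> hlim u y -> x = y.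
Proof.
move=> ux uy; apply/eqP; rewrite -subr_eq0; apply/eqP/hn_eq0/eqP.
rewrite eq_le hn_ge0 andbT; apply/ler_addgt0Pr => e e0.
have e20 : 0 < e / 2 by rewrite divr_gt0.
have [N1 h1] := ux _ e20; have [N2 h2] := uy _ e20.
have {}h1 := h1 (maxn N1 N2) (leq_maxl _ _).
have {}h2 := h2 (maxn N1 N2) (leq_maxr _ _).
by have := hn_tri (u (maxn N1 N2)) x y; rewrite (hnBC x (u _)); lra.
Qed.

Lemma hlimZD k (u v : nat -> H) x y :
  hlim u x -> hlim v y -> hlim (fun n => k *: u n + v n) (k *: x + y).
Proof.
move=> ux vy e e0.
have c0 : 0 < cn k + 1 by have := cn_ge0 k; lra.
have e2 : 0 < e / 2 by rewrite divr_gt0.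
have e1 : 0 < e / 2 / (cn k + 1) by rewrite divr_gt0.
have [N1 h1] := ux _ e1; have [N2 h2] := vy _ e2.
exists (maxn N1 N2) => n; rewrite geq_max => /andP[/h1 {}h1 /h2 {}h2].
rewrite opprD addrACA -scalerBr; apply: le_lt_trans (hnD _ _) _; rewrite hnZ.
move: h1; rewrite ltr_pdivlMr// => h1.
by have := hn_ge0 (u n - x); nra.
Qed.

Lemma hlim_cst x : hlim (fun=> x) x.
Proof. by move=> e e0; exists 0%N => n _; rewrite subrr hn0. Qed.

Lemma inf_seq (S : set R) : S !=set0 -> (forall s, S s -> 0 <= s) ->
  exists d : R, [/\ 0 <= d, forall s, S s -> d <= s &
    forall e : R, 0 < e -> exists2 s, S s & s < d + e].
Proof.
move=> S0 Sge; have hi : has_inf S by split=> //; exists 0.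
exists (inf S); split.
- by apply: lb_le_inf.
- by move=> x Sx; apply: ge_inf => //; case: hi.
- by move=> e e0; have [x Sx xe] := inf_adherent e0 hi; exists x.
Qed.

Definition hclosed_subspace (V : set H) :=
  [/\ V 0, (forall k x y, V x -> V y -> V (k *: x + y)) &
      forall u x, (forall n, V (u n)) -> hlim u x -> V x].

(** The parallelogram law makes a minimising sequence for the distance from [x] to [V] Cauchy;
    minimality at the limit gives orthogonality. *)
Lemma projection_theorem (V : set H) : hclosed_subspace V ->
  forall x, exists2 y, V y & forall z, V z -> <| x - y, z |> = 0.
Proof.
move=> [V0 Vlin Vcl] x.
have VD y z : V y -> V z -> V (y + z).
  by move=> Vy Vz; rewrite -[y]scale1r; exact: Vlin.
have VZ k y : V y -> V (k *: y).
  by move=> Vy; rewrite -[_ *: _]addr0; exact: Vlin.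
have [||d [d0 dle dnear]] := @inf_seq [set r | exists2 y, V y & r = hn (x - y) ^+ 2].
- by exists (hn (x - 0) ^+ 2), 0.
- by move=> _ [y _ ->]; exact: sqr_ge0.
have dV y : V y -> d <= hn (x - y) ^+ 2 by move=> Vy; apply: dle; exists y.
have /choice[u hu] : forall n : nat, exists y, V y /\ hn (x - y) ^+ 2 < d + n.+1%:R^-1.
  move=> n; have [|_ [y Vy ->] hy] := dnear (n.+1%:R^-1); first by rewrite invr_gt0.
  by exists y.
(* The midpoint of [u m] and [u n] lies in [V], so its squared distance to [x] is at least [d]. *)
have apart m n : hn (u m - u n) ^+ 2 <= 2 * (m.+1%:R^-1 + n.+1%:R^-1).
  have := parallelogram (x - u m) (x - u n).
  have -> : x - u m - (x - u n) = - (u m - u n).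
    exact: subBB.
  rewrite hnN.
  have -> : x - u m + (x - u n) = 2 *: (x - 2^-1 *: (u m + u n)).
    rewrite scalerBr scalerA divff ?pnatr_eq0// scale1r scaler_nat mulr2n.
    by rewrite opprD addrACA.
  rewrite hnZ exprMn; have -> : cn (2 : R[i]) = 2.
    by rewrite -[2]/(2%:R) -(rmorph_nat (real_complex R)) cnR ger0_norm.
  have := dV (2^-1 *: (u m + u n)) (VZ _ _ (VD _ _ (hu m).1 (hu n).1)).
  have := (hu m).2; have := (hu n).2.
  set a := _^-1; set b := _^-1; set p := hn _ ^+ 2; set q := hn _ ^+ 2.
  set r := hn _ ^+ 2; set s := hn _ ^+ 2; lra.
have [y uy] : exists y, hlim u y.
  apply: hcomplete => e e0.
  have [N hN] : exists N : nat, N.+1%:R^-1 < e ^+ 2 / 4.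
    have e4 : 0 < e ^+ 2 / 4 by rewrite divr_gt0// exprn_gt0.
    by have [N _ hN] := near_infty_natSinv_lt (PosNum e4); exists N; apply: hN => /=.
  exists N => m n Nm Nn; rewrite -(@ltr_pXn2r _ 2) ?nnegrE ?hn_ge0 ?(ltW e0)//.
  apply: (le_lt_trans (apart m n)).
  have inv (k : nat) : (N <= k)%N -> (k.+1%:R^-1 : R) <= N.+1%:R^-1.
    by move=> Nk; rewrite lef_pV2 ?posrE// ler_nat ltnS.
  have := lerD (inv _ Nm) (inv _ Nn); move: hN.
  by move: (_ + _) (N.+1%:R^-1 : R) => p q; lra.
have Vy : V y by apply: Vcl uy => n; exact: (hu n).1.
exists y => // z Vz.
have ymin : hn (x - y) ^+ 2 <= d.
  have sd : hn (x - y) <= Num.sqrt d.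
    apply: (@hlim_bnd (fun n => x - u n)).
      move=> e /uy[N hN]; exists N => n /hN.
      by rewrite subBB hnN.
    move=> e e0.
    have e2 : 0 < e ^+ 2 by rewrite exprn_gt0.
    have [N _ hN] := near_infty_natSinv_lt (PosNum e2); exists N => n Nn.
    rewrite -(@ler_pXn2r _ 2) ?nnegrE ?hn_ge0 ?addr_ge0 ?sqrtr_ge0 ?(ltW e0)//.
    rewrite sqrrD sqr_sqrtr//; apply: (le_trans (ltW (hu n).2)).
    have := hN _ Nn => /= he.
    have : 0 <= Num.sqrt d * e by rewrite mulr_ge0 ?sqrtr_ge0 ?(ltW e0).
    by move: he (Num.sqrt d * e); move: (n.+1%:R^-1 : R) => p h q; lra.
  by rewrite -(sqr_sqrtr d0) ler_pXn2r ?nnegrE ?hn_ge0 ?sqrtr_ge0.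
apply: cn_eq0; apply/eqP; rewrite -sqrf_eq0 eq_le sqr_ge0 andbT.
(* Minimality compares |x - y - k z|^2 with |x - y|^2 for every [k]; the discriminant then has
   [a = 0] and forces the inner product to vanish. *)
have := @sesqui_discr R 0 (hn z ^+ 2) <| x - y, z |> (sqr_ge0 _).
rewrite mul0r; apply => k.
have := dV _ (VD _ _ Vy (VZ k _ Vz)).
rewrite opprD addrA hn2B dotZr hnZ exprMn; lra.
Qed.


(** The kernel of [f] is closed, and a vector [z] orthogonal to it with f(z) nonzero spans the
    complement, as x - (f x / f z) z is in the kernel. *)
Lemma riesz (f : H -> R[i]) :
  (forall k x y, f (k *: x + y) = k * f x + f y) ->
  (exists C : R, forall x, cn (f x) <= C * hn x) ->
  exists y, forall x, f x = <| x, y |>.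
Proof.
move=> flin [C fC].
have f0 : f 0 = 0.
  by apply: cn_eq0; apply/eqP; rewrite eq_le cn_ge0 (le_trans (fC _))// hn0 mulr0.
have fB k x y : f (x - k *: y) = f x - k * f y.
  by rewrite addrC -scaleNr flin mulNr addrC.
have fZ k x : f (k *: x) = k * f x by rewrite -[_ *: _]addr0 flin f0 addr0.
have kerc : hclosed_subspace [set x | f x = 0].
  split=> //= [k x y fx fy|u x fu ux]; first by rewrite flin fx fy mulr0 addr0.
  apply: cn_eq0; apply/eqP; rewrite eq_le cn_ge0 andbT.
  apply/ler_addgt0Pr => e e0; rewrite add0r.
  have C1 : 0 < `|C| + 1 by have := normr_ge0 C; lra.
  have [N hN] := ux _ (divr_gt0 e0 C1).
  have := hN N (leqnn N); rewrite ltr_pdivlMr// => h.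
  have := fC (u N - x); rewrite -[x]scale1r fB fu sub0r cnN mul1r scale1r.
  have := ler_norm C; have := hn_ge0 (u N - x); nra.
have [h|] := pselect (forall x, f x = 0); first by exists 0 => x; rewrite h dot0r.
move=> /existsNP[x0 /eqP fx0].
have [y0 fy0 yort] := projection_theorem kerc x0.
pose z := x0 - y0.
have fz : f z = f x0 by rewrite /z -[y0]scale1r fB fy0 mulr0 subr0.
have zz : <| z, z |> != 0.
  by apply: contra_neq fx0 => /hn_dot_eq0 z0; rewrite -fz z0.
exists (((f z) / <| z, z |>)^*%C *: z) => x.
have : <| x - (f x / f z) *: z, z |> = 0.
  by rewrite dotC [X in X^*%C](_ : _ = 0) ?rmorph0// yort//= fB divfK ?subrr// fz.
rewrite dotBl dotZl => /eqP; rewrite subr_eq0 => /eqP xz.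
by rewrite dotZr conjcK xz; field; rewrite zz fz fx0.
Qed.

End HilbertNorm.

(** * Bounds and adjoints of bounded operators *)

Section BoundedOps.
Variables (R : realType) (H : hilbertType R).
Implicit Types (a b c : bop H) (x y z : H) (k : R[i]).

Lemma bop_lin a k x y : a (k *: x + y) = k *: a x + a y.
Proof. exact: bop_linear. Qed.
Lemma bopD a x y : a (x + y) = a x + a y.
Proof. by have := bop_lin a 1 x y; rewrite !scale1r. Qed.
Lemma bop_0 a : a 0 = 0.
Proof. by apply: (addrI (a 0)); rewrite -bopD !addr0. Qed.
Lemma bopZ a k x : a (k *: x) = k *: a x.
Proof. by have := bop_lin a k x 0; rewrite bop_0 !addr0. Qed.
Lemma bopN a x : a (- x) = - a x.
Proof. by rewrite -scaleN1r bopZ scaleN1r. Qed.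
Lemma bopB a x y : a (x - y) = a x - a y.
Proof. by rewrite bopD bopN. Qed.
Lemma bop_sum a (I : Type) (r : seq I) (P : pred I) (F : I -> H) :
  a (\sum_(i <- r | P i) F i) = \sum_(i <- r | P i) a (F i).
Proof. exact: (big_morph a (bopD a) (bop_0 a)). Qed.

Lemma addbE a b x : (a + b) x = a x + b x. Proof. by []. Qed.
Lemma oppbE a x : (- a) x = - a x. Proof. by []. Qed.
Lemma subbE a b x : (a - b) x = a x - b x. Proof. by []. Qed.
Lemma mulbE a b x : (a * b) x = a (b x). Proof. by []. Qed.
Lemma scalebE k a x : (k *: a) x = k *: a x. Proof. by []. Qed.
Lemma onebE x : (1 : bop H) x = x. Proof. by []. Qed.
Lemma sumbE (I : Type) (r : seq I) (P : pred I) (F : I -> bop H) x :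
  (\sum_(i <- r | P i) F i) x = \sum_(i <- r | P i) F i x.
Proof. exact: (big_morph (fun a : bop H => a x)). Qed.

Lemma bop_scalerAl k a b : (k *: a) * b = k *: (a * b).
Proof. exact: bop_ext. Qed.
Lemma bop_scalerAr k a b : a * (k *: b) = k *: (a * b).
Proof. by apply: bop_ext => x; rewrite mulbE !scalebE bopZ. Qed.

Definition bnd a (r : R) := 0 <= r /\ forall x, hn (a x) <= r * hn x.

Lemma bop_bounded a : exists r, bnd a r.
Proof.
pose f : {linear H -> H} := HB.pack (a : H -> H)
  (GRing.isLinear.Build _ _ _ _ (a : H -> H) (bop_linear a)).
have /linear_boundedP[r [rreal h]] : bounded_near f (nbhs 0).
  by apply: continuous_linear_bounded; exact: (@bop_continuous _ _ a 0).
have {}h := h (1 + `|r|).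
have rr : complex.Re `|r| < 1 + complex.Re `|r| by rewrite ltrDr.
exists (1 + cn r); split; first by rewrite addr_ge0 ?cn_ge0.
move=> x; rewrite -lecR rmorphM rmorphD/= !hnE cnE.
apply: h; apply: le_lt_trans (real_ler_norm rreal) _.
by rewrite ltrDr.
Qed.

Lemma bounded_linear_bop (f : H -> H) (r : R) :
  linear f -> (forall x, hn (f x) <= r * hn x) -> exists a : bop H, forall x, a x = f x.
Proof.
move=> flin fr.
pose g : {linear H -> H} := HB.pack f (GRing.isLinear.Build _ _ _ _ f flin).
suff cf : continuous f by exists (Bop flin cf).
apply: (@bounded_linear_continuous _ _ _ g); apply/linear_boundedP.
exists r%:C; split; first by rewrite complex_real.
move=> s rs x; have sr : s \is Num.real.
  apply/complex_realP; exists (complex.Re s); move: rs; rewrite ltcE => /andP[/eqP si _].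
    by rewrite [LHS]complexE si mulr0 addr0.
rewrite -(RRe_real sr) -hnE -hnE -rmorphM/= lecR (le_trans (fr _))//.
by rewrite ler_wpM2r ?hn_ge0// -lecR (RRe_real sr) ltW.
Qed.

(** Riesz gives the adjoint pointwise; it is bounded because |f y|^2 = <a (f y), y> <= r |f y| |y|.
    Existence is what makes the placeholder in [adj] harmless. *)
Lemma adjoint_exists a : exists b, is_adjoint a b.
Proof.
have [r [r0 ar]] := bop_bounded a.
have /choice[f fE] : forall y, exists z, forall x, <| a x, y |> = <| x, z |>.
  move=> y; apply: riesz => [k x x'|]; first by rewrite bop_lin dotDl dotZl.
  exists (r * hn y) => x; rewrite mulrAC; apply: (le_trans (cn_dot _ _)).
  by rewrite ler_wpM2r ?hn_ge0.
have flin : linear f.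
  by move=> k y z; apply: dot_extr => x; rewrite -fE !dotDr !dotZr !fE.
have fr y : hn (f y) <= r * hn y.
  have [->|fy0] := eqVneq (f y) 0; first by rewrite hn0 mulr_ge0 ?hn_ge0.
  have h0 : 0 < hn (f y).
    by rewrite lt_neqAle hn_ge0 eq_sym andbT; apply: contra_neq fy0 => /hn_eq0.
  rewrite -(ler_pM2l h0) -expr2 hn2E -fE.
  apply: (le_trans (Re_dot _ _)); rewrite mulrCA mulrA ler_wpM2r ?hn_ge0//.
have [b bE] := bounded_linear_bop flin fr.
by exists b => x y; rewrite bE fE.
Qed.

Lemma adjoint_unique a b c : is_adjoint a b -> is_adjoint a c -> b = c.
Proof.
by move=> ab ac; apply: bop_ext => y; apply: dot_extr => x; rewrite -ab -ac.
Qed.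

Lemma op_adjP a : is_adjoint a (adj a).
Proof. by have [b ab] := adjoint_exists a; apply: (xgetPex 0); exists b. Qed.

Lemma op_adjE a b : is_adjoint a b -> adj a = b.
Proof. exact/adjoint_unique/op_adjP. Qed.

Lemma op_adjPl a x y : <| adj a x, y |> = <| x, a y |>.
Proof. by rewrite dotC -(op_adjP a) -dotC. Qed.

Lemma op_adjK a : adj (adj a) = a.
Proof. by apply: op_adjE => x y; rewrite op_adjPl. Qed.

Lemma op_adjD a b : adj (a + b) = adj a + adj b.
Proof. by apply: op_adjE => x y; rewrite !addbE dotDl dotDr !(op_adjP _ x). Qed.

Lemma op_adjZ k a : adj (k *: a) = k^*%C *: adj a.
Proof. by apply: op_adjE => x y; rewrite !scalebE dotZl dotZr conjcK (op_adjP _ x). Qed.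

Lemma op_adjM a b : adj (a * b) = adj b * adj a.
Proof. by apply: op_adjE => x y; rewrite !mulbE !(op_adjP _ _). Qed.

Lemma op_adj1 : adj (1 : bop H) = 1.
Proof. by apply: op_adjE. Qed.

Lemma op_adjN a : adj (- a) = - adj a.
Proof. by apply: op_adjE => x y; rewrite !oppbE dotNl dotNr (op_adjP _ x). Qed.

Lemma op_adjB a b : adj (a - b) = adj a - adj b.
Proof. by rewrite op_adjD op_adjN. Qed.

Lemma self_adjointE a : self_adjoint a <-> adj a = a.
Proof. by split=> [/op_adjE|h]//; rewrite /self_adjoint -{2}h; exact: op_adjP. Qed.

Lemma bnd_adj a r : bnd a r -> bnd (adj a) r.
Proof.
move=> [r0 ar]; split=> // y.
have [->|fy0] := eqVneq (adj a y) 0; first by rewrite hn0 mulr_ge0 ?hn_ge0.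
have h0 : 0 < hn (adj a y).
  by rewrite lt_neqAle hn_ge0 eq_sym andbT; apply: contra_neq fy0 => /hn_eq0.
rewrite -(ler_pM2l h0) -expr2 hn2E op_adjPl dotC Re_conjc.
by apply: (le_trans (Re_dot _ _)); rewrite mulrCA mulrA ler_wpM2r ?hn_ge0.
Qed.

Lemma bndD a b r s : bnd a r -> bnd b s -> bnd (a + b) (r + s).
Proof.
move=> [r0 ar] [s0 bs]; split=> [|x]; first exact: addr_ge0.
by rewrite mulrDl (le_trans (hnD _ _))// lerD.
Qed.

Lemma bndM a b r s : bnd a r -> bnd b s -> bnd (a * b) (r * s).
Proof.
move=> [r0 ar] [s0 bs]; split=> [|x]; first exact: mulr_ge0.
by rewrite mulbE (le_trans (ar _))// -mulrA ler_wpM2l.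
Qed.

Lemma bndZ k a r : bnd a r -> bnd (k *: a) (cn k * r).
Proof.
move=> [r0 ar]; split=> [|x]; first by rewrite mulr_ge0 ?cn_ge0.
by rewrite hnZ -mulrA ler_wpM2l ?cn_ge0.
Qed.

Lemma bnd1 : bnd (1 : bop H) 1.
Proof. by split=> // x; rewrite mul1r. Qed.

Lemma bnd_le a r s : bnd a r -> r <= s -> bnd a s.
Proof.
move=> [r0 ar] rs; split=> [|x]; first exact: le_trans rs.
by rewrite (le_trans (ar _))// ler_wpM2r ?hn_ge0.
Qed.

End BoundedOps.

(** * Matrices of bounded operators *)

Section MatrixNorm.
Variables (R : realType) (H : hilbertType R) (m : nat).
Local Notation mat := 'M[bop H]_m.
Local Notation vec := ('I_m -> H).
Implicit Types (a b c : mat) (v w : vec) (r s : R).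

Definition vadd v w : vec := fun i => v i + w i.
Definition vscale (k : R[i]) v : vec := fun i => k *: v i.
Definition vdot v w : R[i] := \sum_i <| v i, w i |>.

Lemma Re_sum (I : Type) (t : seq I) (P : pred I) (F : I -> R[i]) :
  complex.Re (\sum_(i <- t | P i) F i) = \sum_(i <- t | P i) complex.Re (F i).
Proof. exact: (big_morph _ (@ReD R)). Qed.

Lemma vnorm_ge0 v : 0 <= vnorm v.
Proof. exact: sqrtr_ge0. Qed.

Lemma vnorm2 v : vnorm v ^+ 2 = \sum_i hn (v i) ^+ 2.
Proof. by rewrite sqr_sqrtr// sumr_ge0// => i _; exact: sqr_ge0. Qed.

Lemma vnorm_le v r : 0 <= r -> \sum_i hn (v i) ^+ 2 <= r ^+ 2 -> vnorm v <= r.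
Proof.
by move=> r0 h; rewrite -(@ler_pXn2r _ 2) ?nnegrE ?vnorm_ge0// vnorm2.
Qed.

Lemma hn_le_vnorm v i : hn (v i) <= vnorm v.
Proof.
rewrite -(@ler_pXn2r _ 2) ?nnegrE ?vnorm_ge0 ?hn_ge0// vnorm2 (bigD1 i)//=.
by rewrite lerDl sumr_ge0// => j _; exact: sqr_ge0.
Qed.

Lemma vnorm_mono v w r : 0 <= r -> (forall i, hn (v i) <= r * hn (w i)) ->
  vnorm v <= r * vnorm w.
Proof.
move=> r0 h; apply: vnorm_le; first by rewrite mulr_ge0 ?vnorm_ge0.
rewrite exprMn vnorm2 mulr_sumr; apply: ler_sum => i _; rewrite -exprMn.
by rewrite ler_pXn2r ?nnegrE ?hn_ge0 ?mulr_ge0 ?hn_ge0.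
Qed.

Lemma vnorm_unif v r : 0 <= r -> (forall i, hn (v i) <= r) -> vnorm v <= m%:R * r.
Proof.
move=> r0 h; apply: vnorm_le; first by rewrite mulr_ge0 ?ler0n.
apply: (@le_trans _ _ (\sum_(i < m) r ^+ 2)).
  by apply: ler_sum => i _; rewrite ler_pXn2r ?nnegrE ?hn_ge0.
rewrite sumr_const card_ord exprMn -[leLHS]mulr_natl ler_wpM2r ?sqr_ge0//.
rewrite -natrX ler_nat.
by case: (m) => // n; rewrite expnS leq_pmulr// expn_gt0.
Qed.

Lemma vnorm2D v w :
  vnorm (vadd v w) ^+ 2 = vnorm v ^+ 2 + vnorm w ^+ 2 + 2 * complex.Re (vdot v w).
Proof.
rewrite !vnorm2 Re_sum mulr_sumr -!big_split/=; apply: eq_bigr => i _.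
exact: hn2D.
Qed.

Lemma vnormZ k v : vnorm (vscale k v) = cn k * vnorm v.
Proof.
apply/eqP; rewrite -(@eqrXn2 _ 2) ?mulr_ge0 ?vnorm_ge0 ?cn_ge0//.
rewrite exprMn !vnorm2 mulr_sumr; apply/eqP/eq_bigr => i _.
by rewrite hnZ exprMn.
Qed.

Lemma Re_vdot v w : complex.Re (vdot v w) <= vnorm v * vnorm w.
Proof.
apply: (le_trans (Re_le_cn _)).
rewrite -(@ler_pXn2r _ 2) ?nnegrE ?cn_ge0 ?mulr_ge0 ?vnorm_ge0// exprMn.
apply: sesqui_discr; first exact: sqr_ge0.
move=> k; have := sqr_ge0 (vnorm (vadd v (vscale (- k) w))).
rewrite vnorm2D vnormZ cnN exprMn.
have -> : vdot v (vscale (- k) w) = - (k^*%C * vdot v w).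
  rewrite /vdot mulr_sumr -sumrN; apply: eq_bigr => i _.
  by rewrite dotZr rmorphN mulNr.
by rewrite ReN mulrN addrAC.
Qed.

Lemma vnormD v w : vnorm (vadd v w) <= vnorm v + vnorm w.
Proof.
rewrite -(@ler_pXn2r _ 2) ?nnegrE ?addr_ge0 ?vnorm_ge0// vnorm2D sqrrD.
by have := Re_vdot v w; lra.
Qed.

Lemma mx_actD a b v : mx_act (a + b) v = vadd (mx_act a v) (mx_act b v).
Proof.
apply: funext => i; rewrite /mx_act/= /vadd -big_split/=.
by apply: eq_bigr => j _; rewrite mxE.
Qed.

Lemma mx_actN a v : mx_act (- a) v = vscale (-1) (mx_act a v).
Proof.
apply: funext => i; rewrite /mx_act/= /vscale scaleN1r -sumrN.
by apply: eq_bigr => j _; rewrite mxE.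
Qed.

Lemma mx_actM a b v : mx_act (a *m b) v = mx_act a (mx_act b v).
Proof.
apply: funext => i; rewrite /mx_act.
under eq_bigr do rewrite mxE sumbE; rewrite exchange_big/=.
by apply: eq_bigr => j _; rewrite bop_sum.
Qed.

Lemma mx_act1 v : mx_act (1%:M : mat) v = v.
Proof.
apply: funext => i; rewrite /mx_act (bigD1 i)//= mxE eqxx big1 ?addr0//.
by move=> j ji; rewrite mxE eq_sym (negbTE ji).
Qed.

Lemma mx_act_vadd a v w : mx_act a (vadd v w) = vadd (mx_act a v) (mx_act a w).
Proof.
apply: funext => i; rewrite /mx_act/= /vadd -big_split/=.
by apply: eq_bigr => j _; rewrite bopD.
Qed.

Lemma mx_act_vscale a k v : mx_act a (vscale k v) = vscale k (mx_act a v).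
Proof.
apply: funext => i; rewrite /mx_act/= /vscale scaler_sumr.
by apply: eq_bigr => j _; rewrite bopZ.
Qed.

Definition vdelta (j : 'I_m) (x : H) : vec := fun i => if i == j then x else 0.

Lemma mx_act_delta a j x i : mx_act a (vdelta j x) i = a i j x.
Proof.
rewrite /mx_act (bigD1 j)//= /vdelta eqxx big1 ?addr0// => l lj.
by rewrite (negbTE lj) bop_0.
Qed.

Lemma vnorm_delta j x : vnorm (vdelta j x) = hn x.
Proof.
apply/eqP; rewrite -(@eqrXn2 _ 2) ?vnorm_ge0 ?hn_ge0// vnorm2 (bigD1 j)//=.
rewrite /vdelta eqxx big1 ?addr0// => l lj.
by rewrite (negbTE lj) hn0 expr0n.
Qed.

Lemma mx_act_inj a b : (forall v, mx_act a v = mx_act b v) -> a = b.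
Proof.
move=> h; apply/matrixP => i j; apply: bop_ext => x.
by rewrite -!mx_act_delta h.
Qed.

(** A crude bound: one factor [m] from the sum in each row, one from summing the coordinates. Only
    constants depending on the matrix size and not on the operators matter later. *)
Lemma mx_bounded_ex a (f : 'I_m -> 'I_m -> R) :
  (forall i j, bnd (a i j) (f i j)) ->
  forall r, 0 <= r -> (forall i j, f i j <= r) ->
  forall v, vnorm (mx_act a v) <= m%:R ^+ 2 * r * vnorm v.
Proof.
move=> af r r0 fr v; rewrite expr2 -!mulrA; apply: vnorm_unif.
  by rewrite !mulr_ge0 ?vnorm_ge0.
move=> i; rewrite /mx_act; apply: (@le_trans _ _ (\sum_(j < m) (r * vnorm v))).
  elim/big_ind2: _ => [|x y x' y' h h'|j _]; first by rewrite hn0.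
    by apply: (le_trans (hnD _ _)); exact: lerD.
  have [f0 h] := af i j; apply: (le_trans (h _)).
  by apply: ler_pM; rewrite ?hn_ge0// hn_le_vnorm.
by rewrite sumr_const card_ord mulr_natl.
Qed.

Lemma mx_bounded a : exists r, 0 <= r /\ forall v, vnorm (mx_act a v) <= r * vnorm v.
Proof.
have /choice[f hf] : forall ij : 'I_m * 'I_m, exists r, bnd (a ij.1 ij.2) r.
  by move=> ij; exact: bop_bounded.
exists (m%:R ^+ 2 * \sum_ij f ij); have f0 ij : 0 <= f ij by case: (hf ij).
have s0 : 0 <= \sum_ij f ij by apply: sumr_ge0.
split; first by rewrite mulr_ge0 ?sqr_ge0.
apply: (@mx_bounded_ex a (fun i j => f (i, j))) => // [i j|i j].
  exact: hf (i, j).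
by rewrite (bigD1 (i, j))//= lerDl sumr_ge0.
Qed.

Lemma op_norm_ge0 a : 0 <= op_norm a.
Proof. by apply: lb_le_inf; [exact: mx_bounded|move=> r []]. Qed.

Lemma op_norm_le a r : 0 <= r -> (forall v, vnorm (mx_act a v) <= r * vnorm v) ->
  op_norm a <= r.
Proof. by move=> r0 ar; apply: ge_inf => //; exists 0 => s []. Qed.

Lemma op_norm_act a v : vnorm (mx_act a v) <= op_norm a * vnorm v.
Proof.
apply/ler_addgt0Pr => e e0.
(* Adding 1 keeps the error e |v| / (|v| + 1) below [e], also for [v = 0]. *)
have v0 : 0 < vnorm v + 1 by have := vnorm_ge0 v; lra.
have hi : has_inf [set r | 0 <= r /\ forall v, vnorm (mx_act a v) <= r * vnorm v].
  by split; [exact: mx_bounded|exists 0 => s []].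
have [s [s0 hs] sr] := inf_adherent (divr_gt0 e0 v0) hi.
apply: (le_trans (hs v)).
apply: (@le_trans _ _ ((op_norm a + e / (vnorm v + 1)) * vnorm v)).
  by rewrite ler_wpM2r ?vnorm_ge0// ltW.
rewrite mulrDl lerD2l mulrAC ler_pdivrMr// ler_pM2l//; lra.
Qed.

Lemma op_norm0 : op_norm (0 : mat) = 0.
Proof.
apply/eqP; rewrite eq_le op_norm_ge0 andbT; apply: op_norm_le => // v.
rewrite mul0r; apply: vnorm_le => //; rewrite expr0n/= big1// => i _.
by rewrite /mx_act big1 ?hn0 ?expr0n// => j _; rewrite mxE.
Qed.

Lemma op_normD a b : op_norm (a + b) <= op_norm a + op_norm b.
Proof.
apply: op_norm_le => [|v]; first by rewrite addr_ge0 ?op_norm_ge0.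
by rewrite mx_actD mulrDl (le_trans (vnormD _ _))// lerD ?op_norm_act.
Qed.

Lemma op_normN a : op_norm (- a) = op_norm a.
Proof.
have le b : op_norm (- b) <= op_norm b.
  apply: op_norm_le => [|v]; first exact: op_norm_ge0.
  by rewrite mx_actN vnormZ cnN cn1 mul1r op_norm_act.
by apply/eqP; rewrite eq_le le -{1}[a]opprK le.
Qed.

Lemma op_normBC a b : op_norm (a - b) = op_norm (b - a).
Proof. by rewrite -op_normN opprB. Qed.

Lemma op_norm_tri c a b : op_norm (a - b) <= op_norm (a - c) + op_norm (c - b).
Proof. by rewrite -[a - b](subrKA c) op_normD. Qed.

Lemma op_normM a b : op_norm (a *m b) <= op_norm a * op_norm b.
Proof.
apply: op_norm_le => [|v]; first by rewrite mulr_ge0 ?op_norm_ge0.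
rewrite mx_actM (le_trans (op_norm_act _ _))// -mulrA.
by rewrite ler_wpM2l ?op_norm_ge0 ?op_norm_act.
Qed.

Lemma op_normM_le a b r s : op_norm a <= r -> op_norm b <= s ->
  op_norm (a *m b) <= r * s.
Proof.
by move=> ar bs; apply: (le_trans (op_normM _ _)); rewrite ler_pM ?op_norm_ge0.
Qed.

Lemma op_norm1 : op_norm (1%:M : mat) <= 1.
Proof. by apply: op_norm_le => // v; rewrite mx_act1 mul1r. Qed.

Lemma op_norm_eq0 a : op_norm a <= 0 -> a = 0.
Proof.
move=> a0; apply: mx_act_inj => v; apply: funext => i.
have -> : mx_act (0 : mat) v = fun _ => 0.
  by apply: funext => j; rewrite /mx_act big1// => l _; rewrite mxE.
apply: hn_eq0; apply/eqP; rewrite eq_le hn_ge0 andbT; apply: (le_trans (hn_le_vnorm _ i)).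
by apply: (le_trans (op_norm_act _ _)); rewrite mulr_le0_ge0 ?vnorm_ge0.
Qed.

Lemma bnd_entry a i j : bnd (a i j) (op_norm a).
Proof.
split=> [|x]; first exact: op_norm_ge0.
rewrite -mx_act_delta (le_trans (hn_le_vnorm _ _))//.
by rewrite (le_trans (op_norm_act _ _))// vnorm_delta.
Qed.

Lemma op_norm_entries a r : 0 <= r -> (forall i j, bnd (a i j) r) ->
  op_norm a <= m%:R ^+ 2 * r.
Proof.
move=> r0 h; apply: op_norm_le; first by rewrite mulr_ge0 ?sqr_ge0.
exact: (@mx_bounded_ex a (fun _ _ => r)).
Qed.

Lemma op_norm_diag (d : 'rV[bop H]_m) r : 0 <= r ->
  (forall i, bnd (d 0 i) r) -> op_norm (diag_mx d) <= r.
Proof.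
move=> r0 h; apply: op_norm_le => // v; apply: vnorm_mono => // i.
rewrite /mx_act (bigD1 i)//= mxE eqxx mulr1n big1 ?addr0; first by case: (h i).
by move=> j ji; rewrite mxE eq_sym (negbTE ji).
Qed.

Lemma mx_act_diag (d : 'rV[bop H]_m) v i : mx_act (diag_mx d) v i = d 0 i (v i).
Proof.
rewrite /mx_act (bigD1 i)//= mxE eqxx mulr1n big1 ?addr0//.
by move=> j ji; rewrite mxE eq_sym (negbTE ji).
Qed.

Lemma vnorm_lim (w : nat -> vec) v r :
  (forall i, hlim (fun n => w n i) (v i)) ->
  (exists N, forall n, (N <= n)%N -> vnorm (w n) <= r) -> vnorm v <= r.
Proof.
move=> wv [N hN]; apply/ler_addgt0Pr => e e0.
have m0 : 0 < m%:R + 1 :> R by have := ler0n R m; lra.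
have /choice[f hf] : forall i, exists K, forall n, (K <= n)%N ->
    hn (w n i - v i) < e / (m%:R + 1).
  by move=> i; apply: wv; rewrite divr_gt0.
pose K := maxn N (\max_i f i).
have -> : v = vadd (w K) (vscale (-1) (vadd (w K) (vscale (-1) v))).
  apply: funext => i; rewrite /vadd /vscale !scaleN1r opprB addrC subrK//.
apply: (le_trans (vnormD _ _)); rewrite vnormZ cnN cn1 mul1r.
apply: lerD; first by apply: hN; exact: leq_maxl.
apply: (@le_trans _ _ (m%:R * (e / (m%:R + 1)))).
  apply: vnorm_unif => [|i]; first by rewrite ltW// divr_gt0.
  rewrite /vadd /vscale scaleN1r ltW//; apply: hf.
  by rewrite (leq_trans (leq_bigmax i))// leq_maxr.
by rewrite mulrCA ger_pMr// ler_pdivrMr// mul1r lerDl.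
Qed.

Lemma geom_small (q C : R) : 0 <= q < 1 -> forall e : R, 0 < e ->
  exists N, forall n, (N <= n)%N -> C * q ^+ n < e.
Proof.
move=> /andP[q0 q1] e e0.
have : (fun n => C * q ^+ n) @ \oo --> (C * 0 : R).
  by apply: cvgMr; apply: cvg_expr; rewrite ger0_norm.
rewrite mulr0 => /cvgrPdist_lt/(_ _ e0)[N _ hN]; exists N => n /hN/=.
by rewrite sub0r normrN; apply: le_lt_trans; exact: ler_norm.
Qed.

(** Completeness of the matrix algebra along geometrically converging sequences. The entries
    converge strongly, their limits are linear and bounded, and the tail bound passes to the limit
    vector by vector. *)
Lemma mx_limit (S : nat -> mat) (C q : R) : 0 <= q < 1 ->
  (forall n, op_norm (S n.+1 - S n) <= C * q ^+ n) ->
  exists L, forall n, op_norm (S n - L) <= C / (1 - q) * q ^+ n.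
Proof.
move=> q01 hS; have /andP[q0 q1] := q01; have q1' : 0 < 1 - q by lra.
have C0 : 0 <= C by have := hS 0%N; rewrite expr0 mulr1; exact/le_trans/op_norm_ge0.
pose D := C / (1 - q); have D0 : 0 <= D by rewrite divr_ge0// ltW.
have DE : D * (1 - q) = C by rewrite /D divfK// gt_eqF.
have far n k : op_norm (S (n + k)%N - S n) <= D * q ^+ n * (1 - q ^+ k).
  elim: k => [|k ih]; first by rewrite addn0 subrr op_norm0 expr0 subrr mulr0.
  apply: (le_trans (op_norm_tri (S (n + k)%N) _ _)); rewrite addnS.
  apply: (le_trans (lerD (hS _) ih)); rewrite -DE exprD exprS le_eqVlt.
  by apply/orP; left; apply/eqP; ring.
have near n k : (n <= k)%N -> op_norm (S k - S n) <= D * q ^+ n.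
  move=> nk; rewrite -(subnKC nk); apply: (le_trans (far _ _)).
  rewrite mulrBr mulr1 gerBl.
  by apply: mulr_ge0 (mulr_ge0 D0 _) _; exact: exprn_ge0.
have nearx n k i j x : (n <= k)%N -> hn (S k i j x - S n i j x) <= D * q ^+ n * hn x.
  move=> nk; have := (bnd_entry (S k - S n) i j).2 x.
  rewrite !mxE subbE => /le_trans; apply.
  by rewrite ler_wpM2r ?hn_ge0// near.
have /choice[f hf] : forall t : ('I_m * 'I_m) * H, exists y,
    hlim (fun n => S n t.1.1 t.1.2 t.2) y.
  move=> [[i j] x]; apply: hcomplete => e e0 /=.
  have [N hN] := geom_small (2 * (D * hn x)) q01 e0; exists N => k n Nk Nn.
  apply: (le_lt_trans (hn_tri (S N i j x) _ _)); rewrite (hnBC (S N _ _ _)).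
  have := hN N (leqnn N); have := nearx _ _ i j x Nk; have := nearx _ _ i j x Nn.
  set p := hn _; set p' := hn _; set u := q ^+ N; nra.
have /choice[L hL] : forall ij : 'I_m * 'I_m, exists b : bop H,
    forall x, b x = f (ij, x).
  move=> ij; apply: (@bounded_linear_bop _ _ _ (op_norm (S 0%N) + D)).
    move=> k x y; apply: (hlim_unique (hf _)) => /=.
    have := hlimZD k (hf (ij, x)) (hf (ij, y)).
    by rewrite /=; under eq_fun do rewrite -bop_lin.
  move=> x; apply: (hlim_bnd (hf _)) => e e0; exists 0%N => n _ /=.
  have -> : S n ij.1 ij.2 x = S 0%N ij.1 ij.2 x + (S n ij.1 ij.2 x - S 0%N ij.1 ij.2 x).
    by rewrite addrC subrK.
  apply: (le_trans (hnD _ _)).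
  have := nearx 0%N n ij.1 ij.2 x (leq0n _); have := (bnd_entry (S 0%N) ij.1 ij.2).2 x.
  rewrite expr0 mulr1; lra.
exists (\matrix_(i, j) L (i, j)) => n; apply: op_norm_le => [|v].
  by rewrite mulr_ge0// exprn_ge0.
apply: (@vnorm_lim (fun k => mx_act (S n - S k) v)).
  move=> i; rewrite /mx_act; elim: (index_enum _) => [|j t ih].
    by rewrite big_nil; under eq_fun do rewrite big_nil; exact: hlim_cst.
  rewrite big_cons; under eq_fun do rewrite big_cons -[X in X + _]scale1r.
  rewrite -[X in X + _]scale1r; apply: hlimZD ih.
  rewrite !mxE subbE hL.
  have := hlimZD (-1) (hf ((i, j), v j)) (hlim_cst (S n i j (v j))).
  rewrite /= scaleN1r addrC; congr (hlim _ _).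
  by apply: funext => k; rewrite !mxE subbE scaleN1r addrC.
exists n => k nk; apply: (le_trans (op_norm_act _ _)).
by rewrite ler_wpM2r ?vnorm_ge0// op_normBC near.
Qed.

Definition op_closed (P : set mat) :=
  forall L, (forall e : R, 0 < e -> exists2 b, P b & op_norm (b - L) < e) -> P L.

Lemma mx_contraction (P : set mat) (F : mat -> mat) (q : R) b0 :
  0 <= q < 1 -> op_closed P -> P b0 -> (forall b, P b -> P (F b)) ->
  (forall b c, P b -> P c -> op_norm (F b - F c) <= q * op_norm (b - c)) ->
  exists2 b, P b & F b = b.
Proof.
move=> q01 Pcl P0 PF Fq; have /andP[q0 q1] := q01.
pose S n := iter n F b0.
have PS n : P (S n) by elim: n => //= n; exact: PF.
have hS n : op_norm (S n.+1 - S n) <= op_norm (S 1%N - S 0%N) * q ^+ n.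
  elim: n => [|n ih]; first by rewrite expr0 mulr1.
  by apply: (le_trans (Fq _ _ (PS n.+1) (PS n))); rewrite exprS mulrCA ler_wpM2l.
have [L hL] := mx_limit q01 hS; set D := _ / _ in hL.
have PL : P L.
  apply: Pcl => e e0; have [N hN] := geom_small D q01 e0; exists (S N) => //.
  exact: le_lt_trans (hL N) (hN N (leqnn N)).
exists L => //; apply/eqP; rewrite -subr_eq0; apply/eqP/op_norm_eq0.
apply/ler_addgt0Pr => e e0; rewrite add0r.
have e20 : 0 < e / 2 by rewrite divr_gt0.
have [N hN] := geom_small D q01 e20.
apply: (le_trans (op_norm_tri (F (S N)) _ _)); rewrite op_normBC.
have h1 := le_lt_trans (hL N) (hN N (leqnn N)).
have h2 : op_norm (F (S N) - L) < e / 2.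
  exact: le_lt_trans (hL N.+1) (hN N.+1 (leqnSn N)).
have h3 := Fq _ _ (PS N) PL.
rewrite [leRHS]splitr; apply: lerD (ltW h2); apply: (le_trans h3).
exact: le_trans (ler_piMl (op_norm_ge0 _) (ltW q1)) (ltW h1).
Qed.

(** The maps b |-> 1 - a b and b |-> 1 - b a are contractions; their fixed points are a right and a
    left inverse of 1 + a, hence equal. *)
Lemma neumann a : op_norm a < 1 -> exists b,
  [/\ (1%:M + a) *m b = 1%:M, b *m (1%:M + a) = 1%:M &
      op_norm b <= (1 - op_norm a)^-1].
Proof.
move=> a1; have q01 : 0 <= op_norm a < 1 by rewrite op_norm_ge0.
have clT : op_closed setT by [].
have [|b _ bE] := @mx_contraction setT (fun b => 1%:M - a *m b) _ 0 q01 clT I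
  (fun _ _ => I) _.
  by move=> b c _ _; rewrite subBB -mulmxBr op_normN op_normM.
have [|c _ cE] := @mx_contraction setT (fun b => 1%:M - b *m a) _ 0 q01 clT I
  (fun _ _ => I) _.
  by move=> b' c _ _; rewrite subBB -mulmxBl op_normN mulrC op_normM.
have ab : (1%:M + a) *m b = 1%:M by rewrite mulmxDl mul1mx -{1}bE subrK.
have ca : c *m (1%:M + a) = 1%:M by rewrite mulmxDr mulmx1 -{1}cE subrK.
have cb : c = b by rewrite -[c]mulmx1 -ab mulmxA ca mul1mx.
exists b; split=> //; first by rewrite -cb.
rewrite -[leRHS]mul1r ler_pdivlMr ?subr_gt0// mulrBr mulr1 lerBlDr.
rewrite -{1}bE; apply: (le_trans (op_normD _ _)); rewrite op_normN.
by apply: lerD; rewrite ?op_norm1// mulrC op_normM.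
Qed.

Definition mx_inverse a b := a *m b = 1%:M /\ b *m a = 1%:M.

Lemma mx_inverse_unique a b c : mx_inverse a b -> mx_inverse a c -> b = c.
Proof. by move=> [_ ba] [ac _]; rewrite -[b]mulmx1 -ac mulmxA ba mul1mx. Qed.

(** Write b = a (1 + a' (b - a)) and invert the second factor by a Neumann argument. *)
Lemma mx_inverse_pert a a' b (s t : R) : mx_inverse a a' -> op_norm a' <= s ->
  op_norm (b - a) * s <= t -> t < 1 ->
  exists b', mx_inverse b b' /\ op_norm b' <= s / (1 - t).
Proof.
move=> [aa' a'a] a's bat t1; have s0 := le_trans (op_norm_ge0 _) a's.
have ct : op_norm (a' *m (b - a)) <= t.
  apply: le_trans bat; apply: (le_trans (op_normM _ _)).
  by rewrite mulrC ler_wpM2l ?op_norm_ge0.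
have [c [c1 c2 c3]] := neumann (le_lt_trans ct t1).
have bE : b = a *m (1%:M + a' *m (b - a)).
  by rewrite mulmxDr mulmx1 mulmxA aa' mul1mx addrC subrK.
exists (c *m a'); split.
  by rewrite bE; split; [rewrite mulmxA -(mulmxA a) c1 mulmx1
                        |rewrite -mulmxA (mulmxA a') a'a mul1mx].
rewrite mulrC; apply: op_normM_le a's; apply: (le_trans c3).
by rewrite lef_pV2 ?posrE ?subr_gt0 ?(le_lt_trans ct)// lerD2l lerN2.
Qed.

(** Commutation of all entries with [u] becomes commutation with the single matrix [u%:M], a form
    that passes at once to inverse matrices. *)
Lemma mx_in_commutantP (S : set (bop H)) a :
  mx_in (commutant S) a <-> forall u, S u -> a *m u%:M = u%:M *m a.
Proof.
have E u i j : ((a *m u%:M) i j = a i j * u) * ((u%:M *m a) i j = u * a i j).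
  rewrite !mxE; split.
    rewrite (bigD1 j)//= mxE eqxx mulr1n big1 ?addr0// => k kj.
    by rewrite mxE (negbTE kj) mulr0n mulr0.
  rewrite (bigD1 i)//= mxE eqxx mulr1n big1 ?addr0// => k ki.
  by rewrite mxE eq_sym (negbTE ki) mulr0n mul0r.
split=> [h u Su|h i j u Su]; first by apply/matrixP => i j; rewrite !E h.
by rewrite -!E h.
Qed.

Lemma mx_in_commutant_inv (S : set (bop H)) a b :
  mx_in (commutant S) a -> mx_inverse a b -> mx_in (commutant S) b.
Proof.
move=> /mx_in_commutantP ha [ab ba]; apply/mx_in_commutantP => u Su.
by rewrite -[b *m _]mulmx1 -ab mulmxA -(mulmxA b) -ha// !mulmxA ba mul1mx.
Qed.

Lemma op_closed_commutant (S : set (bop H)) : op_closed (mx_in (commutant S)).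
Proof.
move=> L h i j u Su; apply/eqP; rewrite -subr_eq0; apply/eqP; apply: bop_ext => x.
apply: hn_eq0; apply/eqP; rewrite eq_le hn_ge0 andbT; apply/ler_addgt0Pr => e e0.
have [r [r0 ur]] := bop_bounded u.
have c0 : 0 < 2 * r * hn x + 1 by have := mulr_ge0 r0 (hn_ge0 x); lra.
have [b Sb bL] := h _ (divr_gt0 e0 c0).
have -> : (L i j * u - u * L i j) x = (L i j - b i j) (u x) - u ((L i j - b i j) x).
  rewrite !subbE !mulbE bopB opprB addrA -(mulbE (b i j)) Sb// mulbE.
  by rewrite subrK.
have h1 y : hn ((L i j - b i j) y) <= op_norm (b - L) * hn y.
  by have := (bnd_entry (L - b) i j).2 y; rewrite op_normBC !mxE.
apply: (le_trans (hnD _ _)); rewrite hnN add0r.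
apply: (@le_trans _ _ (op_norm (b - L) * (2 * r * hn x))).
  have -> : op_norm (b - L) * (2 * r * hn x) =
     op_norm (b - L) * (r * hn x) + r * (op_norm (b - L) * hn x) by ring.
  apply: lerD; first by rewrite (le_trans (h1 _))// ler_wpM2l ?op_norm_ge0.
  by rewrite (le_trans (ur _))// ler_wpM2l.
move: bL; rewrite ltr_pdivlMr//; have := op_norm_ge0 (b - L); lra.
Qed.

End MatrixNorm.

Lemma conj_i (R : realType) : 'i%C^*%C = - 'i%C :> R[i].
Proof. by congr Complex; rewrite oppr0. Qed.

(** * Von Neumann algebras and traces *)

Section VonNeumann.
Variables (R : realType) (H : hilbertType R).
Implicit Types (a b z u : bop H) (S A B : set (bop H)) (k : R[i]) (r s : R).

Lemma commutantD S a b : commutant S a -> commutant S b -> commutant S (a + b).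
Proof. by move=> ha hb u Su; rewrite mulrDl mulrDr ha// hb. Qed.

Lemma commutantZ S k a : commutant S a -> commutant S (k *: a).
Proof. by move=> ha u Su; rewrite bop_scalerAl bop_scalerAr ha. Qed.

Lemma commutantN S a : commutant S a -> commutant S (- a).
Proof. by move=> ha u Su; rewrite mulNr mulrN ha. Qed.

Lemma commutantM S a b : commutant S a -> commutant S b -> commutant S (a * b).
Proof. by move=> ha hb u Su; rewrite -mulrA hb// mulrA ha// mulrA. Qed.

Lemma commutant1 S : commutant S 1.
Proof. by move=> u Su; rewrite mulr1 mul1r. Qed.

Lemma commutant_inv S a b : commutant S a -> a * b = 1 -> b * a = 1 -> commutant S b.
Proof.
move=> ha ab ba u Su.
by rewrite -[LHS]mulr1 -ab mulrA -(mulrA b) -ha// !mulrA ba mul1r.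
Qed.

Lemma adj_commutant A b : (forall a, A a -> A (adj a)) ->
  commutant A b -> commutant A (adj b).
Proof.
move=> hA hb a Aa; rewrite -[a]op_adjK -!op_adjM hb//; exact: hA.
Qed.

Lemma bop_neumann a r : bnd a r -> r < 1 ->
  exists b, (1 + a) * b = 1 /\ b * (1 + a) = 1.
Proof.
move=> [r0 ar] r1; have := @neumann R H 1 a%:M.
have an : op_norm (a%:M : 'M[bop H]_1) <= r.
  rewrite -[r]mul1r -[X in X * r](expr1n _ 2); apply: op_norm_entries => // i j.
  by rewrite mxE !ord1 eqxx mulr1n.
move=> /(_ (le_lt_trans an r1))[b [/matrixP/(_ 0 0) h1 /matrixP/(_ 0 0) h2 _]].
exists (b 0 0); move: h1 h2; rewrite !mxE !big_ord1 !mxE eqxx !mulr1n.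
by [].
Qed.

Lemma double_inj a b : a + a = b + b -> a = b.
Proof.
have dbl (c : bop H) : c = (2^-1 : R[i]) *: (c + c).
  have -> : c + c = (2 : R[i]) *: c by rewrite scaler_nat mulr2n.
  by rewrite scalerA mulVf ?pnatr_eq0// scale1r.
by move=> h; rewrite [a]dbl h -dbl.
Qed.

(* The Cayley transform u = (1 - h)(1 + h)^-1 of a small skew-adjoint h in the
   commutant is a unitary of the commutant, and u determines h algebraically. *)
Lemma commutes_with_skew A h r z :
  bnd h r -> r < 1 -> adj h = - h -> commutant A h ->
  (forall u, commutant A u -> unitary u -> z * u = u * z) -> z * h = h * z.
Proof.
move=> hr r1 hskew Ah hz.
have [k [k1 k2]] := bop_neumann hr r1.
have hr' : bnd (- h) r by rewrite -hskew; exact: bnd_adj.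
have [k' [k1' k2']] := bop_neumann hr' r1.
have ak : adj k = k'.
  have : (1 - h) * adj k = 1 by rewrite -hskew -op_adj1 -op_adjD -op_adjM k2.
  by move=> e; rewrite -[LHS]mul1r -k2' -mulrA e mulr1.
have comm : (1 + h) * (1 - h) = (1 - h) * (1 + h).
  by rewrite !mulrDl !mulrDr !mulrN !mulNr !mul1r !mulr1 addrACA [_ + h]addrC addrACA.
have uE : (1 - h) * k = k * (1 - h).
  have := congr1 (fun x => k * x * k) comm.
  by rewrite /= mulrA k2 mul1r => ->; rewrite -!mulrA k1 mulr1.
have Ak : commutant A k.
  by apply: (commutant_inv (a := 1 + h)) => //; apply: commutantD => //; exact: commutant1.
have aE : adj ((1 - h) * k) = k' * (1 + h) by rewrite op_adjM ak op_adjB op_adj1 hskew opprK.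
have Au : commutant A ((1 - h) * k).
  by apply: commutantM => //; apply: commutantD; [exact: commutant1|exact: commutantN].
have Uu : unitary ((1 - h) * k).
  split; rewrite aE.
    by rewrite mulrA -(mulrA k') comm mulrA k2' mul1r k1.
  by rewrite uE mulrA -(mulrA k) k1' mulr1 k2.
(* The Cayley transform is affine in k = (1 + h)^-1, so what commutes with it commutes with [k] and
   then with [h]. *)
have kE : (1 - h) * k = k + k - 1.
  have -> : 1 - h = 1 + 1 - (1 + h) by rewrite opprD addrA addrK.
  by rewrite mulrBl k1 mulrDl !mul1r.
have zk2 : z * (k + k) = (k + k) * z.
  have := hz _ Au Uu; rewrite kE mulrBr mulrBl mulr1 mul1r => /(congr1 (+%R^~ z)).
  by rewrite !subrK.
have zk : z * k = k * z.
  by apply: double_inj; rewrite -mulrDr zk2 mulrDl.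
have : z * (1 + h) = (1 + h) * z.
  have := congr1 (fun x => (1 + h) * x * (1 + h)) zk.
  by rewrite /= -!mulrA k2 mulr1 (mulrA (1 + h) k) k1 mul1r => ->.
by rewrite mulrDl mulrDr mulr1 mul1r => /addrI.
Qed.

(** By the double commutant property it suffices to commute with the whole commutant. Any [b] there
    is half the sum of b - b^* and b + b^*, which are a skew-adjoint element and a multiple of one,
    and the Cayley transform reduces skew-adjoint elements to unitaries. *)
Lemma vN_mem A z : von_Neumann_algebra A ->
  (forall u, commutant A u -> unitary u -> z * u = u * z) -> A z.
Proof.
move=> [adA AE] hz; rewrite -AE.
have Aadj a : A a -> A (adj a) by move=> /adA[b Ab /op_adjE ->].
have skew h : commutant A h -> adj h = - h -> z * h = h * z.
  move=> Ah hskew; have [r [r0 hr]] := bop_bounded h.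
  (* Dividing [h] by [r + 1] brings its norm below 1, as the Cayley transform requires. *)
  have r1 : 0 < r + 1 by lra.
  have : z * ((r + 1)^-1%:C *: h) = ((r + 1)^-1%:C *: h) * z.
    apply: (@commutes_with_skew A _ (cn (r + 1)^-1%:C * r)) => //.
    - exact: bndZ.
    - by rewrite cnR gtr0_norm ?invr_gt0// mulrC ltr_pdivrMr// mul1r ltrDl.
    - by rewrite op_adjZ conjc_real hskew scalerN.
    - exact: commutantZ.
  rewrite bop_scalerAl bop_scalerAr => /(congr1 ( *:%R (r + 1)%:C)).
  by rewrite !scalerA -rmorphM/= divff ?gt_eqF// !scale1r.
move=> b Ab.
have Ab' := adj_commutant Aadj Ab.
have h1 : z * (b - adj b) = (b - adj b) * z.
  apply: skew; last by rewrite op_adjB op_adjK opprB.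
  by apply: commutantD => //; exact: commutantN.
have h2 : z * ('i%C *: (b + adj b)) = ('i%C *: (b + adj b)) * z.
  apply: skew; first by apply: commutantZ; exact: commutantD.
  by rewrite op_adjZ op_adjD op_adjK addrC -scaleNr conj_i.
have {}h2 : z * (b + adj b) = (b + adj b) * z.
  move: h2; rewrite bop_scalerAl bop_scalerAr => /(congr1 ( *:%R (- 'i))).
  rewrite !scalerA (_ : - 'i * 'i = 1 :> R[i]) ?scale1r//.
  by rewrite mulNr -expr2 sqr_i opprK.
have : z * (b + b) = (b + b) * z.
  have -> : b + b = (b - adj b) + (b + adj b) by rewrite addrACA addNr addr0.
  by rewrite mulrDr h1 h2 -mulrDl.
by rewrite mulrDl mulrDr; exact: double_inj.
Qed.

(** * Closure properties of a von Neumann algebra and its matrices *)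

Section VNClosure.
Variable A : set (bop H).
Hypothesis vA : von_Neumann_algebra A.

Lemma vND a b : A a -> A b -> A (a + b).
Proof. by case: vA => _ <-; exact: commutantD. Qed.
Lemma vNZ k a : A a -> A (k *: a).
Proof. by case: vA => _ <-; exact: commutantZ. Qed.
Lemma vNN a : A a -> A (- a).
Proof. by case: vA => _ <-; exact: commutantN. Qed.
Lemma vNM a b : A a -> A b -> A (a * b).
Proof. by case: vA => _ <-; exact: commutantM. Qed.
Lemma vN1 : A 1.
Proof. by case: vA => _ <-; exact: commutant1. Qed.
Lemma vN_scalar k : A (op_scalar H k).
Proof. exact/vNZ/vN1. Qed.
Lemma vNB a b : A a -> A b -> A (a - b).
Proof. by move=> ? /vNN; exact: vND. Qed.
Lemma vN0 : A 0.
Proof. by rewrite -(subrr 1); exact/vNB/vN1/vN1. Qed.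
Lemma vN_adj a : A a -> A (adj a).
Proof. by case: vA => h _ /h[b Ab /op_adjE ->]. Qed.
Lemma vN_sum (I : Type) (t : seq I) (P : pred I) (F : I -> bop H) :
  (forall i, P i -> A (F i)) -> A (\sum_(i <- t | P i) F i).
Proof. by move=> h; elim/big_ind: _ => //; [exact: vN0|exact: vND]. Qed.

Lemma mx_inD m (a b : 'M[bop H]_m) : mx_in A a -> mx_in A b -> mx_in A (a + b).
Proof. by move=> ha hb i j; rewrite mxE; exact: vND. Qed.
Lemma mx_inN m (a : 'M[bop H]_m) : mx_in A a -> mx_in A (- a).
Proof. by move=> ha i j; rewrite mxE; exact: vNN. Qed.
Lemma mx_inB m (a b : 'M[bop H]_m) : mx_in A a -> mx_in A b -> mx_in A (a - b).
Proof. by move=> ? /mx_inN; exact: mx_inD. Qed.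
Lemma mx_inM m (a b : 'M[bop H]_m) : mx_in A a -> mx_in A b -> mx_in A (a *m b).
Proof. by move=> ha hb i j; rewrite mxE; apply: vN_sum => k _; exact: vNM. Qed.
Lemma mx_in_diag m (d : 'rV[bop H]_m) : (forall i, A (d 0 i)) -> mx_in A (diag_mx d).
Proof.
by move=> h i j; rewrite mxE; case: eqP => _; rewrite ?mulr1n// mulr0n; exact: vN0.
Qed.
Lemma mx_in1 m : mx_in A (1%:M : 'M[bop H]_m).
Proof.
by move=> i j; rewrite mxE; case: eqP => _; rewrite ?mulr1n ?mulr0n; [exact: vN1|exact: vN0].
Qed.
Lemma mx_in_inv m (a b : 'M[bop H]_m) : mx_in A a -> mx_inverse a b -> mx_in A b.
Proof. by case: vA => _ <-; exact: mx_in_commutant_inv. Qed.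
Lemma mx_in_closed m : op_closed (@mx_in R H m A).
Proof. by case: vA => _ <-; exact: op_closed_commutant. Qed.

End VNClosure.

(** * The trace, orthonormal bases of B and the conditional expectation *)

Section Tracial.
Variables (A B : set (bop H)) (tau : bop H -> R[i]) (E : bop H -> bop H).
Hypothesis hAEB : tracial_opval_space A tau E B.

Let vA := vn_A hAEB.
Let vB := vn_B hAEB.
Let BA : B `<=` A := sub_BA hAEB.

Lemma tauZD k a b : A a -> A b -> tau (k *: a + b) = k * tau a + tau b.
Proof. exact: (tau_linear (trace_A hAEB)). Qed.
Lemma tauD a b : A a -> A b -> tau (a + b) = tau a + tau b.
Proof. by move=> Aa Ab; rewrite -[a]scale1r tauZD// mul1r scale1r. Qed.
Lemma tau0 : tau 0 = 0.
Proof. by apply: (addrI (tau 0)); rewrite -tauD ?addr0//; exact: vN0. Qed.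
Lemma tauZ k a : A a -> tau (k *: a) = k * tau a.
Proof.
by move=> Aa; rewrite -[_ *: _]addr0 tauZD ?tau0 ?addr0//; exact: vN0.
Qed.
Lemma tauN a : A a -> tau (- a) = - tau a.
Proof. by move=> Aa; rewrite -scaleN1r tauZ// mulN1r. Qed.
Lemma tauB a b : A a -> A b -> tau (a - b) = tau a - tau b.
Proof. by move=> Aa Ab; rewrite tauD ?tauN//; exact: vNN. Qed.
Lemma tau_sum (I : Type) (t : seq I) (F : I -> bop H) :
  (forall i, A (F i)) -> tau (\sum_(i <- t) F i) = \sum_(i <- t) tau (F i).
Proof.
move=> AF; elim: t => [|i t ih]; first by rewrite !big_nil tau0.
by rewrite !big_cons tauD ?ih//; exact: vN_sum.
Qed.
Lemma tau1 : tau 1 = 1. Proof. exact: (tau_unital (trace_A hAEB)). Qed.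
Lemma tauC a b : A a -> A b -> tau (a * b) = tau (b * a).
Proof. exact: (tau_tracial (trace_A hAEB)). Qed.

(** Positivity of [tau] is stated for elements a^* a. Normality, applied to the directed set {a, b}
    with supremum b, gives monotonicity without extracting square roots. *)
Lemma tau_mono a b : A a -> A b -> self_adjoint a -> self_adjoint b ->
  op_le a b -> tau a <= tau b.
Proof.
move=> Aa Ab sa sb ab.
have le_bb : op_le b b by move=> x; rewrite subrr dot0l.
have := tau_normal (trace_A hAEB) (S := [set c | c = a \/ c = b]) (s := b).
case.
- by move=> c [->|->].
- by move=> c [->|->].
- split; first by exists a; left.
  by move=> c d [->|->] [->|->]; exists b; split=> //; right.
- split=> //; first by move=> c [->|->].
  by move=> t _ _; apply; right.
- by move=> h _; apply: h; left.
Qed.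

Lemma self_adjoint_scalar r : self_adjoint (op_scalar H r%:C).
Proof. by rewrite /op_scalar; apply/self_adjointE; rewrite op_adjZ op_adj1 conjc_real. Qed.

(** In [R[i]], comparable numbers have equal imaginary parts, and [a] lies below a real multiple of
    the identity. *)
Lemma tau_real a : A a -> self_adjoint a -> complex.Im (tau a) = 0.
Proof.
move=> Aa sa; have [r [r0 ar]] := bop_bounded a.
have : tau a <= tau (op_scalar H r%:C).
  apply: tau_mono => //; [exact: vN_scalar|exact: self_adjoint_scalar|] => x.
  rewrite subbE scalebE onebE dotBl dotZl -hn_dot.
  have -> : <| a x, x |> = (complex.Re <| a x, x |>)%:C.
    have : <| a x, x |>^*%C = <| a x, x |> by rewrite -dotC sa.
    case: <| a x, x |> => p q [] /eqP; rewrite -subr_eq0 -opprD oppr_eq0 -mulr2n.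
    by rewrite mulrn_eq0/= => /eqP ->.
  rewrite -rmorphM -rmorphB/= ler0c subr_ge0 (le_trans (Re_dot _ _))//.
  by rewrite expr2 mulrA ler_wpM2r ?hn_ge0.
rewrite tauZ ?tau1; last exact: vN1.
by rewrite mulr1 lecE/= => /andP[/eqP].
Qed.

Lemma tau_adj a : A a -> tau (adj a) = (tau a)^*%C.
Proof.
move=> Aa; have Aa' := vN_adj vA Aa.
have /(tau_real (vND vA Aa Aa')) : self_adjoint (a + adj a).
  by apply/self_adjointE; rewrite op_adjD op_adjK addrC.
have /(tau_real (vNZ vA 'i (vNB vA Aa Aa'))) : self_adjoint ('i%C *: (a - adj a)).
  apply/self_adjointE; rewrite op_adjZ op_adjB op_adjK -opprB scalerN -scaleNr.
  by rewrite conj_i opprK.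
rewrite tauZ ?tauB ?tauD//; last exact: vNB.
case: (tau a) => p q; case: (tau (adj a)) => p' q' /=.
by rewrite mul0r mul1r add0r => /eqP; rewrite subr_eq0 => /eqP -> /eqP;
  rewrite addrC addr_eq0 => /eqP ->.
Qed.

Lemma tau_sq_ge0 a : A a -> 0 <= tau (adj a * a).
Proof. exact: (tau_positive (trace_A hAEB)). Qed.

Lemma tau_CS x y : A x -> A y ->
  cn (tau (adj y * x)) ^+ 2 <=
  complex.Re (tau (adj x * x)) * complex.Re (tau (adj y * y)).
Proof.
move=> Ax Ay; have Ax' := vN_adj vA Ax; have Ay' := vN_adj vA Ay.
apply: sesqui_discr; first by have := tau_sq_ge0 Ay; rewrite lecE => /andP[].
move=> k; have Aky := vNZ vA k Ay.
have := tau_sq_ge0 (vNB vA Ax Aky); rewrite lecE => /andP[_] /=.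
rewrite op_adjB op_adjZ mulrBl !mulrBr !bop_scalerAl !bop_scalerAr scalerA.
rewrite !tauB ?tauZ//; try by repeat (apply: vNB || apply: vNZ || apply: vNM).
have -> : tau (adj x * y) = (tau (adj y * x))^*%C.
  by rewrite -tau_adj ?op_adjM ?op_adjK//; exact: vNM.
rewrite conjcM; move: (tau (adj y * x)) (tau (adj y * y)) => b d.
rewrite !ReB; have -> : complex.Re (k * b^*%C) = complex.Re (k^*%C * b).
  by case: (k) => ? ?; case: (b) => ? ? /=; ring.
have -> : complex.Re ((cn k ^+ 2)%:C * d) = cn k ^+ 2 * complex.Re d.
  by case: (d) => ? ? /=; ring.
by lra.
Qed.

Lemma tau_sq_le z r : A z -> bnd z r -> complex.Re (tau (adj z * z)) <= r ^+ 2.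
Proof.
move=> Az [r0 zr]; have Az' := vN_adj vA Az.
have : tau (adj z * z) <= tau (op_scalar H (r ^+ 2)%:C).
  apply: tau_mono; [exact: vNM|exact: vN_scalar| |exact: self_adjoint_scalar|].
    by apply/self_adjointE; rewrite op_adjM op_adjK.
  move=> x; rewrite subbE scalebE onebE mulbE dotBl dotZl op_adjPl -!hn_dot.
  rewrite -rmorphM -rmorphB/= ler0c subr_ge0 -exprMn.
  by rewrite ler_pXn2r ?nnegrE ?hn_ge0 ?mulr_ge0 ?hn_ge0.
rewrite tauZ ?tau1; last exact: vN1.
by rewrite mulr1 lecE/= => /andP[].
Qed.

(* By traciality the projection q can be pulled out of any position. *)
Lemma tau_proj_le q z r : A q -> adj q = q -> q * q = q -> A z -> bnd z r ->
  cn (tau (q * z)) <= Num.sqrt (complex.Re (tau q)) * r.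
Proof.
move=> Aq qa qq Az zr; have r0 : 0 <= r by case: zr.
have tq : 0 <= complex.Re (tau q).
  by have := tau_sq_ge0 Aq; rewrite qa qq lecE => /andP[].
rewrite -(@ler_pXn2r _ 2) ?nnegrE ?cn_ge0 ?mulr_ge0 ?sqrtr_ge0//.
rewrite exprMn sqr_sqrtr//.
have := tau_CS Az Aq; rewrite qa qq => /le_trans; apply.
by rewrite mulrC ler_wpM2l// tau_sq_le.
Qed.

Lemma E_ZD k a b : A a -> A b -> E (k *: a + b) = k *: E a + E b.
Proof. exact: (E_linear hAEB). Qed.

Lemma E_B b : B b -> E b = b.
Proof.
move=> Bb; have := E_bimodular hAEB Bb (vN1 vA) (vN1 vB).
by rewrite (E_unital hAEB) !mulr1.
Qed.

Lemma E_D a b : A a -> A b -> E (a + b) = E a + E b.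
Proof. by move=> Aa Ab; have := E_ZD 1 Aa Ab; rewrite !scale1r. Qed.

Lemma E_sub a b : A a -> A b -> E (a - b) = E a - E b.
Proof.
by move=> Aa Ab; have := E_ZD (-1) Ab Aa; rewrite !scaleN1r addrC => ->; rewrite addrC.
Qed.

Lemma E_sum (I : Type) (t : seq I) (F : I -> bop H) :
  (forall i, A (F i)) -> E (\sum_(i <- t) F i) = \sum_(i <- t) E (F i).
Proof.
move=> AF; elim: t => [|i t ih]; first by rewrite !big_nil E_B//; exact: vN0.
by rewrite !big_cons E_D ?ih//; exact: vN_sum.
Qed.

(** The orthogonal projection onto the span of [t], once [t] is orthonormal for the inner product
    tau(f^* y). *)
Let proj (t : seq (bop H)) y : bop H := \sum_(f <- t) tau (adj f * y) *: f.

(** Gram-Schmidt with the invariant that every residual y - proj t y, for y in B, is orthogonal to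
    [t]. The list [l] may be dependent: a vector with zero residual adds nothing, and a nonzero
    residual can be normalised because [tau] is faithful. *)
Lemma gram_schmidt (l : seq (bop H)) : {in l, forall e, B e} ->
  exists t : seq (bop H), [/\ {in t, forall f, B f},
    forall y f, B y -> f \in t -> tau (adj f * (y - proj t y)) = 0 &
    {in l, forall e, proj t e = e}].
Proof.
have Bproj (t : seq (bop H)) y : {in t, forall f, B f} -> B (proj t y).
  move=> Bt; rewrite /proj big_seq; apply: (vN_sum vB) => f ft.
  by apply: (vNZ vB); exact: Bt.
elim: l => [_|e l ih Bl]; first by exists [::]; split.
have [|t [Bt ort fx]] := ih; first by move=> f fl; apply: Bl; rewrite inE fl orbT.
have Be : B e by apply: Bl; rewrite inE eqxx.
pose g0 := e - proj t e.
have Bg0 : B g0 by apply: (vNB vB) => //; exact: Bproj.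
have [g00|g0n0] := eqVneq g0 0.
  exists t; split=> // f; rewrite inE => /predU1P[->|/fx//].
  by apply/esym/eqP; rewrite -subr_eq0 -/g0 g00.
pose d := complex.Re (tau (adj g0 * g0)).
have dE : tau (adj g0 * g0) = d%:C.
  rewrite /d RRe_real// ger0_real// tau_sq_ge0//; exact: BA.
have d0 : 0 < d.
  rewrite -ltcR -dE lt_neqAle tau_sq_ge0 ?andbT; last exact: BA.
  rewrite eq_sym; apply: contra_neq g0n0.
  by apply: (tau_faithful (trace_A hAEB)); exact: BA.
pose c := (Num.sqrt d)^-1; have c0 : c != 0 by rewrite invr_eq0 sqrtr_eq0 -ltNge.
have c2 : c ^+ 2 * d = 1 by rewrite exprVn sqr_sqrtr ?ltW// mulVf ?gt_eqF.
pose g := c%:C *: g0; have Bg : B g by exact: (vNZ vB).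
have adg : adj g = c%:C *: adj g0 by rewrite op_adjZ conjc_real.
have gE : g = c%:C *: g0 by [].
clearbody g.
have tf f : f \in t -> tau (adj f * g) = 0.
  move=> ft; rewrite gE bop_scalerAr tauZ ?ort ?mulr0//.
  by apply: vNM => //; [apply: vN_adj => //|]; apply: BA => //; exact: Bt.
have tg f : f \in t -> tau (adj g * f) = 0.
  move=> ft; rewrite -[f]op_adjK -op_adjM tau_adj ?tf ?rmorph0//.
  by apply: vNM => //; [apply: vN_adj => //|]; apply: BA => //; exact: Bt.
have tproj y h : A h -> (forall f, f \in t -> tau (adj h * f) = 0) -> tau (adj h * proj t y) = 0.
  (* The induction runs over sublists of [t], with the orthogonality hypothesis kept for the full
     list. *)
  move=> Ah hf; have : {subset t <= t} by [].
  rewrite /proj; move: {1 3}t; elim=> [_|f t' ih' ft]; first by rewrite big_nil mulr0 tau0.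
  have ft' : f \in t by apply: ft; rewrite inE eqxx.
  have {}ih' := ih' (fun x xt => ft x (mem_behead (s := f :: t') xt)).
  have Af : A f by apply: BA; exact: Bt.
  rewrite big_cons mulrDr tauD ?ih' ?addr0.
  - by rewrite bop_scalerAr tauZ ?hf ?mulr0//; apply: vNM => //; exact: vN_adj.
  - by apply: vNM; [|exact: vN_adj|exact: vNZ].
  - apply: vNM => //; first exact: vN_adj.
    rewrite big_seq; apply: (vN_sum vA) => x xt.
    by apply: vNZ => //; apply: BA; apply: Bt; apply: ft; rewrite inE xt orbT.
have projE y : proj (g :: t) y = tau (adj g * y) *: g + proj t y.
  by rewrite /proj big_cons.
have Ag := BA Bg; have Ag' := vN_adj vA Ag.
have tgg : tau (adj g * g) = 1.
  rewrite adg gE bop_scalerAl bop_scalerAr scalerA tauZ ?dE; last first.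
    by apply: vNM => //; [apply: vN_adj => //|]; exact: BA.
  by rewrite -!rmorphM/= -expr2 c2.
exists (g :: t); split.
- by move=> f; rewrite inE => /predU1P[->//|/Bt].
- move=> y f By; rewrite inE projE opprD addrCA => ft.
  have Ay := BA By.
  have Af : A (adj f).
    by apply: vN_adj => //; apply: BA; case/predU1P: ft => [->//|/Bt].
  have Ap : A (proj t y) by apply: BA; exact: Bproj.
  rewrite mulrDr tauD; last 2 first.
    by apply: vNM => //; apply: vNN => //; exact: vNZ.
    by apply: vNM => //; exact: vNB.
  rewrite mulrN tauN ?bop_scalerAr ?tauZ//; try by repeat (apply: vNM || apply: vNZ).
  case/predU1P: ft => [->|ft].
    by rewrite tgg mulr1 mulrBr tauB ?tproj ?subr0 ?addNr//; exact: vNM.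
  by rewrite tf// mulr0 oppr0 add0r ort.
- move=> f; rewrite inE projE => /predU1P[->|fl].
    have -> : tau (adj g * e) = tau (adj g * g0).
      rewrite mulrBr tauB ?tproj ?subr0//; first by apply: vNM => //; exact: BA.
      by apply: vNM => //; apply: BA; exact: Bproj.
    rewrite adg bop_scalerAl tauZ ?dE; last first.
      by apply: vNM => //; [apply: vN_adj => //|]; exact: BA.
    rewrite gE scalerA -!rmorphM/= mulrAC -expr2 c2 scale1r.
    by rewrite /g0 subrK.
  rewrite fx// -{1}(fx f fl) tproj ?scale0r ?add0r//.
Qed.

Lemma tau_basis : finite_dimensional B -> exists t : seq (bop H),
  {in t, forall f, B f} /\ forall y, B y -> y = \sum_(f <- t) tau (adj f * y) *: f.
Proof.
move=> [d [e [Be spanB]]].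
have [|t [Bt ort fx]] := @gram_schmidt [seq e j | j <- enum 'I_d].
  by move=> _ /mapP[j _ ->].
exists t; split=> // y /spanB[c ->].
rewrite -[in LHS](eq_bigr _ (fun j _ => congr1 ( *:%R (c j)) (fx (e j) _))); last first.
  by move=> j _; apply: map_f; rewrite mem_enum.
under eq_bigr do rewrite /proj scaler_sumr.
rewrite exchange_big/= [in LHS]big_seq [in RHS]big_seq; apply: eq_bigr => f ft.
have Af : A (adj f) by apply: vN_adj => //; apply: BA; exact: Bt.
have Ae j : A (e j) by apply: BA.
rewrite mulr_sumr tau_sum; last first.
  by move=> j; apply: (vNM vA) => //; exact: vNZ.
rewrite scaler_suml; apply: eq_bigr => j _.
by rewrite scalerA bop_scalerAr tauZ//; exact: vNM.
Qed.

(** Bimodularity and invariance of the trace turn the coefficient tau(f^* E(a q c)) into tau(f^* a q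
    c), and traciality into tau(q c f^* a), where [q] stands alone in front and Cauchy-Schwarz
    applies. *)
Lemma E_proj_bound : finite_dimensional B -> exists2 C : R, 0 <= C &
  forall a q c r s, A a -> A q -> A c -> adj q = q -> q * q = q ->
    bnd a r -> bnd c s ->
    bnd (E (a * q * c)) (C * Num.sqrt (complex.Re (tau q)) * (r * s)).
Proof.
move=> /tau_basis[t [Bt tE]].
have /choice[nf hnf] : forall f : bop H, exists r, bnd f r by exact: bop_bounded.
have nf0 f : 0 <= nf f by case: (hnf f).
(* One factor |f| comes from the coefficient, the other from the basis vector. *)
exists (\sum_(f <- t) nf f ^+ 2); first by apply: sumr_ge0 => f _; exact: sqr_ge0.
move=> a q c r s Aa Aq Ac qa qq ar cs.
have r0 : 0 <= r by case: ar. have s0 : 0 <= s by case: cs.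
have Aaqc : A (a * q * c) by do 2 apply: vNM => //.
rewrite (tE (E (a * q * c))); last exact: (E_range hAEB).
rewrite big_seq [X in bnd _ (X * _ * _)]big_seq !mulr_suml.
elim/big_ind2 : _ => [|x x' k k' hx hk|f ft].
- by split=> // x; rewrite mul0r hn0.
- exact: bndD.
have Bf := Bt f ft; have Bf' : B (adj f) by exact: vN_adj.
have Af' := BA Bf'.
have -> : tau (adj f * E (a * q * c)) = tau (q * (c * adj f * a)).
  have := E_bimodular hAEB Bf' Aaqc (vN1 vB); rewrite !mulr1 => <-.
  rewrite (E_trace hAEB); last exact: vNM.
  rewrite !mulrA -(mulrA _ q) tauC; [by rewrite !mulrA|by apply: vNM|by apply: vNM].
have h : cn (tau (q * (c * adj f * a))) <=
    Num.sqrt (complex.Re (tau q)) * (s * nf f * r).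
  apply: tau_proj_le => //; first by do 2 apply: vNM => //.
  by apply: bndM => //; apply: bndM => //; exact: bnd_adj.
apply: bnd_le (bndZ _ (hnf f)) _.
apply: (le_trans (ler_wpM2r (nf0 f) h)).
by rewrite le_eqVlt; apply/orP; left; apply/eqP; ring.
Qed.

End Tracial.
End VonNeumann.

(** * Spectral measures *)

Section MeasuresOnR.
Variable R : realType.
Local Notation TR := (measurableTypeR R).
Implicit Types (m : {finite_measure set TR -> \bar R}) (S : set TR) (M : R).

(** The measure is finite and |t| <= 1 + t^2. *)
Lemma integrable_id m : (\int[m]_t (t ^+ 2)%:E < +oo)%E ->
  m.-integrable setT (fun t : TR => t%:E).
Proof.
move=> h.
have mid : measurable_fun setT (fun t : TR => t) by exact: measurable_id.
have i2 : m.-integrable setT (fun t : TR => (t ^+ 2)%:E).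
  apply/integrableP; split; first by apply/measurable_EFinP; exact: measurable_funX.
  by under eq_integral do rewrite gee0_abs ?lee_fin ?sqr_ge0//.
have i1 := finite_measure_integrable_cst m (1 : R) (@measurableT _ TR).
apply: le_integrable (integrableD measurableT i1 i2) => //.
  exact/measurable_EFinP.
move=> t _; have -> : ((EFin \o cst 1%R) t + (t ^+ 2)%:E = (1 + t ^+ 2)%:E)%E by [].
rewrite /= lee_fin [leRHS]ger0_norm ?addr_ge0 ?sqr_ge0//.
rewrite -(real_normK (num_real t)); have := sqr_ge0 (`|t| - 1); have := normr_ge0 t.
move: (`|t|) => x; rewrite sqrrB; nra.
Qed.

Lemma measure_compl m S : measurable S -> m setT = (m S + m (~` S))%E.
Proof.
by move=> mS; rewrite -(setUv S) measureU ?setICr//; exact: measurableC.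
Qed.

Lemma conull_measure m S : measurable S -> m (~` S) = 0%E -> m S = m setT.
Proof.
move=> mS m0; rewrite -(setUv S) measureU ?setICr//; last exact: measurableC.
by rewrite -[LHS]adde0; congr (_ + _)%E; exact/esym.
Qed.

Lemma conull_Rintegral m S (f : TR -> R) : measurable S -> m (~` S) = 0%E ->
  m.-integrable setT (fun t => (f t)%:E) -> \int[m]_t f t = \int[m]_(t in S) f t.
Proof.
move=> mS m0 If; rewrite /Rintegral (negligible_integral _ _ If m0)//; last exact: measurableC.
by rewrite setDE setCK setTI.
Qed.

Lemma Rintegral_le_conull m S M : measurable S -> m (~` S) = 0%E ->
  (forall t, S t -> t <= M) -> m.-integrable setT (fun t : TR => t%:E) ->
  \int[m]_t t <= M * fine (m setT).
Proof.
move=> mS m0 SM im; rewrite (conull_Rintegral mS m0 im) -(conull_measure mS m0).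
rewrite -Rintegral_cst//; apply: le_Rintegral => //.
  by apply: integrableS im.
exact: finite_measure_integrable_cst.
Qed.

Lemma Rintegral_ge_conull m S M : measurable S -> m (~` S) = 0%E ->
  (forall t, S t -> M <= t) -> m.-integrable setT (fun t : TR => t%:E) ->
  M * fine (m setT) <= \int[m]_t t.
Proof.
move=> mS m0 SM im; rewrite (conull_Rintegral mS m0 im) -(conull_measure mS m0).
rewrite -Rintegral_cst//; apply: le_Rintegral => //.
  exact: finite_measure_integrable_cst.
by apply: integrableS im.
Qed.

Lemma second_moment_conull m S M : measurable S -> m (~` S) = 0%E ->
  (forall t, S t -> `|t| <= M) -> (\int[m]_t (t ^+ 2)%:E < +oo)%E.
Proof.
move=> mS m0 SM.
have mf : measurable_fun setT (fun t : TR => (t ^+ 2)%:E).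
  by apply/measurable_EFinP; apply: measurable_funX; exact: measurable_id.
rewrite (ge0_negligible_integral _ _ mf _ m0)//; last 2 first.
- exact: measurableC.
- by move=> t _; rewrite lee_fin sqr_ge0.
rewrite setDE setCK setTI.
apply: (@le_lt_trans _ _ (\int[m]_(t in S) cst (M ^+ 2)%:E t)%E).
  apply: ge0_le_integral => //.
  - by move=> t _; rewrite lee_fin sqr_ge0.
  - exact: measurable_funTS.
  - by move=> t St; rewrite lee_fin -real_normK ?num_real// ler_pXn2r ?nnegrE ?SM// (le_trans _ (SM _ St)).
rewrite integral_cst//; apply: lte_mul_pinfty; rewrite ?lee_fin ?sqr_ge0//.
by rewrite ltey_eq fin_num_measure.
Qed.

End MeasuresOnR.

(** * Spectral projections: they reduce X and lie in A *)

Section SpectralMeasure.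
Variables (R : realType) (H : hilbertType R) (X : unbounded H).
Variable e : set (measurableTypeR R) -> bop H.
Hypotheses (Xsa : uself_adjoint X) (Xcdd : closed_densely_defined X).
Hypothesis he : spectral_measure X e.
Local Notation TR := (measurableTypeR R).
Local Notation dom := (udom X).
Implicit Types (x y z w : H) (S T J : set TR) (c r s : R).

Lemma dom_lin k x y : dom x -> dom y -> dom (k *: x + y).
Proof. by case: Xcdd => h _ _ dx dy; case: (h k x y dx dy). Qed.
Lemma uact_lin k x y : dom x -> dom y -> uact X (k *: x + y) = k *: uact X x + uact X y.
Proof. by case: Xcdd => h _ _ dx dy; case: (h k x y dx dy). Qed.
Lemma domD x y : dom x -> dom y -> dom (x + y).
Proof. by move=> dx dy; rewrite -[x]scale1r; exact: dom_lin. Qed.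
Lemma uactD x y : dom x -> dom y -> uact X (x + y) = uact X x + uact X y.
Proof. by move=> dx dy; rewrite -[x]scale1r uact_lin// !scale1r. Qed.

(** A domain vector z orthogonal to w satisfies |w - z|^2 = |w|^2 + |z|^2, so none comes closer to w
    than |w|. *)
Lemma dense_orth w : (forall z, dom z -> <| w, z |> = 0) -> w = 0.
Proof.
move=> wz; apply: contrapT => /eqP w0.
have hw : 0 < hn w.
  by rewrite lt_neqAle hn_ge0 eq_sym andbT; apply: contra_neq w0 => /hn_eq0.
case: Xcdd => _ dX _.
have hw' : 0 < (hn w)%:C :> R[i] by rewrite ltcR.
have [||z [wz' dz]] := dX (ball w (hn w)%:C).
- by exists w; exact: ballxx.
- exact: ball_open.
have {}wz' : hn (w - z) < hn w.
  by move: wz'; rewrite -ball_normE/= -hnE ltcR.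
have := hn2B w z; rewrite wz// mulr0 subr0 => hh.
have := sqr_ge0 (hn z); have := hn_ge0 (w - z); nra.
Qed.

Lemma dom0 : dom 0.
Proof.
case: Xcdd => _ dX _.
have [||z [_ dz]] := dX setT; [by exists 0|exact: openT|].
by have := dom_lin (-1) dz dz; rewrite scaleN1r addNr.
Qed.
Lemma domZ k x : dom x -> dom (k *: x).
Proof. by move=> dx; rewrite -[_ *: _]addr0; apply: dom_lin => //; exact: dom0. Qed.
Lemma uact0 : uact X 0 = 0.
Proof. by apply: (addrI (uact X 0)); rewrite -uactD ?addr0//; exact: dom0. Qed.
Lemma uactZ k x : dom x -> uact X (k *: x) = k *: uact X x.
Proof.
by move=> dx; rewrite -[_ *: _]addr0 uact_lin ?uact0 ?addr0//; exact: dom0.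
Qed.
Lemma domB x y : dom x -> dom y -> dom (x - y).
Proof. by move=> dx dy; apply: domD => //; rewrite -scaleN1r; exact: domZ. Qed.
Lemma usym x y : dom x -> dom y -> <| uact X x, y |> = <| x, uact X y |>.
Proof. by move=> dx dy; have [/(_ (conj dy erefl)) + _] := Xsa y (uact X y); apply. Qed.

Lemma e_sa S x y : measurable S -> <| e S x, y |> = <| x, e S y |>.
Proof. by case: he => h _ _ _ mS; exact: h. Qed.
Lemma eI S T x : measurable S -> measurable T -> e (S `&` T) x = e S (e T x).
Proof. by case: he => _ h _ _ mS mT; rewrite h. Qed.
Lemma eT x : e setT x = x.
Proof. by case: he => _ _ -> _. Qed.
Lemma e_idem S x : measurable S -> e S (e S x) = e S x.
Proof. by move=> mS; rewrite -eI// setIid. Qed.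
Lemma eC S T x : measurable S -> measurable T -> e S (e T x) = e T (e S x).
Proof. by move=> mS mT; rewrite -!eI// setIC. Qed.

Let mu_ex x : exists mu : {finite_measure set TR -> \bar R},
  [/\ forall S, measurable S -> mu S = (complex.Re <| e S x, x |>)%:E,
      dom x <-> (\int[mu]_t (t ^+ 2)%:E < +oo)%E &
      dom x -> <| uact X x, x |> = (\int[mu]_t t)%:C].
Proof. by case: he => _ _ _; apply. Qed.

Let mu x : {finite_measure set TR -> \bar R} := sval (cid (mu_ex x)).

Lemma muE x S : measurable S -> mu x S = (hn (e S x) ^+ 2)%:E.
Proof.
move=> mS; rewrite /mu; case: cid => m /= [h _ _]; rewrite h//.
by rewrite hn2E -e_sa// e_idem.
Qed.
Lemma mu_dom x : dom x <-> (\int[mu x]_t (t ^+ 2)%:E < +oo)%E.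
Proof. by rewrite /mu; case: cid => m /= []. Qed.
Lemma mu_dot x : dom x -> <| uact X x, x |> = (\int[mu x]_t t)%:C.
Proof. by rewrite /mu; case: cid => m /= []. Qed.

Lemma mu_total x : fine (mu x setT) = hn x ^+ 2.
Proof. by rewrite muE//= eT. Qed.

Lemma e0 x : e set0 x = 0.
Proof.
apply: hn_eq0; apply/eqP; rewrite -sqrf_eq0; apply/eqP.
by have := muE x measurable0; rewrite measure0 => -[].
Qed.

Lemma e_pyth S x : measurable S -> hn x ^+ 2 = hn (e S x) ^+ 2 + hn (e (~` S) x) ^+ 2.
Proof.
move=> mS; have mS' := measurableC mS.
by have := measure_compl (mu x) mS; rewrite !muE// eT -EFinD => -[].
Qed.

Lemma hn_e2 S x : measurable S -> hn (e S x) ^+ 2 = complex.Re <| x, e S x |>.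
Proof. by move=> mS; rewrite hn2E e_sa// e_idem. Qed.

(** Additivity of [e] comes from that of the scalar measures: |e(S)x|^2 and |e(~S)x|^2 add up to
    |x|^2, and the two vectors are orthogonal because e(set0) = 0, so x - e(S)x - e(~S)x has norm
    0. *)
Lemma e_compl S x : measurable S -> e (~` S) x = x - e S x.
Proof.
move=> mS; have mS' := measurableC mS.
suff : x - e S x - e (~` S) x = 0 by move/eqP; rewrite subr_eq0 => /eqP.
apply: hn_eq0; apply/eqP; rewrite -sqrf_eq0; apply/eqP.
have h0 : <| e S x, e (~` S) x |> = 0 by rewrite e_sa// -eI// setICr e0 dot0r.
by rewrite hn2B dotBl h0 subr0 hn2B -!hn_e2// (e_pyth x mS); ring.
Qed.

Lemma hn_e_le S x : measurable S -> hn (e S x) <= hn x.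
Proof.
move=> mS; rewrite -(@ler_pXn2r _ 2) ?nnegrE ?hn_ge0// (e_pyth x mS).
by rewrite lerDl sqr_ge0.
Qed.

Lemma e_eq S x : measurable S -> mu x (~` S) = 0%E -> e S x = x.
Proof.
move=> mS; rewrite muE; last exact: measurableC.
move=> [] /eqP; rewrite sqrf_eq0 => /eqP /hn_eq0.
by rewrite e_compl// => /eqP; rewrite subr_eq0 => /eqP.
Qed.

Lemma mu_compl0 S x : measurable S -> e S x = x -> mu x (~` S) = 0%E.
Proof.
move=> mS ex; rewrite muE; last exact: measurableC.
by rewrite e_compl// ex subrr hn0 expr0n.
Qed.

(** The cross term <e(T)x, e(T)y> vanishes, as e(S) fixes x, kills y and commutes with e(T).
    Integrating t and t^2 against this identity transfers the splitting to the form and to the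
    domain of X. *)
Lemma mu_add S x y T : measurable S -> e S x = x -> e S y = 0 -> measurable T ->
  mu (x + y) T = (mu x T + mu y T)%E.
Proof.
move=> mS ex ey mT; rewrite !muE// -EFinD bopD hn2D.
have -> : <| e T x, e T y |> = 0 by rewrite -ex eC// e_sa// eC// ey bop_0 dot0r.
by rewrite /= mulr0 addr0.
Qed.

Lemma e_compl_ker S x : measurable S -> e S (x - e S x) = 0.
Proof. by move=> mS; rewrite bopB e_idem// subrr. Qed.

Lemma sq_measurable : measurable_fun setT (fun t : TR => (t ^+ 2)%:E).
Proof. by apply/measurable_EFinP; apply: measurable_funX; exact: measurable_id. Qed.

Lemma dom_e S x : measurable S -> dom x -> dom (e S x).
Proof.
move=> mS /mu_dom dx; apply/mu_dom; apply: le_lt_trans dx.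
rewrite -[x in leRHS](subrK (e S x)) addrC.
rewrite (@eq_measure_integral _ _ _ setT (measure_add (mu (e S x)) (mu (x - e S x)))
   (mu (e S x + (x - e S x)))).
  rewrite ge0_integral_measure_add//.
  - by rewrite leeDl// integral_ge0// => t _; rewrite lee_fin sqr_ge0.
  - by move=> t _; rewrite lee_fin sqr_ge0.
  - exact: sq_measurable.
move=> T mT _; apply: etrans (esym (measure_addE _ _ _)); apply: (mu_add mS) => //.
  exact: e_idem.
exact: e_compl_ker.
Qed.

Lemma e_form_add S x y : measurable S -> e S x = x -> e S y = 0 -> dom x -> dom y ->
  <| uact X (x + y), x + y |> = <| uact X x, x |> + <| uact X y, y |>.
Proof.
move=> mS ex ey dx dy; rewrite !mu_dot//; last exact: domD.
rewrite -rmorphD/=; congr (_%:C); rewrite /Rintegral.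
have ix := integrable_id ((mu_dom x).1 dx).
have iy := integrable_id ((mu_dom y).1 dy).
rewrite -fineD; [|exact: integrable_fin_num..].
rewrite -integral_measure_add//; congr fine.
apply: eq_measure_integral => T mT _; apply: etrans (esym (measure_addE _ _ _)).
exact: (mu_add mS).
Qed.

(** Additivity of the form leaves <Xx, y> + <Xy, x> = 0; by symmetry the real part of <Xx, y>
    vanishes. The same for 'i y gives the imaginary part. *)
Lemma e_offdiag S x y : measurable S -> e S x = x -> e S y = 0 -> dom x -> dom y ->
  <| uact X x, y |> = 0.
Proof.
move=> mS ex ey dx dy.
have re z : e S z = 0 -> dom z -> complex.Re <| uact X x, z |> = 0.
  move=> ez dz; have := e_form_add mS ex ez dx dz.
  rewrite uactD// dotDl !dotDr addrA -[RHS]addr0 -(addrA _ <| uact X x, z |>).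
  move=> h; have : <| uact X x, z |> + <| uact X z, x |> = 0.
    apply: (addrI (<| uact X x, x |> + <| uact X z, z |>)).
    by rewrite -h -!addrA; congr (_ + _); rewrite addrC !addrA.
  rewrite [<| uact X z, x |>]usym// [<| z, uact X x |>]dotC => /(congr1 (@complex.Re R)).
  by rewrite ReD Re_conjc /= => h2; lra.
have r1 := re y ey dy.
have := re ('i%C *: y); rewrite bopZ ey scaler0 => /(_ erefl (domZ _ dy)).
rewrite dotZr; move: r1; case: <| _, _ |> => p q /= -> h.
by congr Complex; lra.
Qed.

(** The off-diagonal blocks of X with respect to e(S) are tested against the dense domain, which
    e(S) preserves. *)
Lemma e_reduces S x : measurable S -> dom x -> uact X (e S x) = e S (uact X x).
Proof.
move=> mS dx; have dex := dom_e mS dx.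
have dex' : dom (x - e S x) by exact: domB.
have h1 : e S (uact X (e S x)) = uact X (e S x).
  apply/eqP; rewrite -subr_eq0 -oppr_eq0 opprB; apply/eqP.
  apply: dense_orth => z dz; rewrite dotBl e_sa// -dotBr.
  apply: (e_offdiag mS) => //; [exact: e_idem|exact: e_compl_ker|].
  by apply: domB => //; exact: dom_e.
have h2 : e S (uact X (x - e S x)) = 0.
  apply: dense_orth => z dz; rewrite e_sa// usym//; last exact: dom_e.
  rewrite dotC (e_offdiag mS) ?rmorph0//; [exact: e_idem|exact: e_compl_ker|].
  exact: dom_e.
by rewrite -[x in RHS](subrK (e S x)) uactD// bopD h1 h2 add0r.
Qed.

Section Bounds.
Variables (S : set TR) (x : H).
Hypotheses (mS : measurable S) (ex : e S x = x).

Lemma dom_bounded r : (forall t, S t -> `|t| <= r) -> dom x.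
Proof.
move=> Sr; apply/mu_dom; apply: (second_moment_conull mS _ Sr).
exact: mu_compl0.
Qed.

Lemma form_upper r : (forall t, S t -> t <= r) -> dom x ->
  complex.Re <| uact X x, x |> <= r * hn x ^+ 2.
Proof.
move=> Sr dx; rewrite mu_dot//= -mu_total; apply: (Rintegral_le_conull mS) => //.
  exact: mu_compl0.
exact/integrable_id/mu_dom.
Qed.

Lemma form_lower r : (forall t, S t -> r <= t) -> dom x ->
  r * hn x ^+ 2 <= complex.Re <| uact X x, x |>.
Proof.
move=> Sr dx; rewrite mu_dot//= -mu_total; apply: (Rintegral_ge_conull mS) => //.
  exact: mu_compl0.
exact/integrable_id/mu_dom.
Qed.

(** Cauchy-Schwarz turns the form bound <(c - X)x, x> >= d |x|^2 into a norm bound. *)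
Lemma coercive_below c d : (forall t, S t -> t <= c - d) -> dom x ->
  d * hn x <= hn (uact X x - c%:C *: x).
Proof.
move=> Sr dx; have := form_upper Sr dx; have := hn_ge0 x.
rewrite le_eqVlt => /predU1P[<-|x0]; first by rewrite mulr0 hn_ge0.
move=> h; rewrite hnBC -(ler_pM2r x0); apply: le_trans (Re_dot _ _).
rewrite dotBl dotZl ReB -hn_dot -rmorphM/=.
by move: h; lra.
Qed.

Lemma coercive_above c d : (forall t, S t -> c + d <= t) -> dom x ->
  d * hn x <= hn (uact X x - c%:C *: x).
Proof.
move=> Sr dx; have := form_lower Sr dx; have := hn_ge0 x.
rewrite le_eqVlt => /predU1P[<-|x0]; first by rewrite mulr0 hn_ge0.
move=> h; rewrite -(ler_pM2r x0); apply: le_trans (Re_dot _ _).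
by rewrite dotBl dotZl ReB -hn_dot -rmorphM/=; move: h; lra.
Qed.

End Bounds.

(* A symmetric operator is bounded by its numerical radius; polarisation is
   applied to x and a multiple of (X - c)x of the same norm. *)
Lemma shifted_bound S x c r : measurable S -> e S x = x -> 0 <= r ->
  (forall t, S t -> c - r <= t <= c + r) -> dom x ->
  hn (uact X x - c%:C *: x) <= r * hn x.
Proof.
move=> mS ex r0 Sr dx.
have [f fE] : exists f, forall z, f z = uact X z - c%:C *: z by eexists.
have fq z : e S z = z -> dom z -> `|complex.Re <| f z, z |>| <= r * hn z ^+ 2.
  move=> ez dz; rewrite fE dotBl dotZl ReB -hn_dot -rmorphM/=.
  have := form_upper mS ez (fun t St => (andP (Sr t St)).2) dz.
  have := form_lower mS ez (fun t St => (andP (Sr t St)).1) dz.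
  by rewrite ler_norml; move=> h1 h2; apply/andP; split; lra.
have fdom z : e S z = z -> dom z.
  move=> ez; apply: (dom_bounded mS ez (r := `|c| + r)) => t /Sr.
  by have := ler_norm c; have := ler_norm (- c); rewrite normrN ler_norml; lra.
have fe z : e S z = z -> e S (f z) = f z.
  move=> ez; have dz := fdom _ ez.
  by rewrite fE bopB bopZ ez -e_reduces// ez.
have fD y z : e S y = y -> e S z = z -> f (y + z) = f y + f z.
  by move=> /fdom dy /fdom dz; rewrite !fE uactD// scalerDr opprD addrACA.
have fN y : e S y = y -> f (- y) = - f y.
  by move=> /fdom dy; rewrite !fE -scaleN1r uactZ// !scaleN1r scalerN -opprD.
have sym y z : e S y = y -> e S z = z -> <| f y, z |> = <| y, f z |>.
  move=> /fdom dy /fdom dz; rewrite !fE dotBl dotBr usym// dotZl dotZr.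
  by rewrite conjc_real.
have key y z : e S y = y -> e S z = z ->
    2 * complex.Re <| f y, z |> <= r * (hn y ^+ 2 + hn z ^+ 2).
  move=> ey ez.
  have eyz : e S (y + z) = y + z by rewrite bopD ey ez.
  have eyz' : e S (y - z) = y - z by rewrite bopB ey ez.
  have := fq _ eyz (fdom _ eyz); have := fq _ eyz' (fdom _ eyz').
  have eNz : e S (- z) = - z by rewrite bopN ez.
  rewrite !ler_norml !fD// fN// => /andP[h1 _] /andP[_ h2].
  have := parallelogram y z; move: h1 h2.
  rewrite !(dotDl, dotDr, dotNl, dotNr, ReD, ReN) [<| f z, y |>]sym//.
  rewrite [<| z, f y |>]dotC Re_conjc opprK.
  set a := complex.Re <| f y, z |>; nra.
have [x0|x0] := eqVneq (hn x) 0.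
  have -> : x = 0 by exact: hn_eq0.
  by rewrite uact0 scaler0 subrr hn0 mulr0.
have [f0|f0] := eqVneq (hn (f x)) 0; first by rewrite -fE f0 mulr_ge0 ?hn_ge0.
have xp : 0 < hn x by rewrite lt_neqAle eq_sym x0 hn_ge0.
have fp : 0 < hn (f x) by rewrite lt_neqAle eq_sym f0 hn_ge0.
pose s := hn x / hn (f x).
have sf : s * hn (f x) = hn x by rewrite divfK.
have s0 : 0 < s by rewrite divr_gt0.
have := key x (s%:C *: f x) ex; rewrite bopZ fe// => /(_ erefl).
rewrite dotZr conjc_real -hn_dot -rmorphM/= hnZ cnR gtr0_norm// sf -fE.
have -> : s * hn (f x) ^+ 2 = hn x * hn (f x) by rewrite -sf; ring.
move=> h; rewrite -(ler_pM2l xp); lra.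
Qed.

Section Intertwine.
Variable u : bop H.
Hypothesis u1 : bnd u 1.
Hypothesis uX : forall x, dom x -> dom (u x) /\ uact X (u x) = u (uact X x).

(* If Y = e(J) u maps the r-bounded part of X - c to its d-bounded-below part
   and d > r, then (X - c)Y = Y(X - c) forces |Y| <= (r/d)|Y|. *)
Lemma intertwine_disjoint S J c r d x : measurable S -> measurable J ->
  0 <= r -> r < d -> (forall t, S t -> c - r <= t <= c + r) ->
  (forall y, e J y = y -> dom y -> d * hn y <= hn (uact X y - c%:C *: y)) ->
  e S x = x -> e J (u x) = 0.
Proof.
move=> mS mJ r0 rd Sr Jd.
have d0 : 0 < d by exact: le_lt_trans rd.
have fdom z : e S z = z -> dom z.
  move=> ez; apply: (dom_bounded mS ez (r := `|c| + r)) => t /Sr.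
  by have := ler_norm c; have := ler_norm (- c); rewrite normrN ler_norml; lra.
have step k : forall z, e S z = z -> hn (e J (u z)) <= (r / d) ^+ k * hn z.
  elim: k => [|k ih] z ez.
    by rewrite expr0 (le_trans (hn_e_le _ mJ))// (le_trans (u1.2 z)).
  have dz := fdom _ ez; have [duz Xuz] := uX dz.
  have dJ := dom_e mJ duz.
  have h1 := Jd _ (e_idem _ mJ) dJ.
  have ez' : e S (uact X z - c%:C *: z) = uact X z - c%:C *: z.
    by rewrite bopB bopZ ez -e_reduces// ez.
  have := ih _ ez'; rewrite bopB bopZ -Xuz bopB bopZ -e_reduces//.
  move=> h2; have h3 := shifted_bound mS ez r0 Sr dz.
  rewrite -(ler_pM2l d0) (le_trans h1)// (le_trans h2)// exprS.
  have q0 : 0 <= (r / d) ^+ k by rewrite exprn_ge0// divr_ge0// ltW.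
  move: q0 h3; move: ((r / d) ^+ k) (hn _) => p a p0 ha.
  have -> : d * (r / d * p * hn z) = p * (r * hn z) by field; rewrite gt_eqF.
  exact: ler_wpM2l.
move=> ex; apply: hn_eq0; apply/eqP; rewrite eq_le hn_ge0 andbT.
apply/ler_addgt0Pr => eps eps0; rewrite add0r.
have q01 : 0 <= r / d < 1.
  by rewrite divr_ge0 ?(ltW d0)//= ltr_pdivrMr// mul1r.
have [N hN] := geom_small (hn x) q01 eps0.
by apply: (le_trans (step N x ex)); rewrite mulrC ltW// hN.
Qed.

(** The complement of [a, b] is a countable union of half-lines at distance 1/(n + 1) from it. Each
    is separated from [a, b], so it carries no mass of [mu (u x)], and neither does their union. *)
Lemma intertwine_itv a b x : a <= b ->
  e `[a, b]%classic x = x -> e `[a, b]%classic (u x) = u x.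
Proof.
move=> ab ex.
pose c := (a + b) / 2; pose r := (b - a) / 2.
have r0 : 0 <= r by rewrite divr_ge0// subr_ge0.
have aE : c - r = a by rewrite /c /r; lra.
have bE : c + r = b by rewrite /c /r; lra.
have Sr t : `[a, b]%classic t -> c - r <= t <= c + r by rewrite aE bE /= in_itv.
apply: e_eq; first exact: measurable_itv.
pose L (n : nat) : set TR := `]-oo, (a - n.+1%:R^-1)]%classic.
pose G (n : nat) : set TR := `[(b + n.+1%:R^-1), +oo[%classic.
have mL n : measurable (L n) by exact: measurable_itv.
have mG n : measurable (G n) by exact: measurable_itv.
have n0 (n : nat) : 0 < n.+1%:R^-1 :> R by rewrite invr_gt0.
have L0 n : mu (u x) (L n) = 0%E.
  rewrite muE// (@intertwine_disjoint `[a, b]%classic _ c r (r + n.+1%:R^-1)) ?hn0 ?expr0n//.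
  - by rewrite ltrDl.
  - move=> y ey dy; apply: (coercive_below (mL n) ey) => // t.
    by rewrite /L/= in_itv/= opprD addrA aE.
have G0 n : mu (u x) (G n) = 0%E.
  rewrite muE// (@intertwine_disjoint `[a, b]%classic _ c r (r + n.+1%:R^-1)) ?hn0 ?expr0n//.
  - by rewrite ltrDl.
  - move=> y ey dy; apply: (coercive_above (mG n) ey) => // t.
    by rewrite /G/= in_itv/= andbT addrA bE.
have cover : ~` `[a, b]%classic `<=` \bigcup_n (L n `|` G n).
  move=> t /=; rewrite in_itv/= => /negP; rewrite negb_and -!ltNge.
  have near s : 0 < s -> exists N : nat, N.+1%:R^-1 < s.
    by move=> s0; have [N _ hN] := near_infty_natSinv_lt (PosNum s0); exists N; exact: (hN N (leqnn N)).
  case/orP; rewrite -subr_gt0 => /near[N hN]; exists N => //.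
    by left; rewrite /L/= in_itv/=; move: (N.+1%:R^-1 : R) hN => q; lra.
  by right; rewrite /G/= in_itv/= andbT; move: (N.+1%:R^-1 : R) hN => q; lra.
have : mu (u x) (\bigcup_n (L n `|` G n)) = 0%E.
  apply/eqP; rewrite eq_le measure_ge0 andbT.
  have mLG n : measurable (L n `|` G n) by exact: measurableU.
  apply: le_trans (measure_sigma_subadditive _ mLG _ (@subset_refl _ _)) _.
    exact: bigcup_measurable.
  rewrite eseries0// => n _ _ /=.
  apply/eqP; rewrite eq_le measure_ge0 andbT.
  apply: le_trans (measureU2 _ (mL n) (mG n)) _; rewrite -[leRHS]adde0.
  have z0 (y : \bar R) : y = 0%E -> (y <= 0)%E by move=> ->.
  by apply: leeD; apply: z0; [exact: L0|exact: G0].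
move=> m0; apply/eqP; rewrite eq_le measure_ge0 andbT -m0.
apply: le_measure => //; rewrite inE; first by apply: measurableC; exact: measurable_itv.
by apply: bigcup_measurable => n _; exact: measurableU.
Qed.

End Intertwine.

Section Unitary.
Variable u : bop H.
Hypothesis uu : unitary u.
Hypothesis uX : forall x, dom x -> dom (u x) /\ uact X (u x) = u (uact X x).
Hypothesis uX' : forall x, dom x -> dom (adj u x) /\ uact X (adj u x) = adj u (uact X x).

Lemma unitary_dot (v : bop H) x y : unitary v -> <| v x, v y |> = <| x, y |>.
Proof. by case=> h _; rewrite -op_adjPl -mulbE h. Qed.

Lemma unitary_adj (v : bop H) : unitary v -> unitary (adj v).
Proof. by case=> h h'; split; rewrite op_adjK. Qed.

Lemma unitary_bnd (v : bop H) : unitary v -> bnd v 1.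
Proof.
move=> hv; split=> // x; rewrite mul1r -(@ler_pXn2r _ 2) ?nnegrE ?hn_ge0//.
by rewrite !hn2E unitary_dot.
Qed.

(** Both [u] and its adjoint preserve the range of the projection, hence [u] also preserves its
    orthogonal complement. *)
Lemma e_itv_comm a b x : a <= b ->
  e `[a, b]%classic (u x) = u (e `[a, b]%classic x).
Proof.
move=> ab; have mI : measurable (`[a, b]%classic : set TR) by exact: measurable_itv.
have h1 y : e `[a, b]%classic (u (e `[a, b]%classic y)) = u (e `[a, b]%classic y).
  by apply: (intertwine_itv (unitary_bnd uu) uX ab); rewrite e_idem.
have h2 y : e `[a, b]%classic (adj u (e `[a, b]%classic y)) = adj u (e `[a, b]%classic y).
  apply: (intertwine_itv (unitary_bnd (unitary_adj uu)) uX' ab); exact: e_idem.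
apply: dot_ext => y; rewrite e_sa// (op_adjP u) -h2 -e_sa// -(op_adjP u).
by rewrite -e_sa// h1.
Qed.

Lemma mu_unitary x S : measurable S -> mu (u x) S = mu x S.
Proof.
(* An exhaustion of the line by sets of finite mass, for the uniqueness of measures agreeing on
   half-open intervals. *)
pose g (n : nat) : set TR := `](- n%:R), n%:R]%classic.
move=> mS; apply: (@measure_unique _ R TR (@ocitv R) g _ _ _ _ (mu (u x)) (mu x) _ _ S mS) => //.
- exact: ocitvI.
- by move=> n; exists (- n%:R, n%:R).
- apply/seteqP; split=> // t _.
  have [n tn] : exists n : nat, `|t| < n%:R by eexists; exact: archi_boundP.
  exists n => //; move: tn; rewrite /g/= in_itv/= ltr_norml => /andP[-> /ltW].
  by [].
- move=> _ [[a b] _ <-]; rewrite /=.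
  have [ab|ba] := leP a b; last first.
    by rewrite set_itv_ge ?measure0// bnd_simp -leNgt ltW.
  (* Commutation is known for closed intervals only; removing the degenerate interval [a, a] gives
     the half-open ones. *)
  have -> : (`]a, b]%classic : set TR) = `[a, b]%classic `&` ~` `[a, a]%classic.
    apply/seteqP; split=> t /=; rewrite !in_itv/=.
      by move=> /andP[ta tb]; rewrite (ltW ta) tb; split=> //; rewrite leNgt ta.
    move=> [/andP[ta tb] /negP]; rewrite tb andbT negb_and -!ltNge.
    by case/orP=> //; rewrite ltNge ta.
  have mi c d : measurable (`[c, d]%classic : set TR) by exact: measurable_itv.
  rewrite !muE ?eI ?e_compl//; try by apply: measurableI => //; exact: measurableC.
  all: try exact: measurableC.
  rewrite e_itv_comm// -bopB e_itv_comm// !hn2E unitary_dot//.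
- by move=> n; rewrite ltey_eq fin_num_measure//; exact: measurable_itv.
Qed.

(** Evaluating the form at x + Dx leaves 2 |Dx|^2. *)
Lemma sa_form_eq0 (D : bop H) : self_adjoint D ->
  (forall x, complex.Re <| D x, x |> = 0) -> D = 0.
Proof.
move=> sD D0; apply: bop_ext => x; apply: hn_eq0; apply/eqP.
rewrite -sqrf_eq0; apply/eqP.
have := D0 (x + D x); rewrite bopD dotDl !dotDr !ReD !D0 add0r addr0.
by rewrite (sD (D x) x) -hn2E; lra.
Qed.

Lemma e_comm S : measurable S -> e S * u = u * e S.
Proof.
move=> mS; have esa : adj (e S) = e S by case: he => h _ _ _; apply/self_adjointE/h.
have h : adj u * e S * u - e S = 0.
  apply: sa_form_eq0.
    by apply/self_adjointE; rewrite op_adjB !op_adjM op_adjK esa mulrA.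
  move=> x; rewrite subbE !mulbE dotBl ReB op_adjPl e_sa// -hn_e2// e_sa// -hn_e2//.
  by have := mu_unitary x mS; rewrite !muE// => -[->]; rewrite subrr.
move/eqP: h; rewrite subr_eq0 => /eqP h; case: uu => _ uu'.
by rewrite -[LHS]mul1r -uu' -!mulrA (mulrA (adj u)) h.
Qed.

End Unitary.

Lemma spectral_projection_mem (A : set (bop H)) S : von_Neumann_algebra A ->
  affiliated A X -> measurable S -> A (e S).
Proof.
move=> vA [_ aff] mS; apply: (vN_mem vA) => u Au uu; apply: e_comm => //.
  exact: aff.
apply: aff; last exact: unitary_adj.
by apply: adj_commutant => //; exact: vN_adj.
Qed.

End SpectralMeasure.

(** * Resolvents *)

Section ScalarResolvent.
Variables (R : realType) (H : hilbertType R) (X : unbounded H).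
Hypotheses (Xsa : uself_adjoint X) (Xcdd : closed_densely_defined X).
Local Notation dom := (udom X).
Implicit Types (x y z : H) (t : R).

Local Notation shift t x := ((t%:C * 'i%C) *: x - uact X x).

Lemma shift_norm t x : dom x ->
  hn (shift t x) ^+ 2 = t ^+ 2 * hn x ^+ 2 + hn (uact X x) ^+ 2.
Proof.
move=> dx; rewrite hn2B hnZ cnM cnR cni mulr1 exprMn real_normK ?num_real//.
have := usym Xsa dx dx; rewrite dotZl dotC; case: <| x, _ |> => p q [] h.
have -> : q = 0 by lra.
by rewrite /=; lra.
Qed.

Lemma shift_lower t x : dom x -> `|t| * hn x <= hn (shift t x).
Proof.
move=> dx; rewrite -(@ler_pXn2r _ 2) ?nnegrE ?mulr_ge0 ?hn_ge0//.
by rewrite shift_norm// exprMn real_normK ?num_real// lerDl sqr_ge0.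
Qed.

Lemma shift_lin t k x y : dom x -> dom y ->
  shift t (k *: x + y) = k *: shift t x + shift t y.
Proof.
move=> dx dy; rewrite uact_lin// scalerDr scalerBr opprD addrACA.
by rewrite !scalerA [_ * k]mulrC.
Qed.

Lemma shiftB t x y : dom x -> dom y -> shift t (x - y) = shift t x - shift t y.
Proof.
move=> dx dy; have -> : x - y = -1 *: y + x by rewrite scaleN1r addrC.
by rewrite shift_lin// scaleN1r addrC.
Qed.

(** Self-adjointness describes the graph by the equations <Xw, x> = <w, y> with w in the domain, and
    these pass to limits. *)
Lemma graph_closed (u : nat -> H) x y : (forall n, dom (u n)) -> hlim u x ->
  hlim (fun n => uact X (u n)) y -> dom x /\ uact X x = y.
Proof.
move=> du ux uy; apply/Xsa => w dw; apply/eqP; rewrite -subr_eq0; apply/eqP.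
apply: cn_eq0; apply/eqP; rewrite eq_le cn_ge0 andbT; apply/ler_addgt0Pr => eps e0.
have c0 : 0 < hn (uact X w) + hn w + 1.
  by have := hn_ge0 w; have := hn_ge0 (uact X w); lra.
have [N1 h1] := ux _ (divr_gt0 e0 c0); have [N2 h2] := uy _ (divr_gt0 e0 c0).
pose n := maxn N1 N2.
have {}h1 := h1 n (leq_maxl _ _); have {}h2 := h2 n (leq_maxr _ _).
have -> : <| uact X w, x |> - <| w, y |> =
    - (<| uact X w, u n - x |> - <| w, uact X (u n) - y |>).
  by rewrite !dotBr (usym Xsa dw (du n)) subBB opprK.
rewrite cnN add0r (le_trans (cnD _ _))// cnN.
apply: le_trans (lerD (cn_dot _ _) (cn_dot _ _)) _.
move: h1 h2; rewrite !ltr_pdivlMr//.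
have := hn_ge0 w; have := hn_ge0 (uact X w); have := hn_ge0 (u n - x).
have := hn_ge0 (uact X (u n) - y).
move: (hn w) (hn (uact X w)) (hn (u n - x)) (hn (uact X (u n) - y)) c0.
move=> a b c d _ d0 c0 b0 a0 h1 h2.
have [cd|dc] := leP c d; [apply: le_trans (ltW h2)|apply: le_trans (ltW h1)].
  by have := ler_wpM2l b0 cd; lra.
by have := ler_wpM2l a0 (ltW dc); lra.
Qed.

(** The range of ti - X is closed, by the lower bound and the closed graph, so it remains to see
    that its orthogonal complement is zero. *)
Lemma shift_surj t : t != 0 -> forall y, exists x, dom x /\ shift t x = y.
Proof.
move=> t0 y; have tp : 0 < `|t| by rewrite normr_gt0.
pose V := [set y | exists x, dom x /\ shift t x = y].
have Vc : hclosed_subspace V.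
  split.
  - by exists 0; split; [exact: dom0|rewrite uact0// scaler0 subr0].
  - move=> k _ _ [x [dx <-]] [x' [dx' <-]]; exists (k *: x + x').
    by split; [exact: dom_lin|rewrite shift_lin].
  - move=> v y' /choice[u hu] vy.
    have du n : dom (u n) by case: (hu n).
    have uE n : shift t (u n) = v n by case: (hu n).
    have [x ux] : exists x, hlim u x.
      apply: hcomplete => eps e0.
      have e2 : 0 < eps * `|t| / 2 by rewrite divr_gt0// mulr_gt0.
      have [N hN] := vy _ e2; exists N => m n Nm Nn.
      rewrite -(ltr_pM2r tp); apply: le_lt_trans (_ : _ <= hn (v m - v n)) _.
        rewrite mulrC -!uE; have := shift_lower t (domB Xcdd (du m) (du n)).
        by rewrite shiftB.
      apply: le_lt_trans (hn_tri y' _ _) _; rewrite (hnBC y').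
      by have := hN _ Nm; have := hN _ Nn; lra.
    have uX : hlim (fun n => uact X (u n)) ((t%:C * 'i%C) *: x - y').
      have := hlimZD (t%:C * 'i%C) ux (hlimZD (-1) vy (hlim_cst 0)).
      rewrite addr0 scaleN1r; congr (hlim _ _); apply: funext => n /=.
      by rewrite addr0 scaleN1r -uE opprB addrC subrK.
    have [dx Xx] := graph_closed du ux uX.
    by exists x; split=> //; rewrite Xx opprB addrC subrK.
have [y' [x [dx xy']] ort] := projection_theorem Vc y.
exists x; split=> //; rewrite xy'; apply/eqP; rewrite eq_sym -subr_eq0; apply/eqP.
set w := y - y' in ort *.
(* Orthogonality to the range puts [w] in the domain of the adjoint, which is X, as an eigenvector
   for - t i; the lower bound for - t excludes this unless [w = 0]. *)
have [dw Xw] : dom w /\ uact X w = ((- t)%:C * 'i%C) *: w.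
  apply/Xsa => z dz; have /eqP := ort _ (ex_intro _ z (conj dz erefl)).
  rewrite dotBr subr_eq0 => /eqP /(congr1 (@conjc R)); rewrite -!dotC => <-.
  rewrite dotZl dotZr; congr (_ * _).
  by apply/eqP; rewrite eq_complex/=; apply/andP; split; apply/eqP; ring.
have := shift_lower (- t) dw; rewrite Xw subrr hn0 normrN => h.
apply: hn_eq0; apply/eqP; rewrite eq_le hn_ge0 andbT.
by rewrite -(ler_pM2l tp) mulr0.
Qed.

Definition is_scalar_resolvent t (rho : bop H) :=
  (forall x, dom (rho x) /\ shift t (rho x) = x) /\
  (forall x, dom x -> rho (shift t x) = x).

Lemma scalar_resolvent t : t != 0 ->
  exists2 rho, is_scalar_resolvent t rho & bnd rho `|t|^-1.
Proof.
move=> t0; have tp : 0 < `|t| by rewrite normr_gt0.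
have /choice[f hf] := shift_surj t0.
have inj x y : dom x -> dom y -> shift t x = shift t y -> x = y.
  move=> dx dy xy; have := shift_lower t (domB Xcdd dx dy).
  rewrite shiftB// xy subrr hn0 => h; apply/eqP; rewrite -subr_eq0; apply/eqP.
  by apply: hn_eq0; apply/eqP; rewrite eq_le hn_ge0 andbT -(ler_pM2l tp) mulr0.
have df x : dom (f x) by case: (hf x).
have fE x : shift t (f x) = x by case: (hf x).
have flin : linear f.
  move=> k x y; apply: inj; rewrite ?shift_lin ?fE//; exact: dom_lin.
have fb x : hn (f x) <= `|t|^-1 * hn x.
  by rewrite mulrC ler_pdivlMr// mulrC -{2}(fE x) shift_lower.
have [rho rhoE] := bounded_linear_bop flin fb.
exists rho; last by split; [rewrite invr_ge0|move=> x; rewrite rhoE].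
split=> x; first by rewrite rhoE.
by move=> dx; rewrite rhoE; apply: inj; rewrite ?fE.
Qed.

Lemma scalar_resolvent_mem (A : set (bop H)) t rho : von_Neumann_algebra A ->
  affiliated A X -> is_scalar_resolvent t rho -> A rho.
Proof.
move=> vA [_ aff] [h1 h2]; apply: (vN_mem vA) => u Au uu; apply: bop_ext => x.
have [dr rE] := h1 x; have [dur urE] := aff u Au uu _ dr.
rewrite !mulbE -[RHS]h2//; congr (rho _).
by rewrite urE -bopZ -bopB rE.
Qed.

End ScalarResolvent.

(** * Matrix resolvents and their perturbation *)

Section MatrixResolvent.
Variables (R : realType) (H : hilbertType R) (A : set (bop H)) (X : unbounded H).
Hypotheses (vA : von_Neumann_algebra A) (Xcdd : closed_densely_defined X).
Variable m : nat.
Implicit Types b c : 'M[bop H]_m.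

Lemma resolvent_unique b c c' : is_resolvent A X b c -> is_resolvent A X b c' -> c = c'.
Proof.
move=> [_ h _] [_ _ h']; apply: mx_act_inj => v.
have := h' (mx_act c v) (fun i => (h v i).1).
have -> : (fun j => mx_act b (mx_act c v) j - uact X (mx_act c v j)) = v.
  by apply: funext => i; case: (h v i).
by move=> hh; apply: funext => i; rewrite hh.
Qed.

(** (b - X) c' v = v - (b' - b) c' v, and c is applied to both sides; c' maps into the domain, so
    every step is defined. *)
Lemma resolvent_identity b b' c c' :
  is_resolvent A X b c -> is_resolvent A X b' c' -> c - c' = c *m (b' - b) *m c'.
Proof.
move=> [_ _ h] [_ h' _]; apply: mx_act_inj => v.
have hv : (fun j => mx_act b (mx_act c' v) j - uact X (mx_act c' v j)) =
    vadd v (vscale (-1) (mx_act (b' - b) (mx_act c' v))).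
  apply: funext => j; have [_ e] := h' v j.
  rewrite /vadd /vscale mx_actD mx_actN /vadd /vscale !scaleN1r -e.
  by rewrite opprB [RHS]addrC addrA subrK.
rewrite !mx_actM mx_actD mx_actN; apply: funext => i.
have := h (mx_act c' v) (fun i => (h' v i).1) i.
rewrite hv mx_act_vadd mx_act_vscale /vadd /vscale !scaleN1r => <-.
by rewrite opprB addrC subrK.
Qed.

Lemma resolvent_diag (t : 'I_m -> R) (rho : 'rV[bop H]_m) :
  (forall j, is_scalar_resolvent X (t j) (rho 0 j)) -> (forall j, A (rho 0 j)) ->
  is_resolvent A X (diag_mx (\row_j op_scalar H ((t j)%:C * 'i%C))) (diag_mx rho).
Proof.
move=> h Ar; split; first exact: mx_in_diag.
- by move=> v i; rewrite !mx_act_diag mxE; case: (h i) => /(_ (v i)).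
- move=> v dv i; rewrite mx_act_diag mx_act_diag mxE; have [_ h2] := h i.
  exact: h2 (dv i).
Qed.

(** With be = b - b0, the resolvent is c0 (1 + be c0)^-1 = (1 + c0 be)^-1 c0. The first form shows
    that it is a right inverse of b - X, the second that it is a left inverse on the domain. *)
Lemma resolvent_pert b0 c0 b : is_resolvent A X b0 c0 -> mx_in A (b - b0) ->
  op_norm (b - b0) * op_norm c0 <= 2^-1 ->
  exists2 c, is_resolvent A X b c & op_norm c <= 2 * op_norm c0.
Proof.
move=> [Ac0 r1 r2]; set be := b - b0 => Abe hb.
have bE v i : mx_act b v i = mx_act b0 v i + mx_act be v i.
  by rewrite -[b](subrK b0) -/be addrC mx_actD.
have n1 : op_norm (be *m c0) <= 2^-1 by exact: le_trans (op_normM _ _) hb.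
have n2 : op_norm (c0 *m be) <= 2^-1.
  by apply: le_trans (op_normM _ _) _; rewrite mulrC.
have half1 : 2^-1 < 1 :> R by lra.
have [y [y1 y2 y3]] := neumann (le_lt_trans n1 half1).
have [z [z1 z2 z3]] := neumann (le_lt_trans n2 half1).
have zy : z *m c0 = c0 *m y.
  rewrite -[LHS]mulmx1 -y1 mulmxA -(mulmxA z) mulmxDr mulmx1 mulmxA.
  by rewrite -[X in z *m (X + _)]mul1mx -mulmxDl mulmxA z2 mul1mx.
exists (c0 *m y).
  split.
  - apply: (mx_inM vA) => //; apply: (mx_in_inv vA _ (conj y1 y2)).
    by apply: mx_inD => //; [exact: mx_in1|exact: mx_inM].
  - move=> v i; rewrite mx_actM; have [d e] := r1 (mx_act y v) i; split=> //.
    rewrite bE addrAC e -(mx_actM be c0).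
    by have := congr1 (fun w => mx_act w v i) y1; rewrite mx_actM mx_actD !mx_act1.
  - move=> v dv i; rewrite -zy mx_actM.
    have -> : (fun j => mx_act b v j - uact X (v j)) =
        vadd (fun j => mx_act b0 v j - uact X (v j)) (mx_act be v).
      by apply: funext => j; rewrite bE /vadd addrAC.
    rewrite mx_act_vadd (_ : mx_act c0 _ = v); last first.
      by apply: funext => j; rewrite r2.
    rewrite -[X in vadd X _]mx_act1 -mx_actM -mx_actD -mx_actM z2.
    by rewrite mx_act1.
rewrite mulrC; apply: op_normM_le => //; apply: (le_trans y3).
rewrite -[leRHS]invrK lef_pV2 ?posrE ?invr_gt0// ?subr_gt0 ?(le_lt_trans n1)//.
by move: n1; lra.
Qed.

End MatrixResolvent.

(** * The points d_n(l) *)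

Section DiagonalPoint.
Variables (R : realType) (H : hilbertType R) (n : nat).
Implicit Types (s t l : R).
Local Notation d := (@d_ R H n).

Lemma d_E l : d l = diag_mx (\row_k op_scalar H (((-1) ^+ k * l)%:C * 'i%C)).
Proof.
rewrite /d_; congr diag_mx; apply/rowP => k; rewrite !mxE; congr op_scalar.
by rewrite rmorphM rmorphXn rmorphN1 -mulrA [_ * 'i%C]mulrC ?complexiE.
Qed.

(** Matrices over [bop H] form a module over [bop H]; real numbers act on them entry by entry. *)
Definition mx_real_scale s (a : 'M[bop H]_(2 * n)) : 'M[bop H]_(2 * n) :=
  \matrix_(i, j) (s%:C *: a i j).

Lemma mx_act_real_scale s a v : mx_act (mx_real_scale s a) v = vscale s%:C (mx_act a v).
Proof.
apply: funext => i; rewrite /mx_act /vscale scaler_sumr.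
by apply: eq_bigr => j _; rewrite mxE.
Qed.

Lemma op_norm_real_scale s a : op_norm (mx_real_scale s a) <= `|s| * op_norm a.
Proof.
apply: op_norm_le => [|v]; first by rewrite mulr_ge0 ?op_norm_ge0.
by rewrite mx_act_real_scale vnormZ cnR -mulrA ler_wpM2l ?op_norm_act.
Qed.

Lemma mx_real_scaleB s a b :
  mx_real_scale s (a - b) = mx_real_scale s a - mx_real_scale s b.
Proof. by apply/matrixP => i j; rewrite !mxE scalerBr. Qed.

Lemma mx_real_scaleBl s t a :
  mx_real_scale (s - t) a = mx_real_scale s a - mx_real_scale t a.
Proof. by apply/matrixP => i j; rewrite !mxE rmorphB scalerBl. Qed.

Lemma mx_real_scale1 a : mx_real_scale 1 a = a.
Proof. by apply/matrixP => i j; rewrite !mxE scale1r. Qed.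

Lemma mx_real_scale0 a : mx_real_scale 0 a = 0.
Proof. by apply/matrixP => i j; rewrite !mxE scale0r. Qed.

(** Real linearity in [l] is what makes the domain of the R-transform convex. *)
Lemma d_lin s t l l' :
  d (s * l + t * l') = mx_real_scale s (d l) + mx_real_scale t (d l').
Proof.
apply/matrixP => i j; rewrite !d_E !mxE.
case: (i == j); rewrite ?mulr1n ?mulr0n ?scaler0 ?addr0//.
rewrite /op_scalar !scalerA -scalerDl; congr (_ *: _).
by rewrite !(rmorphM, rmorphD)/=; ring.
Qed.

Lemma op_scalarM (k k' : R[i]) : op_scalar H k * op_scalar H k' = op_scalar H (k * k').
Proof. by rewrite /op_scalar bop_scalerAl mul1r scalerA. Qed.

(** (i s)(i t) = - s t, and the alternating signs square to 1; thus d(- 1/l) is the inverse of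
    d(l). *)
Lemma d_inverse s t : s * t = -1 -> mx_inverse (d s) (d t).
Proof.
have h a b : a * b = -1 -> d a *m d b = 1%:M.
  move=> ab; rewrite !d_E mulmx_diag; apply/matrixP => i j; rewrite !mxE.
  case: (i == j); rewrite ?mulr1n ?mulr0n// op_scalarM.
  have -> : ((-1) ^+ i * a)%:C * 'i%C * (((-1) ^+ i * b)%:C * 'i%C) = 1 :> R[i].
    rewrite mulrACA -rmorphM -expr2 sqr_i mulrACA -exprD addnn -signr_odd odd_double.
    by rewrite expr0 mul1r ab rmorphN mulrNN rmorph1 mul1r.
  by rewrite /op_scalar scale1r.
by move=> st; split; apply: h => //; rewrite mulrC.
Qed.

Lemma d_norm l : op_norm (d l) <= `|l|.
Proof.
rewrite d_E; apply: op_norm_diag => // i; rewrite mxE.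
have -> : `|l| = cn (((-1) ^+ i * l)%:C * 'i%C) * 1.
  by rewrite mulr1 cnM cni cnR mulr1 normrM normrX normrN1 expr1n mul1r.
exact/bndZ/bnd1.
Qed.

Lemma d_mem (A : set (bop H)) l : von_Neumann_algebra A -> mx_in A (d l).
Proof. by move=> vA; rewrite d_E; apply: mx_in_diag => // i; rewrite mxE; exact: vN_scalar. Qed.

Lemma d_resolvent (A : set (bop H)) (X : unbounded H) l :
  von_Neumann_algebra A -> affiliated A X -> uself_adjoint X -> l != 0 ->
  exists2 c, is_resolvent A X (d l) c & op_norm c <= `|l|^-1.
Proof.
move=> vA aff sa l0; have cdd : closed_densely_defined X by case: aff.
have e1 (k : nat) : `|(-1) ^+ k * l| = `|l|.
  by rewrite normrM normrX normrN1 expr1n mul1r.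
have /choice[rho hrho] : forall k : 'I_(2 * n), exists r,
    is_scalar_resolvent X ((-1) ^+ k * l) r /\ bnd r `|l|^-1.
  move=> k; have [|r h1 h2] := @scalar_resolvent _ _ _ sa cdd ((-1) ^+ k * l).
    by rewrite -normr_eq0 e1 normr_eq0.
  by exists r; split=> //; rewrite -(e1 k).
exists (diag_mx (\row_k rho k)).
  rewrite d_E; apply: resolvent_diag => // k; rewrite mxE; first by case: (hrho k).
  by apply: (scalar_resolvent_mem vA aff); case: (hrho k) => h _; exact: h.
apply: op_norm_diag => [|k]; first by rewrite invr_ge0.
by rewrite mxE; case: (hrho k).
Qed.

End DiagonalPoint.

(** * Tightness and the conditional expectation *)

Section EntrywiseExpectation.
Variables (R : realType) (H : hilbertType R) (A B : set (bop H)).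
Variables (tau : bop H -> R[i]) (E : bop H -> bop H).
Hypothesis hAEB : tracial_opval_space A tau E B.
Variable m : nat.
Implicit Types (a b c z : 'M[bop H]_m) (q u : bop H) (r s : R).

Let vA := vn_A hAEB.

Lemma mulmx_scalarr a u i j : (a *m u%:M) i j = a i j * u.
Proof.
rewrite !mxE (bigD1 j)//= mxE eqxx mulr1n big1 ?addr0// => k kj.
by rewrite mxE (negbTE kj) mulr0n mulr0.
Qed.

Lemma mx_act_scalar u v i : mx_act (u%:M : 'M[bop H]_m) v i = u (v i).
Proof.
rewrite /mx_act (bigD1 i)//= mxE eqxx mulr1n big1 ?addr0// => j ji.
by rewrite mxE eq_sym (negbTE ji).
Qed.

Lemma map_E_sub a b : mx_in A a -> mx_in A b ->
  map_mx E (a - b) = map_mx E a - map_mx E b.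
Proof. by move=> ha hb; apply/matrixP => i j; rewrite !mxE (E_sub hAEB). Qed.

Lemma map_E_add a b : mx_in A a -> mx_in A b ->
  map_mx E (a + b) = map_mx E a + map_mx E b.
Proof. by move=> ha hb; apply/matrixP => i j; rewrite !mxE (E_D hAEB). Qed.

Lemma map_E_id b : mx_in B b -> map_mx E b = b.
Proof. by move=> hb; apply/matrixP => i j; rewrite mxE (E_B hAEB). Qed.

Lemma map_E_in a : mx_in A a -> mx_in B (map_mx E a).
Proof. by move=> ha i j; rewrite mxE; exact: (E_range hAEB). Qed.

Lemma map_E_proj_bound : finite_dimensional B -> exists2 C : R, 0 <= C &
  forall a q c, mx_in A a -> A q -> mx_in A c -> adj q = q -> q * q = q ->
    op_norm (map_mx E (a *m q%:M *m c)) <=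
    C * Num.sqrt (complex.Re (tau q)) * (op_norm a * op_norm c).
Proof.
(* An entry of the product is a sum of [m] terms, and passing from entries to the operator norm
   costs [m ^ 2]. *)
move=> /(E_proj_bound hAEB)[C C0 hC]; exists (m%:R ^+ 2 * (m%:R * C)).
  by rewrite !mulr_ge0 ?sqr_ge0.
move=> a q c Aa Aq Ac qa qq.
have s0 : 0 <= C * Num.sqrt (complex.Re (tau q)) * (op_norm a * op_norm c).
  by rewrite !mulr_ge0 ?sqrtr_ge0 ?op_norm_ge0.
set s := C * _ * _ in s0.
have -> : m%:R ^+ 2 * (m%:R * C) * Num.sqrt (complex.Re (tau q)) *
    (op_norm a * op_norm c) = m%:R ^+ 2 * (m%:R * s) by rewrite /s; ring.
apply: op_norm_entries => [|i j]; first by rewrite mulr_ge0.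
rewrite mxE mxE.
under eq_bigr do rewrite mulmx_scalarr.
rewrite (E_sum hAEB); last by move=> k; do 2 apply: (vNM vA) => //.
suff : bnd (\sum_(k < m) E (a i k * q * c k j)) (\sum_(k < m) s).
  by rewrite sumr_const card_ord mulr_natl.
elim/big_ind2 : _ => [|x x' y y'|k _]; last 2 first.
- exact: bndD.
- by apply: hC => //; exact: bnd_entry.
- by split=> // x; rewrite mul0r hn0.
Qed.

End EntrywiseExpectation.

(** * Estimates by a spectral cutoff *)

Section Estimate.
Variables (R : realType) (H : hilbertType R) (A B : set (bop H)).
Variables (tau : bop H -> R[i]) (E : bop H -> bop H).
Hypothesis hAEB : tracial_opval_space A tau E B.
Variables (X : unbounded H) (e : set (measurableTypeR R) -> bop H).
Hypotheses (aff : affiliated A X) (Xsa : uself_adjoint X).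
Hypothesis he : spectral_measure X e.
Variables (m : nat) (C : R).
Hypothesis C0 : 0 <= C.
Hypothesis hC : forall (a c : 'M[bop H]_m) q, mx_in A a -> A q -> mx_in A c ->
  adj q = q -> q * q = q ->
    op_norm (map_mx E (a *m q%:M *m c)) <=
    C * Num.sqrt (complex.Re (tau q)) * (op_norm a * op_norm c).

Let vA := vn_A hAEB.
Let cdd : closed_densely_defined X. Proof. by case: aff. Qed.

(** The projection estimate with q = c = 1, where tau(1) = 1, shows that E itself is bounded with
    the same constant. *)
Lemma map_E_bound (z : 'M[bop H]_m) : mx_in A z -> op_norm (map_mx E z) <= C * op_norm z.
Proof.
move=> Az; have := hC Az (vN1 vA) (mx_in1 vA (m := m)) (op_adj1 H) (mulr1 1).
rewrite !mulmx1 (tau1 hAEB)/= sqrtr1 mulr1 => /le_trans; apply.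
by rewrite ler_wpM2l// ler_piMr ?op_norm_ge0// op_norm1.
Qed.

Variables (S : set (measurableTypeR R)) (T : R).
Hypotheses (mS : measurable S) (T0 : 0 <= T) (ST : forall t, S t -> `|t| <= T).
Let P := e S.
Let Q := e (~` S).

Lemma cutoff_dom x : udom X (P x).
Proof. by apply: (dom_bounded he mS _ ST); exact: (e_idem he). Qed.

Lemma cutoff_bound x : hn (uact X (P x)) <= T * hn x.
Proof.
have Sr t : S t -> 0 - T <= t <= 0 + T by rewrite sub0r add0r -ler_norml; exact: ST.
have := shifted_bound Xsa cdd he mS (e_idem he x mS) T0 Sr (cutoff_dom x).
rewrite scale0r subr0 => /le_trans; apply.
by rewrite ler_wpM2l// (hn_e_le he).
Qed.

Lemma cutoff_split : (P%:M : 'M[bop H]_m) + Q%:M = 1%:M.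
Proof.
rewrite -raddfD /=; congr (_%:M); apply: bop_ext => x.
by rewrite addbE /Q (e_compl he)// addrC subrK.
Qed.

Let AP : A P. Proof. exact: (spectral_projection_mem Xsa cdd he vA aff). Qed.
Let AQ : A Q.
Proof. by apply: (spectral_projection_mem Xsa cdd he vA aff); exact: measurableC. Qed.
Let Qa : adj Q = Q.
Proof. by case: he => h _ _ _; apply/self_adjointE/h; exact: measurableC. Qed.
Let QQ : Q * Q = Q.
Proof. by apply: bop_ext => x; rewrite mulbE (e_idem he)//; exact: measurableC. Qed.

Variables (b c : 'M[bop H]_m).
Hypotheses (hc : is_resolvent A X b c) (Ab : mx_in A b).

Let Ac : mx_in A c. Proof. by case: hc. Qed.
Let AP' : mx_in A (P%:M : 'M[bop H]_m).
Proof.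
by move=> i j; rewrite mxE; case: eqP => _; rewrite ?mulr1n// mulr0n; exact: vN0.
Qed.

Lemma cutoff_left : op_norm ((c *m b - 1%:M) *m P%:M) <= op_norm c * T.
Proof.
case: hc => _ _ h; apply: op_norm_le => [|v]; first by rewrite mulr_ge0 ?op_norm_ge0.
pose w := mx_act (P%:M) v; pose Xw i := uact X (w i).
have dw i : udom X (w i) by rewrite /w mx_act_scalar; exact: cutoff_dom.
have -> : mx_act ((c *m b - 1%:M) *m P%:M) v = mx_act c Xw.
  rewrite mx_actM -/w mx_actD mx_actN mx_act1 mx_actM; apply: funext => i.
  rewrite /vadd /vscale scaleN1r -(h w dw i).
  have -> : (fun j => mx_act b w j - uact X (w j)) = vadd (mx_act b w) (vscale (-1) Xw).
    by apply: funext => j; rewrite /vadd /vscale scaleN1r.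
  by rewrite mx_act_vadd mx_act_vscale /vadd /vscale scaleN1r opprB addrC subrK.
rewrite -mulrA; apply: le_trans (op_norm_act _ _) _.
rewrite ler_wpM2l ?op_norm_ge0//; apply: vnorm_mono => // i.
by rewrite /Xw /w mx_act_scalar cutoff_bound.
Qed.

(** Here b c - 1 = X c, and P X c = X P c because P reduces X. *)
Lemma cutoff_right : op_norm (P%:M *m (b *m c - 1%:M)) <= T * op_norm c.
Proof.
case: hc => _ h _; apply: op_norm_le => [|v]; first by rewrite mulr_ge0 ?op_norm_ge0.
rewrite -mulrA; apply: le_trans (_ : _ <= T * vnorm (mx_act c v)) _; last first.
  by rewrite ler_wpM2l// op_norm_act.
apply: vnorm_mono => // i; rewrite mx_actM mx_act_scalar.
rewrite mx_actD mx_actN mx_act1 mx_actM /vadd /vscale scaleN1r.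
have [d r] := h v i; rewrite -r opprB addrC subrK.
by rewrite -(e_reduces Xsa cdd he mS d) cutoff_bound.
Qed.

(** Insert 1 = P + Q between the two factors. On P the defect is small in norm; on Q it is only
    bounded by [k], and the gain is sqrt(tau(Q)). *)
Lemma estimate_left (z : 'M[bop H]_m) k : op_norm (c *m b - 1%:M) <= k -> mx_in A z ->
  op_norm (map_mx E ((c *m b - 1%:M) *m z)) <=
  C * (op_norm c * T + k * Num.sqrt (complex.Re (tau Q))) * op_norm z.
Proof.
move=> hk Az; set a := c *m b - 1%:M.
have Aa : mx_in A a by apply: (mx_inB vA); [exact: mx_inM|exact: mx_in1].
have -> : a *m z = a *m P%:M *m z + a *m Q%:M *m z.
  by rewrite -mulmxDl -mulmxDr cutoff_split mulmx1.
have AQ' : mx_in A (Q%:M : 'M[bop H]_m).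
  by move=> i j; rewrite mxE; case: eqP => _; rewrite ?mulr1n// mulr0n; exact: vN0.
rewrite (map_E_add hAEB); try by repeat apply: (mx_inM vA).
apply: le_trans (op_normD _ _) _.
have h1 : op_norm (map_mx E (a *m P%:M *m z)) <= C * (op_norm c * T * op_norm z).
  apply: le_trans (map_E_bound _) _; first by repeat apply: (mx_inM vA).
  rewrite ler_wpM2l// (le_trans (op_normM _ _))// ler_wpM2r ?op_norm_ge0//.
  exact: cutoff_left.
have h2 := hC Aa AQ Az Qa QQ.
have h3 : C * Num.sqrt (complex.Re (tau Q)) * (op_norm a * op_norm z) <=
          C * Num.sqrt (complex.Re (tau Q)) * (k * op_norm z).
  by rewrite ler_wpM2l ?mulr_ge0 ?sqrtr_ge0// ler_wpM2r ?op_norm_ge0.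
apply: le_trans (lerD h1 (le_trans h2 h3)) _.
by rewrite le_eqVlt; apply/orP; left; apply/eqP; ring.
Qed.

Lemma estimate_right (z : 'M[bop H]_m) k : op_norm (b *m c - 1%:M) <= k -> mx_in A z ->
  op_norm (map_mx E (z *m (b *m c - 1%:M))) <=
  C * (op_norm c * T + k * Num.sqrt (complex.Re (tau Q))) * op_norm z.
Proof.
move=> hk Az; set a := b *m c - 1%:M.
have Aa : mx_in A a by apply: (mx_inB vA); [exact: mx_inM|exact: mx_in1].
have -> : z *m a = z *m (P%:M *m a) + z *m Q%:M *m a.
  by rewrite mulmxA -mulmxDl -mulmxDr cutoff_split mulmx1.
have AQ' : mx_in A (Q%:M : 'M[bop H]_m).
  by move=> i j; rewrite mxE; case: eqP => _; rewrite ?mulr1n// mulr0n; exact: vN0.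
rewrite (map_E_add hAEB); try by repeat apply: (mx_inM vA).
apply: le_trans (op_normD _ _) _.
have h1 : op_norm (map_mx E (z *m (P%:M *m a))) <= C * (op_norm z * (T * op_norm c)).
  apply: le_trans (map_E_bound _) _; first by repeat apply: (mx_inM vA).
  rewrite ler_wpM2l// (le_trans (op_normM _ _))// ler_wpM2l ?op_norm_ge0//.
  exact: cutoff_right.
have h2 := hC Az AQ Aa Qa QQ.
have h3 : C * Num.sqrt (complex.Re (tau Q)) * (op_norm z * op_norm a) <=
          C * Num.sqrt (complex.Re (tau Q)) * (op_norm z * k).
  by rewrite ler_wpM2l ?mulr_ge0 ?sqrtr_ge0// ler_wpM2l ?op_norm_ge0.
apply: le_trans (lerD h1 (le_trans h2 h3)) _.
by rewrite le_eqVlt; apply/orP; left; apply/eqP; ring.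
Qed.

End Estimate.

(** * Inverting the Cauchy transform *)

Section NumericBounds.
Variable R : realType.
Implicit Types eta x : R.

Lemma lt_quarter_half x : 0 < x -> 4^-1 * x < 2^-1 * x.
Proof. lra. Qed.

Lemma le0_of_le_small eta x : 100 * eta <= 1 -> 0 <= x -> x <= 18 * eta * x -> x <= 0.
Proof. nra. Qed.

(** With x = 1/l: 1/7 bounds the distance from w^-1 to the centre and 8/7 bounds |w^-1|, both in
    units of 1/l, so the fixed-point map preserves the ball of radius x/4. *)
Lemma radius_bound eta x : 100 * eta <= 1 -> 0 < x ->
  7^-1 * x + 8 / 7 * x * (3 * eta) <= 4^-1 * x.
Proof. nra. Qed.

Lemma rate_bound eta : 100 * eta <= 1 -> 16 * eta <= 2^-1.
Proof. lra. Qed.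

End NumericBounds.

(** * The perturbation G_X(b) - b^-1 and the fixed point *)

Section Inversion.
Variables (R : realType) (H : hilbertType R) (A B : set (bop H)).
Variables (tau : bop H -> R[i]) (E : bop H -> bop H).
Hypothesis hAEB : tracial_opval_space A tau E B.
Variable n : nat.
Local Notation mat := 'M[bop H]_(2 * n).
Local Notation d := (@d_ R H n).
Implicit Types (b c w z : mat) (l r t : R).

Let vA := vn_A hAEB.
Let vB := vn_B hAEB.

Lemma mx_in_BA b : mx_in B b -> mx_in A b.
Proof. by move=> hb i j; apply: (sub_BA hAEB). Qed.

(* The balls whose union is the domain on which the Cauchy transform is
   inverted: d (- l^-1) is the inverse of d l. *)
Definition near_inv l b := mx_in B b /\ op_norm (b - d (- l^-1)) < 2^-1 * l^-1.

Definition minv b : mat := xget 0 [set v | mx_inverse b v].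

Lemma minvE b v : mx_inverse b v -> minv b = v.
Proof.
move=> bv; apply: (@mx_inverse_unique _ _ _ b) (bv).
by have := xgetPex 0 (ex_intro (fun v => mx_inverse b v) _ bv).
Qed.

Section NearPoint.
Variables (l : R) (b : mat).
Hypotheses (l0 : 0 < l) (nb : near_inv l b).

Let li : l * l^-1 = 1. Proof. by rewrite divff// gt_eqF. Qed.
Let li0 : 0 < l^-1. Proof. by rewrite invr_gt0. Qed.

(** The centre has norm at most 1/l and the radius is half of that. The same radius gives |b^-1| <=
    2 l and a resolvent of norm at most 2 l. *)
Lemma near_norm : op_norm b <= 3 / 2 * l^-1.
Proof.
have := op_normD (d (- l^-1)) (b - d (- l^-1)); rewrite addrC subrK.
have := d_norm H n (- l^-1); rewrite normrN gtr0_norm//.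
by have := nb.2; lra.
Qed.

Lemma near_minv : [/\ mx_inverse b (minv b), op_norm (minv b) <= 2 * l & mx_in B (minv b)].
Proof.
have hd : mx_inverse (d (- l^-1)) (d l) by apply: d_inverse; rewrite mulNr mulrC li.
have dl : op_norm (d l) <= l by rewrite -[leRHS](gtr0_norm l0) d_norm.
have [||b' [bb' b'n]] := @mx_inverse_pert _ _ _ _ _ b l 2^-1 hd dl.
- apply: (@le_trans _ _ (2^-1 * l^-1 * l)).
    by rewrite ler_wpM2r ?(ltW l0)// ltW// nb.2.
  by rewrite -mulrA mulVf ?gt_eqF// mulr1.
- by lra.
rewrite (minvE bb'); split=> //; last exact: (mx_in_inv vB nb.1 bb').
by move: b'n; have -> : l / (1 - 2^-1) = 2 * l by field.
Qed.

Variable X : unbounded H.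
Hypotheses (aff : affiliated A X) (Xsa : uself_adjoint X).

Lemma near_resolvent : exists2 c, is_resolvent A X b c & op_norm c <= 2 * l.
Proof.
have ln0 : - l^-1 != 0 by rewrite oppr_eq0 gt_eqF.
have [c0 h0] := d_resolvent n vA aff Xsa ln0.
rewrite normrN gtr0_norm// invrK => c0l.
have [||c hc cl] := resolvent_pert vA h0 (b := b).
- by apply: (mx_inB vA); [exact/mx_in_BA/nb.1|exact: d_mem].
- apply: (@le_trans _ _ (2^-1 * l^-1 * l)).
    by rewrite ler_pM ?op_norm_ge0// ltW// nb.2.
  by rewrite -mulrA mulVf ?gt_eqF// mulr1.
by exists c => //; apply: (le_trans cl); rewrite ler_pM2l.
Qed.

(** |c| |b| <= (2 l)(3/2)(1/l) = 3, and the identity adds 1. The bound depends neither on [l] nor on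
    X, so it can be paired with the smallness of tau(Q). *)
Lemma resolvent_defects c : op_norm c <= 2 * l ->
  op_norm (c *m b - 1%:M) <= 4 /\ op_norm (b *m c - 1%:M) <= 4.
Proof.
have h z : op_norm z <= 3 -> op_norm (z - 1%:M) <= 4.
  move=> z3; apply: (le_trans (op_normD _ _)); rewrite op_normN.
  by have := op_norm1 H (2 * n); lra.
have e3 : (2 * l) * (3 / 2 * l^-1) = 3.
  have -> : 2 * l * (3 / 2 * l^-1) = 3 * (l * l^-1) by field; rewrite gt_eqF.
  by rewrite li mulr1.
move=> cl; split; apply: h; rewrite -[leRHS]e3.
  by apply: op_normM_le => //; exact: near_norm.
by rewrite mulrC; apply: op_normM_le => //; exact: near_norm.
Qed.

End NearPoint.

Section Transform.
Variable X : unbounded H.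
Hypotheses (aff : affiliated A X) (Xsa : uself_adjoint X).

(** The only analytic input of the inversion: after E, both defects act as if they had norm [eta].
    Tightness provides it for every positive [eta], with [l0] common to the family. *)
Definition resolvent_estimate eta l0 := forall l b c z,
  0 < l -> l < l0 -> near_inv l b -> is_resolvent A X b c -> op_norm c <= 2 * l ->
  mx_in A z ->
  op_norm (map_mx E ((c *m b - 1%:M) *m z)) <= eta * op_norm z /\
  op_norm (map_mx E (z *m (b *m c - 1%:M))) <= eta * op_norm z.

Local Notation G := (cauchy_transform A E X (m := 2 * n)).

Lemma cauchyE b c : is_resolvent A X b c -> G b = map_mx E c.
Proof.
move=> hc; rewrite /cauchy_transform; congr map_mx.
apply: (resolvent_unique (b := b)) (hc).
by have := xgetPex 0 (ex_intro (fun c => is_resolvent A X b c) _ hc).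
Qed.

Variables (eta l0 : R).
Hypotheses (eta0 : 0 <= eta) (hest : resolvent_estimate eta l0).

(** [minv b] has its entries in B, so E fixes it and G(b) - b^-1 is E applied to (c b - 1) b^-1. *)
Lemma F_bound l b : 0 < l -> l < l0 -> near_inv l b ->
  op_norm (G b - minv b) <= 2 * eta * l /\ mx_in B (G b).
Proof.
move=> lp ll nb; have [c hc cl] := near_resolvent lp nb aff Xsa.
have [[bi ib] bin Bbi] := near_minv lp nb.
have Ac : mx_in A c by case: hc.
rewrite (cauchyE hc); split; last exact: (map_E_in hAEB).
have Abi := mx_in_BA Bbi.
rewrite -{1}(map_E_id hAEB Bbi) -(map_E_sub hAEB)//.
have -> : c - minv b = (c *m b - 1%:M) *m minv b.
  by rewrite mulmxBl mul1mx -mulmxA bi mulmx1.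
have [h _] := hest lp ll nb hc cl Abi.
apply: (le_trans h); rewrite [2 * _]mulrC -mulrA; exact: ler_wpM2l.
Qed.

(** With u, u' the inverses of b, b' and be = b' - b, the difference is c be c' - u be u' under E,
    that is (c b - 1) u be c' + u be u' (b' c' - 1): one defect on the left and one on the right,
    each next to a factor of norm at most 4 l l' |be|. *)
Lemma F_lip l l' b b' : 0 < l -> l < l0 -> 0 < l' -> l' < l0 ->
  near_inv l b -> near_inv l' b' ->
  op_norm ((G b - minv b) - (G b' - minv b')) <= 8 * eta * (l * l') * op_norm (b - b').
Proof.
move=> lp ll lp' ll' nb nb'.
have [c hc cl] := near_resolvent lp nb aff Xsa.
have [c' hc' cl'] := near_resolvent lp' nb' aff Xsa.
have [[bi ib] bin Bbi] := near_minv lp nb.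
have [[bi' ib'] bin' Bbi'] := near_minv lp' nb'.
have Ac : mx_in A c by case: hc.
have Ac' : mx_in A c' by case: hc'.
have Abi := mx_in_BA Bbi; have Abi' := mx_in_BA Bbi'.
have Ab := mx_in_BA nb.1; have Ab' := mx_in_BA nb'.1.
rewrite (cauchyE hc) (cauchyE hc').
set u := minv b in bi ib bin Bbi Abi *; set u' := minv b' in bi' ib' bin' Bbi' Abi' *.
rewrite -(map_E_id hAEB Bbi) -(map_E_id hAEB Bbi') -!(map_E_sub hAEB)//; try exact: (mx_inB vA).
set be := b' - b; have Abe : mx_in A be by exact: (mx_inB vA).
have -> : c - u - (c' - u') =
    (c *m b - 1%:M) *m (u *m be *m c') + (u *m be *m u') *m (b' *m c' - 1%:M).
  have uu : u - u' = u *m be *m u'.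
    by rewrite /be mulmxBr ib mulmxBl mul1mx -mulmxA bi' mulmx1.
  have -> : c - u - (c' - u') = (c - c') - (u - u').
    by rewrite !opprB -!addrA; congr (_ + _); rewrite addrCA [RHS]addrCA [- u + _]addrC.
  rewrite (resolvent_identity hc hc') uu -/be.
  have -> : (c *m b - 1%:M) *m (u *m be *m c') = c *m be *m c' - u *m be *m c'.
    by rewrite mulmxBl mul1mx !mulmxA -(mulmxA c b) bi mulmx1.
  have -> : u *m be *m u' *m (b' *m c' - 1%:M) = u *m be *m c' - u *m be *m u'.
    by rewrite mulmxBr mulmx1 -(mulmxA _ u') (mulmxA u') ib' mul1mx.
  by rewrite addrA subrK.
have Az : mx_in A (u *m be *m c') by repeat apply: (mx_inM vA).
have Az' : mx_in A (u *m be *m u') by repeat apply: (mx_inM vA).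
have Ad : mx_in A (c *m b - 1%:M) by apply: (mx_inB vA); [exact: mx_inM|exact: mx_in1].
have Ad' : mx_in A (b' *m c' - 1%:M) by apply: (mx_inB vA); [exact: mx_inM|exact: mx_in1].
rewrite (map_E_add hAEB); try exact: (mx_inM vA).
apply: (le_trans (op_normD _ _)).
have [h1 _] := hest lp ll nb hc cl Az.
have [_ h2] := hest lp' ll' nb' hc' cl' Az'.
have k1 : op_norm (u *m be *m c') <= 2 * l * op_norm be * (2 * l').
  by apply: op_normM_le => //; exact: op_normM_le.
have k2 : op_norm (u *m be *m u') <= 2 * l * op_norm be * (2 * l').
  by apply: op_normM_le => //; exact: op_normM_le.
have := lerD (le_trans h1 (ler_wpM2l eta0 k1)) (le_trans h2 (ler_wpM2l eta0 k2)).
move/le_trans; apply; rewrite op_normBC -/be le_eqVlt; apply/orP; left; apply/eqP.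
by ring.
Qed.

Hypothesis eta_small : 100 * eta <= 1.

(** If G(b) = G(b'), the inverses differ as much as the perturbations do. Then b - b' = b (b'^-1 -
    b^-1) b' has norm at most (3/2)(8 eta)(3/2) |b - b'| = 18 eta |b - b'|, where 18 eta < 1. *)
Lemma G_inj l l' b b' : 0 < l -> l < l0 -> 0 < l' -> l' < l0 ->
  near_inv l b -> near_inv l' b' -> G b = G b' -> b = b'.
Proof.
move=> lp ll lp' ll' nb nb' Gbb.
have [[bi ib] bin Bbi] := near_minv lp nb.
have [[bi' ib'] bin' Bbi'] := near_minv lp' nb'.
have h := F_lip lp ll lp' ll' nb nb'.
rewrite Gbb subBB op_normN op_normBC in h.
have e : b - b' = b *m (minv b' - minv b) *m b'.
  by rewrite mulmxBr mulmxBl bi mul1mx -mulmxA ib' mulmx1.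
have le1 : op_norm (b - b') <=
    3 / 2 * l^-1 * (8 * eta * (l * l') * op_norm (b - b')) * (3 / 2 * l'^-1).
  rewrite {1}e; apply: op_normM_le; last exact: near_norm.
  apply: op_normM_le; first exact: near_norm.
  by rewrite op_normBC (op_normBC b).
have e2 : 3 / 2 * l^-1 * (8 * eta * (l * l') * op_norm (b - b')) * (3 / 2 * l'^-1) =
    18 * eta * op_norm (b - b').
  by field; rewrite !gt_eqF.
apply/eqP; rewrite -subr_eq0; apply/eqP/op_norm_eq0.
apply: (le0_of_le_small eta_small (op_norm_ge0 _)).
by apply: (le_trans le1); rewrite e2.
Qed.

(** The bound on w b - 1 = F(b) b is recorded because it yields the normalisation at 0 once [eta]
    may shrink. *)
Lemma G_surj l w : 0 < l -> l < l0 -> op_ball B (d l) (l / 8) w ->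
  exists b, [/\ near_inv l b, G b = w, op_norm (w *m b - 1%:M) <= 3 * eta &
                 mx_inverse w (minv w) /\ mx_in B (minv w)].
Proof.
move=> lp ll [Bw wd].
have li0 : 0 < l^-1 by rewrite invr_gt0.
have li : l * l^-1 = 1 by rewrite divff// gt_eqF.
have hd : mx_inverse (d l) (d (- l^-1)) by apply: d_inverse; rewrite mulrN li.
have dn : op_norm (d (- l^-1)) <= l^-1.
  by rewrite -[leRHS](gtr0_norm li0) -[`|l^-1|]normrN d_norm.
(* A relative perturbation of 1/8 gives |w^-1| <= (1/l) / (1 - 1/8). *)
have [||v [wv vn]] := @mx_inverse_pert _ _ _ _ _ w l^-1 8^-1 hd dn.
- apply: (@le_trans _ _ (l / 8 * l^-1)); first by rewrite ler_wpM2r ?(ltW li0)// ltW.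
  by rewrite mulrAC li mul1r.
- by rewrite invf_lt1 ?ltr1n ?ltr0n.
have {}vn : op_norm v <= 8 / 7 * l^-1.
  by apply: (le_trans vn); rewrite le_eqVlt; apply/orP; left; apply/eqP; field; rewrite gt_eqF.
have Bv : mx_in B v by exact: (mx_in_inv vB Bw wv).
(* A fixed point needs a closed set: the closed ball of radius 1/(4 l) lies inside the open one of
   radius 1/(2 l) on which the estimates hold. *)
pose P := [set b | mx_in B b /\ op_norm (b - d (- l^-1)) <= 4^-1 * l^-1].
have Pnear b : P b -> near_inv l b.
  by move=> [Bb bd]; split=> //; apply: (le_lt_trans bd); exact: lt_quarter_half.
have [F FE] : exists F : mat -> mat, forall b, F b = G b - minv b by eexists.
pose Phi b := v *m (1%:M + F b *m b).
have Fb b : P b -> op_norm (F b) <= 2 * eta * l /\ mx_in B (F b).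
  move=> /Pnear nb; have [Fn BG] := F_bound lp ll nb; rewrite FE; split=> //.
  by apply: (mx_inB vB) => //; case: (near_minv lp nb).
have Fbn b : P b -> op_norm (F b *m b) <= 3 * eta.
  move=> Pb; have -> : 3 * eta = (2 * eta * l) * (3 / 2 * l^-1).
    by field; rewrite gt_eqF.
  by apply: op_normM_le; [case: (Fb _ Pb)|exact/near_norm/Pnear].
have vd : op_norm (v - d (- l^-1)) <= 7^-1 * l^-1.
  have -> : v - d (- l^-1) = v *m (d l - w) *m d (- l^-1).
    by rewrite mulmxBr mulmxBl -mulmxA hd.1 mulmx1 wv.2 mul1mx.
  have -> : 7^-1 * l^-1 = 8 / 7 * l^-1 * (l / 8) * l^-1.
    by field; rewrite gt_eqF.
  apply: op_normM_le => //; apply: op_normM_le => //.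
  by rewrite op_normBC ltW.
have q01 : 0 <= (2^-1 : R) < 1 by rewrite invr_ge0 ler0n invf_lt1 ?ltr1n ?ltr0n.
have [|||b b' Pb Pb'|b Pb bE] := @mx_contraction _ _ _ P Phi 2^-1 (d (- l^-1)) q01.
- move=> L hL; split.
    by apply: (mx_in_closed vB) => eps /hL[b [Bb _] h]; exists b.
  apply/ler_addgt0Pr => eps /hL[b [Bb bd] h].
  apply: (le_trans (op_norm_tri b _ _)); rewrite op_normBC addrC.
  by apply: lerD => //; exact: ltW.
- split; first exact: d_mem.
  by rewrite subrr op_norm0 mulr_ge0// ltW.
- move=> b Pb; split.
    apply: (mx_inM vB) => //; apply: (mx_inD vB); first exact: mx_in1.
    by apply: (mx_inM vB); [case: (Fb _ Pb)|case: Pb].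
  have -> : Phi b - d (- l^-1) = v - d (- l^-1) + v *m (F b *m b).
    by rewrite /Phi mulmxDr mulmx1 addrAC.
  apply: (le_trans (op_normD _ _)).
  have := op_normM_le vn (Fbn _ Pb); move/(lerD vd)/le_trans; apply.
  exact: radius_bound.
- have -> : Phi b - Phi b' = v *m ((F b - F b') *m b + F b' *m (b - b')).
    rewrite /Phi -mulmxBr; congr (_ *m _); rewrite opprD addrACA subrr add0r.
    by rewrite mulmxBl mulmxBr addrA subrK.
  have nb := Pnear _ Pb; have nb' := Pnear _ Pb'.
  have := F_lip lp ll lp ll nb nb'; rewrite -!FE => hF.
  have h1 := op_normM_le hF (near_norm lp nb).
  have h2 := op_normM_le (Fb _ Pb').1 (lexx (op_norm (b - b'))).
  have h3 := le_trans (op_normD _ _) (lerD h1 h2).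
  apply: (le_trans (op_normM_le vn h3)).
  (* The powers of [l] cancel, and (8/7)(12 + 2) = 16. *)
  have -> : 8 / 7 * l^-1 * (8 * eta * (l * l) * op_norm (b - b') * (3 / 2 * l^-1) +
      2 * eta * l * op_norm (b - b')) = 16 * eta * op_norm (b - b').
    by field; rewrite gt_eqF.
  by apply: ler_wpM2r (op_norm_ge0 _) _ _ _; exact: rate_bound.
have nb := Pnear _ Pb; have [[bi ib] _ _] := near_minv lp nb.
have wb : w *m b = 1%:M + F b *m b by rewrite -{1}bE /Phi mulmxA wv.1 mul1mx.
exists b; split=> //; last by rewrite (minvE wv).
  have : w *m b = G b *m b by rewrite wb FE mulmxBl ib addrC subrK.
  by move=> /(congr1 (mulmx^~ (minv b))); rewrite -!mulmxA bi !mulmx1.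
by rewrite wb addrAC subrr add0r Fbn.
Qed.

End Transform.
End Inversion.

(** * The domain of the R-transform *)

Section Connectedness.
Variables (R : realType) (H : hilbertType R) (B : set (bop H)) (n : nat).
Local Notation mat := 'M[bop H]_(2 * n).
Implicit Types (x y : mat) (D V W : set mat) (s t : R).

Definition mx_segment x y t : mat := mx_real_scale (1 - t) x + mx_real_scale t y.

Lemma mx_segment0 x y : mx_segment x y 0 = x.
Proof. by rewrite /mx_segment subr0 mx_real_scale1 mx_real_scale0 addr0. Qed.

Lemma mx_segment1 x y : mx_segment x y 1 = y.
Proof. by rewrite /mx_segment subrr mx_real_scale1 mx_real_scale0 add0r. Qed.

Lemma mx_segment_lip x y s t :
  op_norm (mx_segment x y s - mx_segment x y t) <= `|s - t| * op_norm (y - x).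
Proof.
have -> : mx_segment x y s - mx_segment x y t = mx_real_scale (s - t) (y - x).
  rewrite /mx_segment mx_real_scaleB !mx_real_scaleBl !mx_real_scale1.
  move: (mx_real_scale s x) (mx_real_scale s y) (mx_real_scale t x) (mx_real_scale t y).
  move=> sx sy tx ty; rewrite -!(addrA x) [- sx + sy]addrC [- tx + ty]addrC.
  have cancel (p q : mat) : x + (p - (x + q)) = p - q.
    by rewrite opprD addrCA [x + (- x - q)]addrA subrr add0r.
  rewrite cancel !opprB addrACA [RHS]addrACA.
  by rewrite [- sx - ty]addrC.
exact: op_norm_real_scale.
Qed.

Definition mx_convex D := forall x y t, D x -> D y -> 0 <= t <= 1 -> D (mx_segment x y t).

(** On a segment from V to W, the supremum of the parameters sent into V can be sent neither into V
    nor into W, both being open. *)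
Lemma convex_mx_connected D : mx_open B D -> mx_convex D -> mx_open_connected B D.
Proof.
move=> oD cD; split=> // V W [VB oV] [WB oW] VW VWd.
apply: contrapT => /not_orP[/eqP/set0P[x Vx] /eqP/set0P[y Wy]].
pose f := mx_segment x y.
have fD t : 0 <= t <= 1 -> D (f t).
  by move=> t01; apply: cD => //; rewrite -VW; [left|right].
have fVW t : 0 <= t <= 1 -> V (f t) \/ W (f t).
  by move=> /fD; rewrite -VW.
have sep z : V z -> W z -> False.
  by move=> Vz Wz; have : (V `&` W) z by []; rewrite VWd.
have loc Z s : mx_open B Z -> 0 <= s <= 1 -> Z (f s) -> exists2 e : R, 0 < e &
    forall t, 0 <= t <= 1 -> `|t - s| < e -> Z (f t).
  move=> [_ oZ] s01 Zs; have [r r0 hr] := oZ _ Zs.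
  have c0 : 0 < op_norm (y - x) + 1 by have := op_norm_ge0 (y - x); lra.
  exists (r / (op_norm (y - x) + 1)); first exact: divr_gt0.
  move=> t t01 ts; apply: hr; split; first by case: oD => h _; apply: h; exact: fD.
  apply: (le_lt_trans (mx_segment_lip _ _ _ _)).
  move: ts; rewrite ltr_pdivlMr//.
  have := normr_ge0 (t - s); have := op_norm_ge0 (y - x).
  by move: (op_norm _) `|_| => p q; nra.
pose S := [set t | 0 <= t <= 1 /\ V (f t)].
have S0 : S 0 by split; rewrite ?lexx ?ler01// /f mx_segment0.
have supS : has_sup S.
  by split; [exists 0|exists 1 => t [/andP[]]].
have s01 : 0 <= sup S <= 1.
  apply/andP; split; first exact: ub_le_sup supS.2 _ S0.
  by apply: ge_sup; [exists 0|move=> t [/andP[]]].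
have [Vs|Ws] := fVW _ s01.
- have [e e0 he] := loc V _ (conj VB oV) s01 Vs.
  have s1 : sup S < 1.
    rewrite lt_neqAle (andP s01).2 andbT; apply/eqP => s1.
    by apply: (sep (f 1)); [rewrite -s1|rewrite /f mx_segment1].
  have [t [t1 t2 t3]] : exists t, [/\ sup S < t, t <= 1 & t - sup S < e].
    (* A parameter beyond the supremum, still in [0, 1] and within [e] of it. *)
    exists (Num.min 1 (sup S + e / 2)); split.
    + by rewrite lt_min s1 ltrDl divr_gt0.
    + by rewrite ge_min lexx.
    + have : Num.min 1 (sup S + e / 2) <= sup S + e / 2 by rewrite ge_min lexx orbT.
      lra.
  have St : S t.
    have t01 : 0 <= t <= 1 by rewrite t2 andbT (le_trans (andP s01).1)// ltW.
    split=> //; apply: he => //; rewrite gtr0_norm ?subr_gt0//.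
  by have := ub_le_sup supS.2 St; rewrite leNgt t1.
- have [e e0 he] := loc W _ (conj WB oW) s01 Ws.
  have [t [/andP[t0 t1] Vt] st] := sup_adherent e0 supS.
  apply: (sep _ Vt); apply: he; rewrite ?t0//.
  have ts := ub_le_sup supS.2 (conj (introT andP (conj t0 t1)) Vt : S t).
  by rewrite distrC ger0_norm ?subr_ge0//; lra.
Qed.

End Connectedness.

(** * Membership of d_n(l) in Omega_n(B) *)

Section OmegaMembership.
Variables (R : realType) (H : hilbertType R) (A B : set (bop H)).
Variables (tau : bop H -> R[i]) (E : bop H -> bop H).
Hypothesis hAEB : tracial_opval_space A tau E B.

Let vB := vn_B hAEB.

(** tau(1) = 1 differs from tau(0). On the zero space every operator inequality would hold, and the
    maximal radius in [Omega] would not exist. *)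
Lemma nontrivial_space : exists x : H, x != 0.
Proof.
apply: contrapT => h; have : (1 : bop H) = 0.
  apply: bop_ext => x; apply: contrapT => /eqP x0; apply: h; exists x.
  exact: x0.
move=> e; have := tau1 hAEB; rewrite e (tau0 hAEB) => /eqP.
by rewrite eq_sym oner_eq0.
Qed.

Lemma op_scalar_adj (k : R[i]) : adj (op_scalar H k) = op_scalar H k^*%C.
Proof. by rewrite /op_scalar op_adjZ op_adj1. Qed.

Lemma op_scalar_le (s t : R) : s <= t -> op_le (op_scalar H s%:C) (op_scalar H t%:C).
Proof.
move=> st x; rewrite subbE !scalebE onebE -scalerBl dotZl -rmorphB -hn_dot -rmorphM/=.
by rewrite ler0c mulr_ge0 ?sqr_ge0 ?subr_ge0.
Qed.

Lemma le_op_scalar (s t : R) : op_le (op_scalar H s%:C) (op_scalar H t%:C) -> s <= t.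
Proof.
move=> h; have [x x0] := nontrivial_space; have := h x.
rewrite subbE !scalebE onebE -scalerBl dotZl -rmorphB -hn_dot -rmorphM/= ler0c.
rewrite pmulr_lge0 ?subr_ge0// exprn_gt0// lt_neqAle hn_ge0 eq_sym andbT.
by apply: contra_neq x0 => /hn_eq0.
Qed.

Lemma op_Im_scalar (t : R) : op_Im (op_scalar H (t%:C * 'i%C)) = op_scalar H t%:C.
Proof.
rewrite /op_Im op_scalar_adj /op_scalar -scalerBl scalerA -complexiE; congr (_ *: _).
have -> : t%:C * 'i%C - (t%:C * 'i%C)^*%C = 2 * 'i%C * t%:C :> R[i].
  by apply/eqP; rewrite eq_complex/=; apply/andP; split; apply/eqP; ring.
by rewrite mulrA mulVf ?mul1r// mulf_neq0 ?pnatr_eq0// eq_complex/= oner_eq0 andbF.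
Qed.

(** Uniqueness of the positive square root: for y = c x - |t| x one finds c y = - |t| y, and
    positivity of c forces y = 0. *)
Lemma op_abs_scalar (t : R) : t != 0 -> op_abs (op_scalar H t%:C) = op_scalar H `|t|%:C.
Proof.
move=> t0; have tp : 0 < `|t| by rewrite normr_gt0.
have tt : adj (op_scalar H t%:C) * op_scalar H t%:C = op_scalar H (`|t| ^+ 2)%:C.
  by rewrite op_scalar_adj conjc_real op_scalarM -rmorphM/= real_normK ?num_real// expr2.
have ge0 : op_ge0 (op_scalar H `|t|%:C).
  by move=> x; rewrite scalebE onebE dotZl -hn_dot -rmorphM/= ler0c mulr_ge0 ?sqr_ge0.
have sq : op_scalar H `|t|%:C * op_scalar H `|t|%:C = op_scalar H (`|t| ^+ 2)%:C.
  by rewrite op_scalarM -rmorphM expr2.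
rewrite /op_abs; have [c0 cc] := xgetPex 0 (ex_intro (fun c => op_ge0 c /\
  c * c = adj (op_scalar H t%:C) * op_scalar H t%:C) _ (conj ge0 (etrans sq (esym tt)))).
move: (xget _ _) c0 cc => c c0 cc; apply: bop_ext => x.
pose y := c x - `|t|%:C *: x.
have cy : c y = - (`|t|%:C *: y).
  rewrite /y bopB bopZ -mulbE cc tt scalebE onebE scalerBr scalerA opprB.
  by rewrite -rmorphM -expr2 addrC.
have : y = 0.
  have := c0 y; rewrite cy dotNl dotZl -hn_dot -rmorphM -rmorphN/= ler0c oppr_ge0.
  by rewrite pmulr_rle0// => h; apply: hn_eq0; apply/eqP; rewrite -sqrf_eq0 eq_le h sqr_ge0.
by rewrite /y => /eqP; rewrite subr_eq0 => /eqP ->.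
Qed.

Lemma d_Omega n (l : R) : (0 < n)%N -> 0 < l -> Omega B (@d_ R H n l).
Proof.
move=> n0 l0; exists (\row_k op_scalar H (((-1) ^+ k * l)%:C * 'i%C)), l.
have e1 (k : nat) : `|(-1) ^+ k * l| = l.
  by rewrite normrM normrX normrN1 expr1n mul1r gtr0_norm.
have ne (k : nat) : (-1) ^+ k * l != 0 by rewrite -normr_eq0 e1 gt_eqF.
have absE (k : 'I_(2 * n)) : op_abs (op_Im ((\row_k op_scalar H
    (((-1) ^+ k * l)%:C * 'i%C)) 0 k)) = op_scalar H l%:C.
  by rewrite mxE op_Im_scalar op_abs_scalar// e1.
split.
- move=> k; rewrite mxE; case: ifP => ok.
    split; first exact: vN_scalar.
    exists l => //; rewrite op_Im_scalar -rmorphN; apply: op_scalar_le.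
    by rewrite -signr_odd ok expr1 mulN1r.
  split; first exact: vN_scalar.
  exists l => //; rewrite op_Im_scalar; apply: op_scalar_le.
  by rewrite -signr_odd ok expr0 mul1r.
- by split=> // k; rewrite absE; exact: op_scalar_le.
(* Maximality of the radius is read off at one index, which exists because [n] is positive. *)
- move=> s hs; have n2 : (0 < 2 * n)%N by rewrite muln_gt0.
  by have := hs (Ordinal n2); rewrite absE; exact: le_op_scalar.
- by rewrite -d_E; split; [exact: d_mem|rewrite subrr op_norm0].
Qed.

End OmegaMembership.

(** * Uniformity over the family *)

Section UniformEstimate.
Variables (R : realType) (H : hilbertType R) (A B : set (bop H)).
Variables (tau : bop H -> R[i]) (E : bop H -> bop H).
Hypothesis hAEB : tracial_opval_space A tau E B.
Hypothesis hB : finite_dimensional B.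
Variables (I : Type) (X : I -> unbounded H).
Hypotheses (hXA : forall i, affiliated A (X i)) (hXsa : forall i, uself_adjoint (X i)).
Variable e : I -> set (measurableTypeR R) -> bop H.
Hypothesis he : forall i, spectral_measure (X i) (e i).
Hypothesis htight : tight (fun i S => complex.Re (tau (e i S))).

Lemma uniform_estimate n (eta : R) : 0 < eta -> exists2 l0 : R, 0 < l0 &
  forall i, @resolvent_estimate R H A B E n (X i) eta l0.
Proof.
move=> eta0; have [C C0 hC] := map_E_proj_bound hAEB (2 * n) hB.
(* Half of [eta] is allotted to the tail: 4 bounds the defect and sqrt(tau(Q)) <= s. Tightness is
   therefore used at [s ^ 2]. *)
pose s := eta / (8 * (C + 1)).
have C1 : 0 < C + 1 by lra.
have s0 : 0 < s by rewrite divr_gt0// mulr_gt0.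
have Cs : C * (4 * s) <= eta / 2.
  have : (C + 1) * (4 * s) = eta / 2 by rewrite /s; field; rewrite gt_eqF.
  by move: (C) (s) s0 => c t t0; lra.
have [K cK hK] := htight (exprn_gt0 2 s0).
have hC' a c q := hC a q c.
have [T T0 hT] : exists2 T : R, 0 <= T & forall t, K t -> `|t| <= T.
  have [M [_ hM]] := compact_bounded cK; exists (`|M| + 1); first by rewrite addr_ge0.
  move=> t Kt; apply: hM Kt; apply: (le_lt_trans (ler_norm M)); lra.
have mK : measurable (K : set (measurableTypeR R)).
  by apply: closed_measurable; apply: compact_closed => //; exact: Rhausdorff.
have T1 : 0 < T + 1 by lra.
(* The other half pays for C |c| T with |c| <= 2 l. The compact set, hence [T], serves all [i], and
   so does this threshold; adding 1 keeps the denominators positive. *)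
exists (eta / (4 * (C + 1) * (T + 1))).
  by rewrite divr_gt0// !mulr_gt0.
move=> i l b c z l0 ll nb hc cl Az.
have Ab := mx_in_BA hAEB nb.1.
have [k1 k2] := resolvent_defects l0 nb cl.
have tQ : Num.sqrt (complex.Re (tau (e i (~` K)))) <= s.
  by rewrite -[leRHS](gtr0_norm s0) -sqrtr_sqr ler_wsqrtr// ltW.
have CT : C * (op_norm c * T) <= eta / 2.
  have e1 : (C + 1) * (2 * (eta / (4 * (C + 1) * (T + 1))) * (T + 1)) = eta / 2.
    by field; rewrite !gt_eqF.
  rewrite -e1; apply: ler_pM; rewrite ?lerDl ?mulr_ge0 ?op_norm_ge0//.
  apply: ler_pM; rewrite ?lerDl ?op_norm_ge0//.
  by apply: (le_trans cl); rewrite ler_pM2l// ltW.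
have key : C * (op_norm c * T + 4 * Num.sqrt (complex.Re (tau (e i (~` K))))) <= eta.
  rewrite mulrDr [leRHS]splitr; apply: lerD => //; apply: le_trans Cs.
  by rewrite ler_wpM2l// ler_pM2l.
split.
  apply: le_trans (estimate_left hAEB (hXA i) (hXsa i) (he i) C0 hC' mK T0 hT hc Ab k1 Az) _.
  by rewrite ler_wpM2r ?op_norm_ge0.
apply: le_trans (estimate_right hAEB (hXA i) (hXsa i) (he i) C0 hC' mK T0 hT hc Ab k2 Az) _.
by rewrite ler_wpM2r ?op_norm_ge0.
Qed.

Lemma resolvent_estimate_le n eta (l0 l1 : R) i : l1 <= l0 ->
  @resolvent_estimate R H A B E n (X i) eta l0 ->
  @resolvent_estimate R H A B E n (X i) eta l1.
Proof.
move=> l10 h l b c z lp ll; apply: h => //; exact: lt_le_trans l10.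
Qed.

Section FixedLevel.
Variables (n : nat) (i : I) (lam : R).
Hypotheses (n0 : (0 < n)%N) (lam0 : 0 < lam).
Local Notation mat := 'M[bop H]_(2 * n).
Local Notation d := (@d_ R H n).
Local Notation G := (cauchy_transform A E (X i) (m := 2 * n)).
Hypothesis hest : @resolvent_estimate R H A B E n (X i) 100^-1 lam.

Let vB := vn_B hAEB.
Let c0 : 0 <= 100^-1 :> R. Proof. by rewrite invr_ge0. Qed.
Let c1 : 100 * 100^-1 <= 1 :> R. Proof. by rewrite divff ?pnatr_eq0. Qed.

Definition inv_domain : set mat := [set b | exists2 l, 0 < l < lam & near_inv B l b].
Definition R_domain : set mat :=
  [set w | exists2 l, 0 < l < lam & op_ball B (d l) (l / 8) w].
Definition G_inv w : mat := xget 0 [set b | inv_domain b /\ G b = w].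

Lemma ball_open (b0 : mat) r b : op_ball B b0 r b ->
  exists2 s, 0 < s & op_ball B b s `<=` op_ball B b0 r.
Proof.
move=> [Bb bd]; exists (r - op_norm (b - b0)); first by rewrite subr_gt0.
move=> c [Bc cb]; split=> //; apply: (le_lt_trans (op_norm_tri b _ _)).
by rewrite -ltrBrDr.
Qed.

Lemma inv_domain_open : mx_open B inv_domain.
Proof.
split=> [b [l _ []]//|b [l ll nb]].
have [s s0 hs] := @ball_open (d (- l^-1)) (2^-1 * l^-1) b nb.
by exists s => // c /hs hc; exists l.
Qed.

Lemma R_domain_open : mx_open B R_domain.
Proof.
split=> [w [l _ []]//|w [l ll hw]].
by have [s s0 hs] := ball_open hw; exists s => // c /hs hc; exists l.
Qed.

(** Centres and radii of the balls are both linear in [l], so a convex combination of points lies in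
    the ball at the combined [l]. *)
Lemma R_domain_convex : mx_convex R_domain.
Proof.
move=> x y t [l /andP[l1 l2] [Bx xd]] [l' /andP[l1' l2'] [By yd]] /andP[t0 t1].
have t0' : 0 <= 1 - t by rewrite subr_ge0.
exists ((1 - t) * l + t * l').
  apply/andP; split.
    (* [t = 0] is treated apart, because the strict inequality is taken from the term with factor
       [t]. *)
    have [->|tn] := eqVneq t 0; first by rewrite subr0 mul1r mul0r addr0.
    have tp : 0 < t by rewrite lt_neqAle eq_sym tn.
    by apply: ltr_wpDl; [rewrite mulr_ge0// ltW|rewrite mulr_gt0].
  have [->|tn] := eqVneq t 0; first by rewrite subr0 mul1r mul0r addr0.
  have tp : 0 < t by rewrite lt_neqAle eq_sym tn.
  have -> : lam = (1 - t) * lam + t * lam by ring.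
  by apply: ler_ltD; [rewrite ler_wpM2l// ltW|rewrite ltr_pM2l].
split.
  by move=> j k; rewrite !mxE; apply: (vND vB); apply: (vNZ vB).
rewrite d_lin /mx_segment opprD addrACA -!mx_real_scaleB.
apply: (le_lt_trans (op_normD _ _)).
apply: (le_lt_trans (lerD (op_norm_real_scale _ _) (op_norm_real_scale _ _))).
rewrite (ger0_norm t0) (ger0_norm t0').
have -> : ((1 - t) * l + t * l') / 8 = (1 - t) * (l / 8) + t * (l' / 8) by ring.
have [->|tn] := eqVneq t 0; first by rewrite subr0 !mul1r !mul0r !addr0.
have tp : 0 < t by rewrite lt_neqAle eq_sym tn.
by apply: ler_ltD; [rewrite ler_wpM2l// ltW|rewrite ltr_pM2l].
Qed.

Lemma G_inj_domain b b' : inv_domain b -> inv_domain b' -> G b = G b' -> b = b'.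
Proof.
move=> [l /andP[l1 l2] nb] [l' /andP[l1' l2'] nb'].
exact: (G_inj hAEB (hXA i) (hXsa i) c0 hest c1 l1 l2 l1' l2' nb nb').
Qed.

Lemma G_invP w : R_domain w -> inv_domain (G_inv w) /\ G (G_inv w) = w.
Proof.
move=> [l /andP[l1 l2] hw].
have [b [nb Gb _ _]] := G_surj hAEB (hXA i) (hXsa i) c0 hest c1 l1 l2 hw.
have Ub : inv_domain b by exists l; rewrite ?l1.
by have := xgetPex 0 (ex_intro (fun b => inv_domain b /\ G b = w) _ (conj Ub Gb)).
Qed.

Lemma G_inv_unique w b : inv_domain b -> G b = w -> R_domain w -> G_inv w = b.
Proof. by move=> Ub Gb /G_invP[U' G']; apply: G_inj_domain => //; rewrite G'. Qed.

Lemma d_in_R_domain l : 0 < l < lam -> R_domain (d l).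
Proof.
move=> /andP[l1 l2]; exists l; rewrite ?l1//.
by split; [exact: d_mem|rewrite subrr op_norm0 divr_gt0].
Qed.

(** The fixed value 1/100 only bounds the norm by 3/100. For a given [eps] the estimate is invoked
    again with a smaller [eta], and injectivity on the large domain identifies the preimage so found
    with the branch [G_inv]. *)
Lemma G_inv_asymp :
  op_norm (d l *m G_inv (d l) - 1%:M) @[l --> (0 : R)^'+] --> (0 : R).
Proof.
apply/cvgrPdist_le => eps eps0.
(* eps/3 controls the error 3 eta; the cap 1/100 keeps the inversion valid. *)
pose eta := Num.min (eps / 3) 100^-1.
have eta0 : 0 < eta by rewrite lt_min divr_gt0//= invr_gt0.
have eta1 : 100 * eta <= 1.
  have : eta <= 100^-1 by rewrite ge_min lexx orbT.
  by rewrite -(ler_pM2l (x := 100)) ?divff ?pnatr_eq0// ltr0n.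
have eta2 : 3 * eta <= eps.
  have : eta <= eps / 3 by rewrite ge_min lexx.
  by lra.
have [l0 l00 /(_ i) hl0] := uniform_estimate n eta0.
near=> l.
have lp : 0 < l by near: l; exact: nbhs_right_gt.
have ll : l < lam by near: l; exact: nbhs_right_lt.
have ll0 : l < l0 by near: l; exact: nbhs_right_lt.
have lb : op_ball B (d l) (l / 8) (d l).
  by split; [exact: d_mem|rewrite subrr op_norm0 divr_gt0].
have [b [nb Gb h _]] := G_surj hAEB (hXA i) (hXsa i) (ltW eta0) hl0 eta1 lp ll0 lb.
have lin : 0 < l < lam by rewrite lp.
rewrite (@G_inv_unique _ b)//; last 2 first.
- by exists l.
- exact: d_in_R_domain.
by rewrite sub0r normrN ger0_norm ?op_norm_ge0// (le_trans h).
Unshelve. all: by end_near.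
Qed.

Lemma R_transform_exists :
  is_R_transform A E B (X i) R_domain (fun w => G_inv w - minv w).
Proof.
exists inv_domain, G_inv; split.
- split; [exact: inv_domain_open| |exact: G_inj_domain].
  move=> b [l /andP[l1 l2] nb]; split; first exact: nb.1.
  by have [c hc _] := near_resolvent hAEB l1 nb (hXA i) (hXsa i); exists c.
- exact: convex_mx_connected R_domain_open R_domain_convex.
- exact: G_invP.
- split; last exact: G_inv_asymp.
  near=> l; apply: d_in_R_domain; apply/andP; split.
    by near: l; exact: nbhs_right_gt.
  by near: l; exact: nbhs_right_lt.
- move=> w [l /andP[l1 l2] hw]; exists (minv w).
  have [_ [_ _ _ [[h1 h2] h3]]] := G_surj hAEB (hXA i) (hXsa i) c0 hest c1 l1 l2 hw.
  by split.
Unshelve. all: by end_near.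
Qed.

End FixedLevel.
End UniformEstimate.

(** Halving forces strict decrease, and the minimum keeps the sequence below [f]. *)
Fixpoint shrink (R : realType) (f : nat -> R) n : R :=
  if n is k.+1 then Num.min (shrink f k / 2) (f n) else f 0%N.

Lemma shrinkP (R : realType) (f : nat -> R) : (forall n, 0 < f n) ->
  forall n, [/\ 0 < shrink f n, shrink f n <= f n & shrink f n.+1 < shrink f n].
Proof.
move=> f0; have pos n : 0 < shrink f n.
  by elim: n => //= n ih; rewrite lt_min f0 divr_gt0.
move=> n; split=> //; first by case: n => //= n; rewrite ge_min lexx orbT.
by rewrite /= gt_min ltr_pdivrMr// ltr_pMr// ltr1n.
Qed.

(** The first conjunct is the membership that the informal statement asserts along with the
    definition of d_n. Levels are the positive integers, and decrease of p_n as l tends to 0 is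
    expressed as strict increase in [l]. *)
Theorem theorem6p1 (R : realType) (H : hilbertType R)
    (A : set (bop H)) (tau : bop H -> R[i]) (E : bop H -> bop H)
    (B : set (bop H))
    (hAEB : tracial_opval_space A tau E B)
    (hB : finite_dimensional B)
    (I : Type) (X : I -> unbounded H)
    (hXA : forall i, affiliated A (X i))
    (hXsa : forall i, uself_adjoint (X i))
    (e : I -> set (measurableTypeR R) -> bop H)
    (he : forall i, spectral_measure (X i) (e i))
    (htight : tight (fun i S => complex.Re (tau (e i S)))) :
  (forall (n : nat) (l : R), (0 < n)%N -> 0 < l -> Omega B (d_ H n l)) /\
  exists (lam : nat -> R) (p : nat -> R -> R),
    [/\ forall n, (0 < n)%N -> 0 < lam n,
        forall n, (0 < n)%N -> lam n.+1 < lam n &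
        forall n, (0 < n)%N ->
          [/\ forall l, 0 < l < lam n -> 0 < p n l,
              forall l l', 0 < l -> l < l' -> l' < lam n -> p n l < p n l',
              (p n : R -> R^o) =O_ ((0 : R)^'+) (id : R -> R^o) &
              forall i, exists D Rt,
                is_R_transform A E B (X i) D Rt /\
                forall l, 0 < l < lam n -> op_ball B (d_ H n l) (p n l) `<=` D]].
Proof.
split; first by move=> n l n0 l0; exact: (d_Omega hAEB n0 l0).
have c0 : 0 < 100^-1 :> R by rewrite invr_gt0.
(* [eta] is the same at every level; the threshold varies with [n] through the constant for matrices
   of size 2n. *)
have /choice[f hf] : forall n, exists l0 : R, 0 < l0 /\
    forall i, @resolvent_estimate R H A B E n (X i) 100^-1 l0.
  move=> n; have [l0 l00 h] := uniform_estimate hAEB hB hXA hXsa he htight n c0.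
  by exists l0.
have sh := shrinkP (fun n => (hf n).1).
(* The radius l/8 is the one for which the fixed point was found. *)
exists (shrink f), (fun _ l => l / 8); split.
- by move=> n _; case: (sh n).
- by move=> n _; case: (sh n).
move=> n n0; have [lam0 lamf _] := sh n; split.
- by move=> l /andP[l0 _]; rewrite divr_gt0.
- by move=> l l' _ ll' _; rewrite ltr_pM2r// invr_gt0.
- apply/eqOP; near=> k; near=> x; rewrite normrM mulrC.
  rewrite ler_wpM2r// ger0_norm ?invr_ge0//; near: k; exact: nbhs_pinfty_ge.
- move=> i; have hest := resolvent_estimate_le lamf ((hf n).2 i).
  exists (@R_domain R H B n (shrink f n)), (fun w =>
    @G_inv R H A B E I X n i (shrink f n) w - minv w).
  split; first exact: (R_transform_exists hAEB hB hXA hXsa he htight).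
  by move=> l ll w hw; exists l.
Unshelve. all: by end_near.
Qed.
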